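(* For any permutations $\sigma_1,\dots,\sigma_5$ and real numbers $c_1,\dots,c_5\ge 0$, the linear combination $\sum_{i=1}^5 c_i\sigma_i$ is not quasirandom-forcing.
   Context: A permutation of order $n$ is a bijection $\pi:[n]\to[n]$; $|\pi|$ denotes its order. For permutations $\sigma\in S_k$ and $\pi\in S_n$, a copy of $\sigma$ in $\pi$ is a set $\{x_1<\dots<x_k\}\subseteq[n]$ with $\pi(x_i)<\pi(x_j)$ iff $\sigma(i)<\sigma(j)$. The density $d(\sigma,\pi)$ is the number of copies of $\sigma$ in $\pi$ divided by $\binom{n}{k}$ if $k\le n$, and $0$ if $k>n$; it is extended linearly to formal linear combinations of permutations. A sequence $(\pi_n)$ of permutations is quasirandom if $\lim_{n\to\infty} d(\sigma,\pi_n)=1/|\sigma|!$ for every permutation $\sigma$. A linear combination $\sum_{i} c_i\sigma_i$ is quasirandom-forcing if every sequence $(\pi_n)$ with $|\pi_n|\to\infty$ and $\lim_{n} d(\sum_i c_i\sigma_i,\pi_n)=\sum_i c_i/|\sigma_i|!$ is quasirandom. *)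

(* Defs.v *)
From mathcomp Require Import all_boot all_order all_fingroup all_algebra.
From mathcomp Require Import all_classical all_reals all_analysis.

Set Implicit Arguments.
Unset Strict Implicit.
Unset Printing Implicit Defensive.

Import Order.TTheory GRing.Theory Num.Theory numFieldNormedType.Exports.

Local Open Scope classical_set_scope.
Local Open Scope ring_scope.

(* The ground set [n] = {1, .., n} is 'I_n = {0, .., n-1}; only the relative
   order of its elements matters below. *)
Definition permutation : Type := {n : nat & 'S_n}.

Definition perm_order (p : permutation) : nat := tag p.

(* f is the increasing enumeration x_1 < .. < x_k of X. *)
Definition is_copy (k n : nat) (s : 'S_k) (p : 'S_n) (X : {set 'I_n}) : bool :=
  [exists f : {ffun 'I_k -> 'I_n},
    [&& [forall i : 'I_k, forall j : 'I_k, (i < j)%N ==> (f i < f j)%N],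
        X == [set f i | i : 'I_k]%SET
      & [forall i : 'I_k, forall j : 'I_k, (p (f i) < p (f j))%N == (s i < s j)%N]]].

Definition ncopies (k n : nat) (s : 'S_k) (p : 'S_n) : nat :=
  #|[set X : {set 'I_n} | is_copy s p X]%SET|.

Definition density (R : realType) (s p : permutation) : R :=
  let k := perm_order s in
  let n := perm_order p in
  if (k <= n)%N then (ncopies (tagged s) (tagged p))%:R / 'C(n, k)%:R else 0.

(* A formal linear combination \sum_(i < m) c_i s_i is given by the families
   of its coefficients and of its permutations. *)
Definition lin_density (R : realType) (m : nat) (c : 'I_m -> R)
    (s : 'I_m -> permutation) (p : permutation) : R :=
  \sum_(i < m) c i * density R (s i) p.

Definition quasirandom (R : realType) (p : nat -> permutation) : Prop :=
  forall s : permutation,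
    (fun n => density R s (p n)) @ \oo --> (((perm_order s)`!%:R)^-1 : R).

Definition quasirandom_forcing (R : realType) (m : nat) (c : 'I_m -> R)
    (s : 'I_m -> permutation) : Prop :=
  forall p : nat -> permutation,
    (fun n => perm_order (p n)) @ \oo --> \oo ->
    (fun n => lin_density c s (p n)) @ \oo -->
      (\sum_(i < m) c i / (perm_order (s i))`!%:R : R) ->
    quasirandom R p.

(* Main.v *)
Require Import Defs.
From Stdlib Require Import BinNat Nnat.
From mathcomp Require Import all_boot all_order all_fingroup all_algebra.
From mathcomp Require Import zify ring lra.
From mathcomp Require Import polyrcf.
Set Implicit Arguments.
Unset Strict Implicit.
Unset Printing Implicit Defensive.
Import Order.TTheory GRing.Theory Num.Theory.
Local Open Scope ring_scope.

(** Suppose the combination is forcing and let [T] be its value in the quasirandom limit. Each step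
    changes densities by O(1/n), so some permutation on the walk has value close to [T]; but the
    fixed initial segment contains too many increasing patterns for quasirandomness ([not_forcing]).
    Hence [T] is an asymptotic maximum or minimum. Sampling from finite weighted point sets, with
    ties broken at random, turns this into an inequality over all such models ([extremal]).

    Every product model attains [T], since there all patterns of one order are equally likely. Now
    perturb the column law in two thin horizontal strips at the bottom. The contribution of first
    order in the mass of the strips must vanish ([first_order]), and so must the antisymmetric part
    of the contribution of second order ([second_order]). For suitable column laws these become
    polynomial identities on a simplex: one in Bernstein form for the position of the lowest value
    ([edge_first]), and one whose monomials record the gaps left of, between and right of the two
    lowest values, with a sign telling which comes first ([edge_second]). With at most five terms,
    such a polynomial is zero or a monomial times a multiple of 1 - X - Y - Z ([newton_normal],
    [edge_dichotomy]). Comparing several sides of the square excludes the second case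
    ([not_exceptional]). So on each side the two extreme values can be exchanged without changing
    the total weight ([bottom_zero]).

    Five items cannot satisfy this in many ways. Order 3 would need all six patterns ([order_neq3]),
    all orders above 2 coincide ([one_order]), and the common order is 4 ([order_four]), with the
    lowest value uniformly distributed over the four positions. Orders at most 2 never contribute to
    a deviation from [T] ([excess]); if no larger order is present, the combination is constant and
    forces nothing ([forcing_large]).

    If [T] is a maximum, some pattern carries a quarter of the weight and has its lowest value at an
    end; an explicit permutation gives it density above 1/6, too much against the mean 1/24
    ([not_maximal]). If [T] is a minimum, the monotone permutations must contain some of the
    patterns, so both monotone patterns of order 4 occur ([lower_witness]). The exchanges then force
    exactly the four patterns of the Klein four-group, with equal weights ([all_klein]), and an
    explicit permutation of order 14 contains them with total density below 1/6 ([not_minimal]). *)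

(** * Sorting integer keys with ties broken at random *)

Lemma rank_perm (n : nat) (key : 'I_n -> int) : injective key ->
  {r : 'S_n | forall t u, (r t < r u)%N = (key t < key u)}.
Proof.
move=> kinj.
pose rk t := #|[set u | key u < key t]|.
have rkn t : (rk t < n)%N.
  rewrite -[X in (_ < X)%N](card_ord n) -cardsT; apply: proper_card.
  by rewrite properT; apply/eqP => /setP/(_ t); rewrite !inE ltxx.
have mono t u : key t < key u -> (rk t < rk u)%N.
  move=> tu; apply: proper_card; apply/properP; split.
    by apply/subsetP => v; rewrite !inE => /lt_trans; apply.
  by exists t; rewrite !inE ?ltxx.
have rinj : injective (fun t => Ordinal (rkn t)).
  move=> t u /(congr1 val) /= E; apply: kinj.
  by case: (ltgtP (key t) (key u)) => // /mono; rewrite E ltnn.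
exists (perm rinj) => t u; rewrite !permE /=.
case: (ltgtP (key t) (key u)) => [/mono //|/mono|/kinj ->]; last by rewrite ltnn.
by move=> h; apply/negbTE; rewrite -leqNgt ltnW.
Qed.

Section Sorted.
Variable k : nat.
Implicit Types (c : 'I_k -> int) (t : 'S_k).

Definition nondecr c := [forall i : 'I_k, forall j : 'I_k, (i <= j)%N ==> (c i <= c j)].

Definition stab c := [set t : 'S_k | [forall i, c (t i) == c i]].

Lemma nondecrP c : reflect (forall i j : 'I_k, (i <= j)%N -> c i <= c j) (nondecr c).
Proof.
apply: (iffP forallP) => h i; first by move=> j; have /forallP/(_ j)/implyP := h i.
by apply/forallP => j; apply/implyP/h.
Qed.

Lemma stabP c t : reflect (forall i, c (t i) = c i) (t \in stab c).
Proof. by rewrite inE; apply: (iffP forallP) => h i; apply/eqP. Qed.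

Lemma eq_nondecr c c' : c =1 c' -> nondecr c = nondecr c'.
Proof. by move=> e; apply/nondecrP/nondecrP => h i j /h; rewrite !e. Qed.

Lemma eq_stab c c' : c =1 c' -> stab c = stab c'.
Proof. by move=> e; apply/setP => t; apply/stabP/stabP => h i; have := h i; rewrite !e. Qed.

Lemma nondecr_perm c t : nondecr c -> nondecr (c \o t) -> c \o t =1 c.
Proof.
move=> /nondecrP nc /nondecrP nct i.
have srt (d : 'I_k -> int) : (forall i j : 'I_k, (i <= j)%N -> d i <= d j) ->
    sorted <=%O [seq d i | i <- enum 'I_k].
  move=> dm; rewrite sorted_map; apply: (@sub_sorted _ (fun i j : 'I_k => (i <= j)%N)).
    by move=> a b /= ab; exact: dm.
  by have := iota_sorted 0 k; rewrite -val_enum_ord sorted_map.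
have pe : perm_eq [seq c i | i <- enum 'I_k] [seq (c \o t) i | i <- enum 'I_k].
  have -> : [seq (c \o t) i | i <- enum 'I_k] = [seq c i | i <- [seq t i | i <- enum 'I_k]].
    by elim: (enum 'I_k) => //= a l ->.
  apply: perm_map; apply: uniq_perm.
  - exact: enum_uniq.
  - by rewrite map_inj_uniq ?enum_uniq //; exact: perm_inj.
  - move=> x; rewrite mem_enum; symmetry; apply/mapP.
    by exists (t^-1%g x); rewrite ?mem_enum // permKV.
have E := sorted_eq le_trans le_anti (srt _ nc) (srt _ nct) pe.
have nthE (d : 'I_k -> int) : nth 0 [seq d i | i <- enum 'I_k] i = d i.
  by rewrite (nth_map i) ?nth_ord_enum // size_enum_ord.
by rewrite -[LHS](nthE (c \o t)) -E nthE.
Qed.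

(** Refining [c] by the injective tie-breaker [r] gives a strict linear order, and a finite linear
    order has exactly one increasing enumeration. *)
Lemma sorting_perm c (r : 'I_k -> nat) : injective r ->
  exists2 s : 'S_k, nondecr (c \o s) &
   forall t : 'S_k, (t == s) = [forall i : 'I_k, forall j : 'I_k, (i < j)%N ==>
     ((c (t i) < c (t j)) || (c (t i) == c (t j)) && (r (t i) < r (t j))%N)].
Proof.
move=> rinj.
(* [N] exceeds every value of [r], so that [key] orders the pairs lexicographically. *)
pose N := (\sum_i (r i).+1)%N.
have rN i : (r i < N)%N by rewrite /N (bigD1 i) //= leq_addr.
pose key i := c i * N%:Z + (r i)%:Z.
have keyE i j : (key i < key j) = (c i < c j) || (c i == c j) && (r i < r j)%N.
  have hi := rN i; have hj := rN j; rewrite /key.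
  case: (ltgtP (c i) (c j)) => h /=.
  - by have : (c i + 1 <= c j); [lia | nia].
  - by apply/negbTE; rewrite -leNgt; have : (c j + 1 <= c i); [lia | nia].
  - by rewrite h; lia.
have kinj : injective key.
  move=> i j E; have := keyE i j; have := keyE j i; rewrite E ltxx.
  case: (ltgtP (c i) (c j)) => //= h; case: (ltngtP (r i) (r j)) => // h' _ _.
  exact: rinj.
have [R hR] := rank_perm kinj.
exists R^-1%g.
  apply/nondecrP => i j; rewrite leq_eqVlt => /orP[/eqP/val_inj->//|ij] /=.
  have := hR (R^-1%g i) (R^-1%g j); rewrite !permKV ij keyE.
  by move/esym/orP => [/ltW//|/andP[/eqP->]].
move=> t; apply/eqP/forallP => [-> i|h].
  apply/forallP => j; apply/implyP => ij.
  by rewrite -keyE -hR !permKV.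
have mono : forall i j : 'I_k, (i < j)%N -> ((t * R)%g i < (t * R)%g j)%N.
  move=> i j ij; rewrite !permM hR keyE.
  by have /forallP/(_ j)/implyP/(_ ij) := h i.
suff : (t * R)%g = 1%g by move/eqP; rewrite -eq_invg_mul -(inj_eq invg_inj) invgK => /eqP->.
pose d i := ((i : 'I_k) : nat)%:Z.
have E := @nondecr_perm d (t * R)%g _ _.
apply/permP => i; rewrite perm1; apply: val_inj.
have := E _ _ i; rewrite /d /= => H.
by apply/eqP; rewrite -eqz_nat H //; apply/nondecrP => a b ab; rewrite lez_nat //=;
  move: ab; rewrite leq_eqVlt => /orP[/eqP/val_inj->//|/mono/ltnW].
Qed.

Lemma card_stab_perm c t : #|stab (c \o t)| = #|stab c|.
Proof.
rewrite -(card_imset _ (@conjg_inj _ t)).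
apply: eq_card => s; apply/imsetP/stabP => [[u /stabP hu ->] i|hs].
  by rewrite conjgE !permM -[in RHS](permKV t i); exact: hu.
exists (s ^ t^-1)%g; last by rewrite conjgKV.
by apply/stabP => i; rewrite conjgE invgK !permM /= permKV hs.
Qed.

(** The permutations that sort [c] form a coset of the stabiliser of the sorted arrangement. This is
    why the denominator in [tie] makes it a probability. *)
Lemma card_sorting c : #|[set t : 'S_k | nondecr (c \o t)]| = #|stab c|.
Proof.
have [s ns _] := @sorting_perm c (fun i => i) val_inj.
rewrite -(card_stab_perm _ s) -[RHS](card_imset _ (mulIg s)).
apply: eq_card => t; rewrite inE; apply/idP/imsetP => [nt|[u /stabP hu ->]].
  exists (t * s^-1)%g; last by rewrite mulgKV.
  apply/stabP => i; rewrite permM /= permKV.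
  suff /(nondecr_perm ns)/(_ i) : nondecr ((c \o s) \o (t * s^-1)%g) by rewrite /= permM permKV.
  by rewrite (@eq_nondecr _ (c \o t)) // => j; rewrite /= permM permKV.
by rewrite (@eq_nondecr _ (c \o s)) // => j; rewrite /= permM; exact: hu.
Qed.

End Sorted.

(** Lets a permutation of the selected indices be absorbed into a uniformly random order of all [n]
    points. *)
Lemma finfun_extend (T : finType) (k n : nat) (g : 'I_k -> 'I_n) (t : 'S_k) :
  injective g -> {u : 'S_n | forall i, u (g i) = g (t i)}.
Proof.
move=> ginj.
pose h (x : 'I_n) := if [pick i | g i == x] is Some i then g (t i) else x.
have hg i : h (g i) = g (t i).
  rewrite /h; case: pickP => [j /eqP/ginj->//|/(_ i)]; by rewrite eqxx.
have hout x : (forall i, g i != x) -> h x = x.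
  by rewrite /h => gx; case: pickP => // i; rewrite (negPf (gx i)).
have hinj : injective h.
  move=> x y.
  case: (pickP (fun i => g i == x)) => [i /eqP <-|nx];
  case: (pickP (fun j => g j == y)) => [j /eqP <-|ny]; rewrite ?hg.
  - by move=> /ginj/perm_inj->.
  - by rewrite (hout y) => [E|a]; [have := ny (t i); rewrite E eqxx | rewrite ny].
  - by rewrite (hout x) => [E|a]; [have := nx (t j); rewrite -E eqxx | rewrite nx].
  - by rewrite !hout // => a; rewrite ?nx ?ny.
by exists (perm hinj) => i; rewrite permE hg.
Qed.

Section Weights.
Variable R : realFieldType.
Variable k : nat.
Implicit Types (c : 'I_k -> int) (t : 'S_k).

(* The probability that [c], with ties broken by a uniformly random order, is
   increasing. *)
Definition tie c : R := (nondecr c)%:R / #|stab c|%:R.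

Lemma stab_gt0 c : 0 < #|stab c|%:R :> R.
Proof.
by rewrite ltr0n; apply/card_gt0P; exists 1%g; apply/stabP => i; rewrite perm1.
Qed.

Lemma tie_ge0 c : 0 <= tie c.
Proof. by rewrite divr_ge0. Qed.

Lemma eq_tie c c' : c =1 c' -> tie c = tie c'.
Proof. by move=> e; rewrite /tie (eq_nondecr e) (eq_stab e). Qed.

Lemma sum_tie c : \sum_(t : 'S_k) tie (c \o t) = 1.
Proof.
rewrite /tie (eq_bigr (fun t : 'S_k => #|stab c|%:R^-1 * (nondecr (c \o t))%:R)); last first.
  by move=> t _; rewrite card_stab_perm mulrC.
rewrite -mulr_sumr -natr_sum.
have -> : (\sum_(i : 'S_k) nondecr (c \o i) = #|stab c|)%N.
  by rewrite -card_sorting -sum1dep_card [RHS]big_mkcond; apply: eq_bigr => t _; case: nondecr.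
by rewrite mulVf // gt_eqF ?stab_gt0.
Qed.

(** Acting by the stabiliser of [c] does not change the law of the random order [r], and for every
    [r] exactly one element of the stabiliser makes the selected points increase. So the event has
    probability 1 / #|stab c| if [c] is nondecreasing, and it is impossible otherwise. *)
Lemma sum_tie_perm (n : nat) (g : 'I_k -> 'I_n) c : injective g ->
  \sum_(r : 'S_n) ([forall i : 'I_k, forall j : 'I_k, (i < j)%N ==>
     ((c i < c j) || (c i == c j) && (r (g i) < r (g j))%N)])%:R = n`!%:R * tie c.
Proof.
move=> ginj.
pose F (h : 'I_k -> 'I_n) : bool := [forall i : 'I_k, forall j : 'I_k, (i < j)%N ==>
     ((c i < c j) || (c i == c j) && (h i < h j)%N)].
rewrite (eq_bigr (fun r : 'S_n => (F (r \o g))%:R)) //.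
have Fnd h : F h -> nondecr c.
  move=> /forallP Fh; apply/nondecrP => i j; rewrite leq_eqVlt => /orP[/eqP/val_inj->//|ij].
  by have /forallP/(_ j)/implyP/(_ ij)/orP[/ltW//|/andP[/eqP->]] := Fh i.
rewrite /tie; case: (boolP (nondecr c)) => nc; last first.
  by rewrite mul0r mulr0 big1 // => r _; case: (boolP (F _)) => // /Fnd; rewrite (negPf nc).
have eqF h h' : h =1 h' -> F h = F h'.
  by move=> e; apply: eq_forallb => i; apply: eq_forallb => j; rewrite !e.
have inv t : \sum_(r : 'S_n) (F (r \o g \o t))%:R = \sum_(r : 'S_n) (F (r \o g))%:R :> R.
  have [u hu] := finfun_extend 'I_k t ginj.
  rewrite [RHS](reindex_inj (mulgI u)); apply: eq_bigr => r _.
  by congr (nat_of_bool _)%:R; apply: eqF => i; rewrite /= permM hu.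
have one r : \sum_(t in stab c) (F ((r : 'S_n) \o g \o t))%:R = 1 :> R.
  have rinj : injective (fun i => (r (g i) : nat)).
    by move=> i j /val_inj/perm_inj/ginj.
  have [s ns hs] := sorting_perm c rinj.
  have sc : s \in stab c by apply/stabP => i; rewrite -[RHS](nondecr_perm nc ns).
  rewrite (bigD1 s) //= big1 ?addr0 => [|t /andP[/stabP tc ts]].
    suff -> : F (r \o g \o s) by [].
    have /esym := hs s; rewrite eqxx => /forallP h; apply/forallP => i.
    by apply/forallP => j; have /forallP/(_ j) := h i; rewrite !(stabP c s sc).
  case: (boolP (F _)) => // Ft; case/negP: ts; rewrite hs.
  move/forallP: Ft => h; apply/forallP => i.
  by apply/forallP => j; have /forallP/(_ j) := h i; rewrite !tc.
have : \sum_(t in stab c) \sum_(r : 'S_n) (F (r \o g \o t))%:R = n`!%:R :> R.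
  rewrite exchange_big /= (eq_bigr (fun=> 1)) => [|r _]; last exact: one.
  by rewrite sumr_const card_Sn.
rewrite (eq_bigr _ (fun t _ => inv t)) sumr_const -[X in X = _]mulr_natr => <-.
by rewrite mul1r mulfK // gt_eqF ?stab_gt0.
Qed.

(** Independent points with one common law are exchangeable, so their k! orders are equally
    likely. *)
Lemma sum_prod_tie (C : finType) (p : C -> R) (x : C -> int) : \sum_a p a = 1 ->
  \sum_(g : {ffun 'I_k -> C}) (\prod_i p (g i)) * tie (x \o g) = k`!%:R^-1.
Proof.
move=> p1.
pose re (t : 'S_k) (g : {ffun 'I_k -> C}) := [ffun i => g (t i)].
have reK t : injective (re t).
  move=> g h /ffunP e; apply/ffunP => i.
  by have := e (t^-1%g i); rewrite !ffunE permKV.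
have inv (t : 'S_k) : \sum_(g : {ffun 'I_k -> C}) (\prod_i p (g i)) * tie (x \o g)
   = \sum_(g : {ffun 'I_k -> C}) (\prod_i p (g i)) * tie ((x \o g) \o t).
  rewrite (reindex_inj (reK t)); apply: eq_bigr => g _; congr (_ * _).
    rewrite [RHS](reindex_inj (@perm_inj _ t)); apply: eq_bigr => i _.
    by rewrite ffunE.
  by apply: eq_tie => i; rewrite /= ffunE.
have : \sum_(t : 'S_k) \sum_(g : {ffun 'I_k -> C}) (\prod_i p (g i)) * tie (x \o g) = 1.
  rewrite (eq_bigr _ (fun t _ => inv t)) exchange_big /=.
  rewrite (eq_bigr (fun g : {ffun 'I_k -> C} => \prod_i p (g i))) => [|g _].
    by rewrite -(bigA_distr_bigA (fun _ => p)) big1 // => i _.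
  by rewrite -mulr_sumr sum_tie mulr1.
rewrite sumr_const card_Sn => E.
have k0 : k`!%:R != 0 :> R by rewrite pnatr_eq0 -lt0n fact_gt0.
by apply: (mulIf k0); rewrite mulr_natr E mulVf.
Qed.

End Weights.

(** * Finite models and random permutations sampled from them *)

Section Model.
Variables (R : realFieldType) (V : finType) (m : V -> R) (x y : V -> int).

(* The probability that [k] independent points with law [m] form the pattern
   [s], ties in either coordinate being broken by independent uniform orders. *)
Definition mdens (k : nat) (s : 'S_k) : R :=
  k`!%:R * \sum_(f : {ffun 'I_k -> V})
    (\prod_i m (f i)) * tie R (x \o f) * tie R (fun v => y (f (s^-1%g v))).

Lemma sum_marginal (k n : nat) (g : 'I_k -> 'I_n) (phi : {ffun 'I_k -> V} -> R) :
  injective g -> \sum_a m a = 1 ->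
  \sum_(f : {ffun 'I_n -> V}) (\prod_t m (f t)) * phi [ffun i => f (g i)]
  = \sum_(h : {ffun 'I_k -> V}) (\prod_i m (h i)) * phi h.
Proof.
move=> ginj m1.
rewrite (partition_big (fun f : {ffun 'I_n -> V} => [ffun i => f (g i)]) predT) //=.
apply: eq_bigr => h _.
rewrite (eq_bigr (fun f : {ffun 'I_n -> V} => (\prod_t m (f t)) * phi h)) => [|f /eqP-> //].
rewrite -mulr_suml; congr (_ * _).
(* The constraint that [h] imposes on coordinate [t] alone, so that the indicator of a restriction
   equal to [h] factors over the coordinates. *)
pose chi (t : 'I_n) (v : V) : bool := [forall i, (g i == t) ==> (h i == v)].
rewrite big_mkcond /=.
rewrite (eq_bigr (fun f : {ffun 'I_n -> V} => \prod_t (m (f t) * (chi t (f t))%:R))) => [|f _].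
  rewrite -(bigA_distr_bigA (fun t v => m v * (chi t v)%:R)) /=.
  rewrite (bigID (mem [set g i | i in 'I_k])) /= [X in _ * X]big1 ?mulr1 => [|t tg].
    rewrite big_imset /=; last by move=> a b _ _ /ginj.
    apply: eq_bigr => i _; rewrite (bigD1 (h i)) //= big1 => [|v vh].
      rewrite addr0 (_ : chi _ _) ?mulr1 //; apply/forallP => j; apply/implyP.
      by move=> /eqP/ginj->.
    rewrite (_ : chi _ _ = false) ?mulr0 //; apply/negbTE; apply/forallPn; exists i.
    by rewrite eqxx /= eq_sym.
  rewrite -[RHS]m1; apply: eq_bigr => v _.
  rewrite (_ : chi t v) ?mulr1 //; apply/forallP => i; apply/implyP => /eqP gi.
  by case/negP: tg; rewrite -gi imset_f.
rewrite big_split /= -natr_prod.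
case: (boolP [forall t, chi t (f t)]) => [/forallP all|/forallPn[t nt]].
  rewrite (_ : [ffun i => f (g i)] == h).
    by rewrite [X in _ * X%:R]big1 ?mulr1 // => t _; rewrite all.
  apply/eqP/ffunP => i; rewrite ffunE; have /forallP/(_ i) := all (g i).
  by rewrite eqxx /= => /eqP.
rewrite [X in _ * X](_ : _ = 0) ?mulr0.
  case: eqP => // e; move: nt; rewrite /chi -e => /forallPn[i]; rewrite ffunE negb_imply => /andP[/eqP->].
  by rewrite eqxx.
by rewrite (bigD1 t) //= (negPf nt) mul0n.
Qed.

End Model.

Lemma incr_image_inj (k n : nat) (f g : {ffun 'I_k -> 'I_n}) :
  [forall i : 'I_k, forall j : 'I_k, (i < j)%N ==> (f i < f j)%N] ->
  [forall i : 'I_k, forall j : 'I_k, (i < j)%N ==> (g i < g j)%N] ->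
  [set f i | i : 'I_k] = [set g i | i : 'I_k] -> f = g.
Proof.
have mono (h : {ffun 'I_k -> 'I_n}) :
    [forall i : 'I_k, forall j : 'I_k, (i < j)%N ==> (h i < h j)%N] ->
    forall i j : 'I_k, (h i < h j)%N = (i < j)%N.
  move=> /forallP hm i j; apply/idP/idP => [|ij]; last by have /forallP/(_ j)/implyP/(_ ij) := hm i.
  apply: contraLR; rewrite -!leqNgt leq_eqVlt => /orP[/eqP/val_inj->//|ji].
  by have /forallP/(_ i)/implyP/(_ ji)/ltnW := hm j.
move=> /mono fm /mono gm E.
have inj (h : {ffun 'I_k -> 'I_n}) : (forall i j : 'I_k, (h i < h j)%N = (i < j)%N) -> injective h.
  move=> hm i j e; apply: val_inj; have := hm i j; have := hm j i.
  by rewrite e ltnn; case: ltngtP.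
have card_below (h : {ffun 'I_k -> 'I_n}) i : (forall i j : 'I_k, (h i < h j)%N = (i < j)%N) ->
    #|[set x in [set h i | i : 'I_k] | (x < h i)%N]| = i.
  move=> hm; rewrite (_ : [set x in _ | _] = [set h j | j : 'I_k & (j < i)%N]).
    rewrite card_imset; last exact: inj.
    by rewrite -sum1dep_card (big_ord_narrow (ltnW (ltn_ord i))) sum1_card card_ord.
  apply/setP => x; rewrite !inE; apply/andP/imsetP => [[/imsetP[j _ ->]]|[j]].
    by rewrite hm => ji; exists j; rewrite ?inE.
  by rewrite inE => ji ->; rewrite hm imset_f.
apply/ffunP => i.
have /imsetP[j _ e] : f i \in [set g i | i : 'I_k] by rewrite -E imset_f.
rewrite e; congr (g _); apply: val_inj => /=.
by rewrite -(card_below f i fm) -(card_below g j gm) E e.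
Qed.

Lemma ncopiesE (k n : nat) (s : 'S_k) (p : 'S_n) : ncopies s p =
  #|[set f : {ffun 'I_k -> 'I_n} |
     [forall i : 'I_k, forall j : 'I_k, (i < j)%N ==> (f i < f j)%N] &&
     [forall i : 'I_k, forall j : 'I_k, (p (f i) < p (f j))%N == (s i < s j)%N]]|.
Proof.
rewrite /ncopies -[RHS](@card_in_imset _ _ (fun f : {ffun 'I_k -> 'I_n} => [set f i | i : 'I_k])).
  apply: eq_card => X; rewrite inE; apply/existsP/imsetP => [[f /and3P[f1 /eqP f2 f3]]|[f]].
    by exists f => //; rewrite inE f1.
  by rewrite inE => /andP[f1 f2] ->; exists f; rewrite f1 f2 eqxx.
move=> f g; rewrite !inE => /andP[f1 _] /andP[g1 _].
exact: incr_image_inj.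
Qed.

(** Here the permutation is the point set with horizontal ranks [rx] and vertical ranks [ry].
    Counting maps into the points, rather than into positions, treats the two coordinates alike. *)
Lemma ncopies_keys (k n : nat) (s : 'S_k) (rx ry : 'S_n) : ncopies s (rx^-1 * ry)%g =
  #|[set g : {ffun 'I_k -> 'I_n} |
     [forall i : 'I_k, forall j : 'I_k, (i < j)%N ==> (rx (g i) < rx (g j))%N] &&
     [forall v : 'I_k, forall w : 'I_k, (v < w)%N ==>
        (ry (g (s^-1%g v)) < ry (g (s^-1%g w)))%N]]|.
Proof.
rewrite ncopiesE.
pose h (g : {ffun 'I_k -> 'I_n}) := [ffun i => rx (g i)].
have hinj : injective h.
  by move=> g g' /ffunP e; apply/ffunP => i; have := e i; rewrite !ffunE => /perm_inj.
rewrite -[RHS](card_imset _ hinj); apply: eq_card => f; rewrite inE; apply/andP/imsetP.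
  move=> [/forallP f1 /forallP f2]; exists [ffun i => rx^-1%g (f i)]; last first.
    by apply/ffunP => i; rewrite !ffunE permKV.
  rewrite inE; apply/andP; split.
    apply/forallP => i; apply/forallP => j; rewrite !ffunE !permKV.
    by have /forallP/(_ j) := f1 i.
  apply/forallP => v; apply/forallP => w; rewrite !ffunE; apply/implyP => vw.
  have /forallP/(_ (s^-1%g w))/eqP := f2 (s^-1%g v).
  by rewrite !permM !permKV vw.
case=> g; rewrite inE => /andP[/forallP g1 /forallP g2] ->; split.
  by apply/forallP => i; apply/forallP => j; rewrite !ffunE; have /forallP/(_ j) := g1 i.
apply/forallP => i; apply/forallP => j; rewrite !ffunE !permM !permK.
have H (a b : 'I_k) : (s a < s b)%N -> (ry (g a) < ry (g b))%N.
  by have /forallP/(_ (s b))/implyP := g2 (s a); rewrite !permK.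
case: (ltngtP (s i) (s j)) => [/H->//|/H|/val_inj/perm_inj->]; last by rewrite ltnn.
by case: ltngtP.
Qed.

Section Sampling.
Variables (R : realFieldType) (V : finType) (m : V -> R) (x y : V -> int).
Hypotheses (m0 : forall a, 0 <= m a) (m1 : \sum_a m a = 1).

Definition lexkey (n : nat) (c : 'I_n -> int) (r : 'S_n) (t : 'I_n) : int :=
  c t * n%:Z + (r t : nat)%:Z.

Lemma lexkey_lt n (c : 'I_n -> int) (r : 'S_n) t u :
  (lexkey c r t < lexkey c r u) = (c t < c u) || (c t == c u) && (r t < r u)%N.
Proof.
have ht := ltn_ord (r t); have hu := ltn_ord (r u); rewrite /lexkey.
case: (ltgtP (c t) (c u)) => h /=.
- by have : (c t + 1 <= c u); [lia | nia].
- by apply/negbTE; rewrite -leNgt; have : (c u + 1 <= c t); [lia | nia].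
- by rewrite h; lia.
Qed.

Lemma lexkey_inj n (c : 'I_n -> int) (r : 'S_n) : injective (lexkey c r).
Proof.
move=> i j E; have := lexkey_lt c r i j; have := lexkey_lt c r j i; rewrite E ltxx.
by case: (ltgtP (c i) (c j)) => //= h; case: (ltngtP (r i) (r j)) => // /val_inj/perm_inj.
Qed.

(** The permutation read off from [n] points of the model: [o] holds the points and, for each
    coordinate, an order that decides between ties. *)
Definition sample (n : nat) (o : {ffun 'I_n -> V} * 'S_n * 'S_n) : 'S_n :=
  ((sval (rank_perm (@lexkey_inj n (x \o o.1.1) o.1.2)))^-1 *
    sval (rank_perm (@lexkey_inj n (y \o o.1.1) o.2)))%g.

Definition sample_weight (n : nat) (o : {ffun 'I_n -> V} * 'S_n * 'S_n) : R :=
  (\prod_t m (o.1.1 t)) / (n`!%:R * n`!%:R).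

Lemma sample_weight_ge0 n o : 0 <= @sample_weight n o.
Proof. by rewrite divr_ge0 ?mulr_ge0 // prodr_ge0. Qed.

Lemma sum_sample_weight n : \sum_o @sample_weight n o = 1.
Proof.
rewrite -(pair_big predT predT (fun a b => @sample_weight n (a, b))) /=.
rewrite -(pair_big predT predT (fun a b => \sum_c @sample_weight n ((a, b), c))) /=.
rewrite /sample_weight /=.
under eq_bigr do rewrite !sumr_const card_Sn.
rewrite !sumrMnl -mulr_suml -(bigA_distr_bigA (fun _ => m)) big1 //.
have n0 : n`!%:R != 0 :> R by rewrite pnatr_eq0 -lt0n fact_gt0.
by rewrite mul1r -mulrnA -[LHS]mulr_natr natrM mulVf // mulf_neq0.
Qed.

(** Any [k] of the sampled points are themselves a sample, so the expectation does not depend on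
    [n]. Copies are counted over all maps [g]: those that are not injective contribute nothing, and
    each of the n ^_ k injective ones contributes [mdens] divided by k!. *)
Lemma expected_density (k n : nat) (s : 'S_k) : (k <= n)%N ->
  \sum_o @sample_weight n o * ((ncopies s (sample o))%:R / 'C(n, k)%:R) = mdens m x y s.
Proof.
move=> kn.
have n0 : n`!%:R != 0 :> R by rewrite pnatr_eq0 -lt0n fact_gt0.
pose A (f : {ffun 'I_n -> V}) (r : 'S_n) (g : {ffun 'I_k -> 'I_n}) : bool :=
  [forall i : 'I_k, forall j : 'I_k, (i < j)%N ==>
     ((x (f (g i)) < x (f (g j))) || (x (f (g i)) == x (f (g j))) && (r (g i) < r (g j))%N)].
pose B (f : {ffun 'I_n -> V}) (r : 'S_n) (g : {ffun 'I_k -> 'I_n}) : bool :=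
  [forall v : 'I_k, forall w : 'I_k, (v < w)%N ==>
     ((y (f (g (s^-1%g v))) < y (f (g (s^-1%g w)))) ||
      (y (f (g (s^-1%g v))) == y (f (g (s^-1%g w)))) && (r (g (s^-1%g v)) < r (g (s^-1%g w)))%N)].
have cE o : (ncopies s (sample o))%:R = \sum_g (A o.1.1 o.1.2 g)%:R * (B o.1.1 o.2 g)%:R :> R.
  rewrite /sample; case: rank_perm => rx hx; case: rank_perm => ry hy /=.
  rewrite ncopies_keys -sum1_card natr_sum big_mkcond /=; apply: eq_bigr => g _.
  rewrite inE -natrM mulnb.
  under eq_forallb do under eq_forallb do rewrite hx lexkey_lt.
  under [X in _ && X]eq_forallb do under eq_forallb do rewrite hy lexkey_lt.
  by rewrite -/(A o.1.1 o.1.2 g) -/(B o.1.1 o.2 g); case: (A _ _ _); case: (B _ _ _).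
under eq_bigr do rewrite cE mulrA mulr_sumr.
rewrite -mulr_suml exchange_big /=.
have key (g : {ffun 'I_k -> 'I_n}) :
    \sum_o @sample_weight n o * ((A o.1.1 o.1.2 g)%:R * (B o.1.1 o.2 g)%:R)
    = (injectiveb g)%:R * (mdens m x y s / k`!%:R).
  case: (boolP (injectiveb g)) => [/injectiveP ginj|gn]; last first.
    rewrite mul0r big1 // => o _; case: (boolP (A _ _ _)) => [/forallP Ag|]; last by rewrite mul0r mulr0.
    case/negP: gn; apply/injectiveP => i j e; apply: val_inj.
    have h a b : g a = g b -> ~~ (a < b)%N.
      move=> ab; apply/negP => lt; have /forallP/(_ b)/implyP/(_ lt) := Ag a.
      by rewrite ab ltxx ltnn andbF.
    by have := h i j e; have := h j i (esym e); case: ltngtP.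
  rewrite mul1r /mdens mulrC mulKf ?pnatr_eq0 -?lt0n ?fact_gt0 //.
  rewrite -(pair_big predT predT (fun a b => @sample_weight n (a, b) *
     ((A a.1 a.2 g)%:R * (B a.1 b g)%:R))) /=.
  rewrite -(pair_big predT predT (fun a b => \sum_c @sample_weight n ((a, b), c) *
     ((A a b g)%:R * (B a c g)%:R))) /=.
  under eq_bigr => f _.
    under eq_bigr => r _ do rewrite /sample_weight /= -mulr_sumr -mulr_sumr.
    rewrite -mulr_sumr -mulr_suml.
    rewrite (sum_tie_perm R (fun i => x (f (g i))) ginj).
    rewrite (@sum_tie_perm R k n (fun v => g (s^-1%g v)) (fun v => y (f (g (s^-1%g v))))); last first.
      by move=> a b /ginj/perm_inj.
    rewrite mulrA (_ : _ * _ * _ = (\prod_t m (f t)) * (tie R (x \o [ffun i => f (g i)]) *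
       tie R (fun v => y ([ffun i => f (g i)] (s^-1%g v))))); last first.
      rewrite (@eq_tie R k _ (x \o [ffun i => f (g i)])) => [|i]; last by rewrite /= ffunE.
      rewrite [X in _ * (_ * X)](@eq_tie R k _ (fun v => y ([ffun i => f (g i)] (s^-1%g v)))); last first.
        by move=> v; rewrite ffunE.
      by field.
    over.
  rewrite (sum_marginal (fun h => tie R (x \o h) * tie R (fun v => y (h (s^-1%g v)))) ginj m1).
  by apply: eq_bigr => h _; rewrite mulrA.
under eq_bigr do rewrite key.
rewrite -mulr_suml -natr_sum.
have -> : (\sum_(g : {ffun 'I_k -> 'I_n}) injectiveb g = n ^_ k)%N.
  rewrite -[k in RHS]card_ord -[n in RHS]card_ord -card_inj_ffuns -sum1dep_card [RHS]big_mkcond.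
  by apply: eq_bigr => g _; case: injectiveb.
rewrite -bin_ffact natrM.
have b0 : 'C(n, k)%:R != 0 :> R by rewrite pnatr_eq0 -lt0n bin_gt0.
have k0 : k`!%:R != 0 :> R by rewrite pnatr_eq0 -lt0n fact_gt0.
by field; rewrite b0 k0.
Qed.

End Sampling.

(** * Thin strips: expanding densities in the mass of a strip *)

Lemma poly_le0_at0 (R : rcfType) (p : {poly R}) (s0 : R) : 0 < s0 ->
  (forall s, 0 < s -> s < s0 -> p.[s] <= 0) -> p.[0] <= 0.
Proof.
move=> s0p hp; rewrite leNgt; apply/negP => p0.
have [d d0 hd] := poly_cont 0 p p0.
pose e := Num.min d s0 / 2.
have m0 : 0 < Num.min d s0 by rewrite lt_min d0.
have e0 : 0 < e by rewrite divr_gt0.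
have em : e < Num.min d s0 by rewrite /e; lra.
have := hp e e0 (lt_le_trans em _); rewrite ge_min lexx orbT => /(_ isT).
have := hd e; rewrite subr0 gtr0_norm // (lt_le_trans em) ?ge_min ?lexx // => /(_ isT).
by rewrite ltr_norml => /andP[]; lra.
Qed.

(** Near 0 the linear term dominates and changes sign with [e]. *)
Lemma quadratic_le0 (R : realFieldType) (A B e0 : R) : 0 < e0 ->
  (forall e, `|e| <= e0 -> e ^+ 2 * A - e * B <= 0) -> B = 0.
Proof.
move=> e0p h.
have [//|B0] := eqVneq B 0.
(* This size satisfies both [e <= e0] and e |A| < |B|; the sign is chosen opposite to that of [B]
   below. *)
pose e := e0 * `|B| / (`|B| + e0 * `|A|).
have nB : 0 < `|B| by rewrite normr_gt0.
have nA : 0 <= e0 * `|A| by rewrite mulr_ge0 // ltW.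
have den : 0 < `|B| + e0 * `|A| by rewrite ltr_wpDr.
have e_gt0 : 0 < e by rewrite divr_gt0 ?mulr_gt0.
have ee0 : e <= e0 by rewrite /e ler_pdivrMr // mulrDr lerDl mulr_ge0 // ltW.
have eA : e * `|A| < `|B|.
  rewrite /e mulrAC ltr_pdivrMr //.
  by have := mulr_gt0 nB nB; nra.
have := h (- (Num.sg B * e)).
rewrite normrN normrM normr_sg B0 mul1r (gtr0_norm e_gt0) => /(_ ee0).
rewrite sqrrN exprMn sqr_sg B0 mul1r mulNr opprK (mulrAC (Num.sg B)) -normrEsg.
have lA : - `|A| <= A by rewrite lerNl ler_normr lexx orbT.
have : 0 < e * A + `|B| by have := ler_wpM2l (ltW e_gt0) lA; lra.
by move=> /(mulr_gt0 e_gt0); lra.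
Qed.

Section Strip.
Variables (R : rcfType) (C : finType) (x : C -> int).

(* [rows l] is the law of the column of the point with the [l]-th smallest
   value. *)
Definition tens (k : nat) (s : 'S_k) (rows : nat -> C -> R) : R :=
  \sum_(g : {ffun 'I_k -> C}) (\prod_(l < k) rows l (g l)) * tie R (fun i => x (g (s i))).

Definition rowsx (k : nat) (l : {ffun 'I_k -> 'I_3}) : 'I_k -> int := fun v => (l v : nat)%:Z.

(** The part of the density in which the point of value [i] lies in row [l i], without the masses of
    the rows. Rows 0 and 1 are the thin strips, row 2 is the bulk above them. *)
Definition strip_term (k : nat) (s : 'S_k) (v : 'I_3 -> C -> R) (l : {ffun 'I_k -> 'I_3}) : R :=
  k`!%:R * tie R (rowsx l) *
   \sum_(g : {ffun 'I_k -> C}) (\prod_i v (l i) (g i)) * tie R (fun i => x (g (s i))).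

(** Indexing the points by value instead of position makes the vertical ties depend on the rows
    only, which separates rows from columns. *)
Lemma strip_mdens (k : nat) (s : 'S_k) (w : 'I_3 -> R) (v : 'I_3 -> C -> R) :
  mdens (fun a : C * 'I_3 => w a.2 * v a.2 a.1) (fun a => x a.1) (fun a => (a.2 : nat)%:Z) s
  = \sum_(l : {ffun 'I_k -> 'I_3}) (\prod_i w (l i)) * strip_term s v l.
Proof.
pose h (a : {ffun 'I_k -> C} * {ffun 'I_k -> 'I_3}) : {ffun 'I_k -> C * 'I_3} :=
  [ffun i => (a.1 (s i), a.2 (s i))].
have hbij : bijective h.
  exists (fun f : {ffun 'I_k -> C * 'I_3} =>
    (([ffun i => (f (s^-1%g i)).1] : {ffun 'I_k -> C}),
     ([ffun i => (f (s^-1%g i)).2] : {ffun 'I_k -> 'I_3}))).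
    by case=> a b; rewrite /h; congr pair; apply/ffunP => i; rewrite !ffunE /= permKV.
  by move=> f; apply/ffunP => i; rewrite !ffunE /= !permK; case: (f i).
rewrite /mdens (reindex h) /=; last exact: onW_bij.
rewrite -(pair_big predT predT (fun a b => (\prod_(i < k) (w (h (a, b) i).2 * v (h (a, b) i).2 (h (a, b) i).1))
  * tie R ((fun a => x a.1) \o h (a, b)) * tie R (fun u => ((h (a, b) (s^-1%g u)).2 : nat)%:Z))) /=.
rewrite exchange_big mulr_sumr; apply: eq_bigr => l _ /=.
rewrite /strip_term !mulr_sumr.
apply: eq_bigr => g _.
have -> : tie R ((fun a => x a.1) \o h (g, l)) = tie R (fun i => x (g (s i))).
  by apply: eq_tie => i; rewrite /= ffunE.
have -> : tie R (fun u => ((h (g, l) (s^-1%g u)).2 : nat)%:Z) = tie R (rowsx l).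
  by apply: eq_tie => i; rewrite /rowsx ffunE /= permKV.
have -> : \prod_(i < k) (w (h (g, l) i).2 * v (h (g, l) i).2 (h (g, l) i).1) =
  (\prod_i w (l i)) * \prod_i v (l i) (g i).
  rewrite -big_split /= [RHS](reindex_inj (@perm_inj _ s)); apply: eq_bigr => i _.
  by rewrite !ffunE.
by ring.
Qed.

Definition low (k : nat) (l : {ffun 'I_k -> 'I_3}) : nat := #|[set i | l i != ord_max]|.

Definition strip_w (s : R) : 'I_3 -> R := fun r => if r == ord_max then 1 - 2 * s else s.

Lemma prod_strip_w (k : nat) s (l : {ffun 'I_k -> 'I_3}) :
  \prod_i strip_w s (l i) = s ^+ low l * (1 - 2 * s) ^+ (k - low l).
Proof.
rewrite (bigID (fun i => l i != ord_max)) /=; congr (_ * _).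
  rewrite (eq_bigr (fun=> s)) => [|i /negPf li]; last by rewrite /strip_w li.
  by rewrite prodr_const; congr (_ ^+ _); apply: eq_card => i; rewrite !inE.
rewrite (eq_bigr (fun=> 1 - 2 * s)) => [|i /negPn li]; last by rewrite /strip_w li.
rewrite prodr_const; congr (_ ^+ _).
have := cardC (fun i => l i != ord_max); rewrite card_ord => /(canRL (addKn _)) e.
by rewrite /low cardsE -e; apply: eq_card => i; rewrite !inE.
Qed.

(** Each point in a strip costs a factor [s], so [low] is the order in [s]. Once the orders below
    [d] cancel, divide by s^d and let [s] tend to 0. *)
Lemma strip_order (I : finType) (k : I -> nat) (c : I -> R)
    (D : forall i, {ffun 'I_(k i) -> 'I_3} -> R) (d : nat) (s0 : R) : 0 < s0 ->
  (forall i j, (j < d)%N -> \sum_(l : {ffun 'I_(k i) -> 'I_3} | low l == j) D i l = 0) ->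
  (forall s, 0 < s -> s < s0 ->
     \sum_i c i * \sum_(l : {ffun 'I_(k i) -> 'I_3}) (\prod_u strip_w s (l u)) * D i l <= 0) ->
  \sum_i c i * \sum_(l : {ffun 'I_(k i) -> 'I_3} | low l == d) D i l <= 0.
Proof.
move=> s0p Dz Dle.
pose P : {poly R} := \sum_i c i *: \sum_(l : {ffun 'I_(k i) -> 'I_3} | (d <= low l)%N)
   D i l *: ('X ^+ (low l - d) * (1 - 2 *: 'X) ^+ (k i - low l)).
have PE s : P.[s] = \sum_i c i * \sum_(l : {ffun 'I_(k i) -> 'I_3} | (d <= low l)%N)
   D i l * (s ^+ (low l - d) * (1 - 2 * s) ^+ (k i - low l)).
  rewrite horner_sum; apply: eq_bigr => i _; rewrite hornerZ horner_sum; congr (_ * _).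
  apply: eq_bigr => l _; rewrite hornerZ hornerM !horner_exp; congr (_ * (_ * _)).
    by rewrite hornerX.
  by rewrite hornerD hornerN hornerZ hornerX hornerC.
have := @poly_le0_at0 R P s0 s0p; rewrite PE.
rewrite [X in (_ -> X <= 0) -> _](_ : _ = \sum_i c i * \sum_(l : {ffun 'I_(k i) -> 'I_3} | low l == d) D i l); last first.
  apply: eq_bigr => i _; congr (_ * _).
  rewrite (bigID (fun l => low l == d)) /= [X in _ + X]big1 ?addr0 => [|l /andP[dl ld]].
    rewrite (eq_bigl (fun l => low l == d)) => [|l]; last by case: eqP => [->|]; rewrite ?leqnn ?andbF.
    by apply: eq_bigr => l /eqP ->; rewrite subnn expr0 mul1r mulr0 subr0 expr1n mulr1.
  by rewrite expr0n subn_eq0 leqNgt ltn_neqAle eq_sym ld dl mul0r mulr0.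
apply=> s sp ss0; rewrite PE -(pmulr_rle0 _ (exprn_gt0 d sp)).
apply: le_trans (Dle s sp ss0); rewrite mulr_sumr; apply: ler_sum => i _.
rewrite le_eqVlt; apply/orP; left; apply/eqP; rewrite mulrCA; congr (_ * _).
rewrite [RHS](bigID (fun l => (d <= low l)%N)) /= [X in _ = _ + X](_ : _ = 0) ?addr0.
  rewrite mulr_sumr; apply: eq_bigr => l dl.
  rewrite prod_strip_w mulrCA [RHS]mulrC; congr (_ * _).
  by rewrite mulrA -exprD subnKC.
rewrite (partition_big (fun l => inord (low l) : 'I_d.+1) predT) //=; apply: big1 => j _.
rewrite (eq_bigr (fun l => (s ^+ j * (1 - 2 * s) ^+ (k i - j)) * D i l)); last first.
  move=> l /andP[dl /eqP <-]; rewrite prod_strip_w inordK //.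
  by rewrite ltnS ltnW // ltnNge.
rewrite -mulr_sumr; have [jd|dj] := ltnP j d; last first.
  rewrite big1 ?mulr0 // => l /andP[dl /eqP lj]; move: dj; rewrite -lj inordK ?(negPf dl) //.
  by rewrite ltnS ltnW // ltnNge.
rewrite (eq_bigl (fun l => low l == j)) ?Dz ?mulr0 // => l.
apply/andP/eqP => [[dl /eqP <-]|lj]; first by rewrite inordK // ltnS ltnW // ltnNge.
by rewrite lj -ltnNge jd; split=> //; apply/eqP/val_inj; rewrite /= inordK // ltnS ltnW.
Qed.

End Strip.

Lemma eq_stab_rel (k : nat) (c c' : 'I_k -> int) :
  (forall i j, (c i == c j) = (c' i == c' j)) -> stab c = stab c'.
Proof.
by move=> e; apply/setP => t; rewrite !inE; apply: eq_forallb => i; exact: e.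
Qed.

Lemma card_ord_lt (k i : nat) : (i <= k)%N -> #|[set j : 'I_k | (j < i)%N]| = i.
Proof. by move=> ik; rewrite -sum1dep_card (big_ord_narrow ik) sum1_card card_ord. Qed.

(** Row 2 is the highest row, so the points in the strips are those with the smallest values. *)
Lemma low_segment (k : nat) (l : {ffun 'I_k -> 'I_3}) : nondecr (rowsx l) ->
  forall i : 'I_k, (l i == ord_max) = (low l <= i)%N.
Proof.
move=> /nondecrP nd i.
have mono (a b : 'I_k) : (a <= b)%N -> (l a <= l b)%N by move=> /nd; rewrite lez_nat.
have maxE (a : 'I_k) : (l a == ord_max) = (2 <= l a)%N.
  by rewrite -val_eqE /= eqn_leq -ltnS ltn_ord.
apply/idP/idP => [lmax|].
  rewrite -(card_ord_lt (ltnW (ltn_ord i))); apply: subset_leq_card; apply/subsetP => j.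
  rewrite !inE; apply: contraR; rewrite -leqNgt => /mono.
  by move: lmax; rewrite !maxE; exact: leq_trans.
apply: contraTT; rewrite -ltnNge => lmax.
rewrite -(card_ord_lt (ltn_ord i)); apply: subset_leq_card; apply/subsetP => j.
rewrite !inE ltnS => /mono; move: lmax; rewrite !maxE -!ltnNge => h1 h2.
exact: leq_ltn_trans h2 h1.
Qed.

Definition lrow1 (k : nat) (r : 'I_3) : {ffun 'I_k -> 'I_3} :=
  [ffun i : 'I_k => if (i : nat) == 0%N then r else ord_max].
Definition lrow2 (k : nat) (r1 r2 : 'I_3) : {ffun 'I_k -> 'I_3} :=
  [ffun i : 'I_k => if (i : nat) == 0%N then r1 else if (i : nat) == 1%N then r2 else ord_max].

Definition r0 : 'I_3 := ord0.
Definition r1 : 'I_3 := inord 1.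
Lemma r1E : r1 = 1%N :> nat. Proof. by rewrite inordK. Qed.

Lemma nondecr_row1 k r : nondecr (rowsx (lrow1 k r)).
Proof.
apply/nondecrP => i j ij; rewrite lez_nat !ffunE.
case: (eqVneq (i : nat) 0%N); case: (eqVneq (j : nat) 0%N) => // j0 i0.
  by rewrite -ltnS ltn_ord.
by move: ij; rewrite j0 leqn0 (negPf i0).
Qed.

Lemma nondecr_row2 k (a b : 'I_3) : (a <= b)%N -> nondecr (rowsx (lrow2 k a b)).
Proof.
move=> ab; apply/nondecrP => i j ij; rewrite lez_nat !ffunE.
have h (r : 'I_3) : (r <= 2)%N by rewrite -ltnS ltn_ord.
by case: (nat_of_ord i) (nat_of_ord j) ij => [|[|i']] [|[|j']] //=; rewrite ?leqnn.
Qed.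

Section Weights.
Variable R : rcfType.

Definition wt1 (k : nat) : R := k`!%:R * tie R (rowsx (lrow1 k r0)).
Definition wt2 (k : nat) : R := k`!%:R * tie R (rowsx (lrow2 k r0 r1)).

Lemma tie_row1 k : tie R (rowsx (lrow1 k r1)) = tie R (rowsx (lrow1 k r0)).
Proof.
rewrite /tie !nondecr_row1; congr (_ / #|pred_of_set _|%:R); apply: eq_stab_rel => i j.
by rewrite /rowsx !ffunE; case: (_ == 0%N); case: (_ == 0%N); rewrite ?eqxx // !eqz_nat r1E.
Qed.

Lemma tie_gt0 k (c : 'I_k -> int) : nondecr c -> 0 < tie R c.
Proof. by move=> nc; rewrite /tie nc divr_gt0 // stab_gt0. Qed.

Lemma wt2_gt0 k : 0 < wt2 k.
Proof. by rewrite mulr_gt0 ?ltr0n ?fact_gt0 // tie_gt0 // nondecr_row2. Qed.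

Lemma wt1E k : wt1 k.+1 = k.+1%:R.
Proof.
rewrite /wt1 /tie nondecr_row1.
have -> : #|stab (rowsx (lrow1 k.+1 r0))| = k`!.
  have e : #|[set~ (ord0 : 'I_k.+1)]| = k by rewrite cardsC1 card_ord.
  rewrite -[in RHS]e -card_perm; apply: eq_card => t; apply/stabP/subsetP => [h i|h i].
    rewrite !inE; apply: contraNN => /eqP->; have := h ord0; rewrite /rowsx !ffunE /=.
    by case: eqP => // t0 _; apply/eqP/val_inj.
  have t0 : t ord0 = ord0.
    by apply/eqP; apply: contraT => /h; rewrite !inE eqxx.
  rewrite /rowsx !ffunE; case: (eqVneq i ord0) => [->|i0]; first by rewrite t0.
  have ti0 : t i != ord0 by rewrite -t0 (inj_eq perm_inj).
  by move: i0 ti0; rewrite -!val_eqE /= => /negPf-> /negPf->.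
rewrite factS natrM mul1r mulfK // pnatr_eq0 -lt0n fact_gt0 //.
Qed.

(** When two points share a strip, the stabiliser also contains their exchange and is twice as
    large. *)
Lemma tie_row2_eq k a : a != ord_max -> tie R (rowsx (lrow2 k.+2 a a)) = tie R (rowsx (lrow2 k.+2 r0 r1)) / 2.
Proof.
move=> a2; rewrite /tie !nondecr_row2 ?r1E //.
suff -> : #|stab (rowsx (lrow2 k.+2 a a))| = (2 * #|stab (rowsx (lrow2 k.+2 r0 r1))|)%N.
  by rewrite natrM invfM mulrA mulrAC.
set A := stab _; set B := stab _.
pose o0 : 'I_k.+2 := ord0; pose o1 : 'I_k.+2 := inord 1.
have o1E : o1 = 1%N :> nat by rewrite inordK.
have BP (t : 'S_k.+2) : (t \in B) = (t o0 == o0) && (t o1 == o1).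
  apply/stabP/andP => [h|[/eqP t0 /eqP t1] i].
    split; apply/eqP/val_inj.
      have := h o0; rewrite /rowsx !ffunE /=.
      by case: (nat_of_ord (t o0)) => [|[|n]] //; rewrite r1E.
    have := h o1; rewrite /rowsx !ffunE /= o1E.
    by case: (nat_of_ord (t o1)) => [|[|n]] //=; rewrite r1E.
  rewrite /rowsx !ffunE; case: (eqVneq i o0) => [->|i0]; first by rewrite t0.
  case: (eqVneq i o1) => [->|i1]; first by rewrite t1.
  have ti0 : t i != o0 by rewrite -t0 (inj_eq perm_inj).
  have ti1 : t i != o1 by rewrite -t1 (inj_eq perm_inj).
  move: i0 i1 ti0 ti1; rewrite -!val_eqE /= o1E => /negPf-> /negPf-> /negPf-> /negPf->.
  by [].
have AP (t : 'S_k.+2) : (t \in A) = (t \in B) || ((tperm o0 o1 * t)%g \in B).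
  rewrite !BP !permM tpermL tpermR.
  have aN : (a : nat) != 2%N by [].
  apply/stabP/idP => [h|h i].
    have h0 : (t o0 < 2)%N.
      have := h o0; rewrite /rowsx !ffunE /=.
      case: (nat_of_ord (t o0)) => [|[|n]] //= [] /esym/eqP; by rewrite (negPf aN).
    have h1 : (t o1 < 2)%N.
      have := h o1; rewrite /rowsx !ffunE /= o1E /=.
      case: (nat_of_ord (t o1)) => [|[|n]] //= [] /esym/eqP; by rewrite (negPf aN).
    have : t o0 != t o1 by rewrite (inj_eq perm_inj) -val_eqE /= o1E.
    rewrite -!val_eqE /= o1E.
    by case: (nat_of_ord (t o0)) h0 => [|[|n]] //; case: (nat_of_ord (t o1)) h1 => [|[|n']].
  have [hi|] := boolP ((i == o0) || (i == o1)).
    have : (t i == o0) || (t i == o1).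
      by case/orP: hi => /eqP ->; case/orP: h => /andP[/eqP h1 /eqP h2]; rewrite ?h1 ?h2 eqxx ?orbT.
    move: hi; rewrite /rowsx !ffunE -!val_eqE /= o1E.
    by case/orP => /eqP -> /orP[] /eqP -> /=.
  rewrite negb_or => /andP[i0 i1].
  have [ti0 ti1] : t i != o0 /\ t i != o1.
    case/orP: h => /andP[/eqP h1 /eqP h2]; split.
    - by rewrite -h1 (inj_eq perm_inj).
    - by rewrite -h2 (inj_eq perm_inj).
    - by rewrite -h1 (inj_eq perm_inj).
    - by rewrite -h2 (inj_eq perm_inj).
  move: i0 i1 ti0 ti1; rewrite /rowsx !ffunE -!val_eqE /= o1E.
  by move=> /negPf-> /negPf-> /negPf-> /negPf->.
have -> : A = B :|: [set (tperm o0 o1 * t)%g | t in B].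
  apply/setP => t; rewrite AP in_setU; congr (_ || _); apply/idP/imsetP => [h|[u hu ->]].
    by exists (tperm o0 o1 * t)%g => //; rewrite mulgA tperm2 mul1g.
  by rewrite mulgA tperm2 mul1g.
have dis : B :&: [set (tperm o0 o1 * t)%g | t in B] = set0.
  apply/setP => t; rewrite in_setI in_set0; apply/negP => /andP[tB /imsetP[u uB e]].
  move: tB uB; rewrite e !BP permM tpermL => /andP[/eqP u1 _] /andP[_ /eqP].
  by rewrite u1 => /(congr1 val) /=; rewrite o1E.
by rewrite cardsU dis cards0 subn0 card_imset ?mul2n ?addnn //; exact: mulgI.
Qed.

End Weights.

Lemma low_le (k : nat) (l : {ffun 'I_k -> 'I_3}) : (low l <= k)%N.
Proof. by rewrite -[X in (_ <= X)%N]card_ord max_card. Qed.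

Lemma low_row1 k (r : 'I_3) : low (lrow1 k.+1 r) = (r != ord_max).
Proof.
rewrite /low; have [->|rn] := eqVneq r ord_max.
  by rewrite eq_card0 // => i; rewrite !inE ffunE; case: ifP; rewrite eqxx.
rewrite (@eq_card _ _ (pred1 (ord0 : 'I_k.+1))) ?card1 // => i.
by rewrite !inE ffunE (_ : (i == ord0) = ((i : nat) == 0%N)) //; case: ifP; rewrite ?rn ?eqxx.
Qed.

Lemma low_row2 k (a b : 'I_3) : (a <= b)%N -> low (lrow2 k.+2 a b) = ((a != ord_max) + (b != ord_max))%N.
Proof.
move=> ab; rewrite /low -sum1dep_card big_mkcond big_ord_recl big_ord_recl big1 => [|i _].
  by rewrite !ffunE /= addn0; case: (_ == _); case: (_ == _).
by rewrite ffunE.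
Qed.

Definition vec1 (T : Type) (a p : T) (l : nat) : T := if l is 0 then a else p.
Definition vec2 (T : Type) (a b p : T) (l : nat) : T :=
  match l with 0 => a | 1 => b | _ => p end.

Section LowSums.
Variables (R : rcfType) (C : finType) (x : C -> int).
Notation strip_term := (@strip_term R C x).
Notation tens := (@tens R C x).

Lemma tens_strip_term k (s : 'S_k) (v : 'I_3 -> C -> R) (l : {ffun 'I_k -> 'I_3}) (rows : nat -> C -> R) :
  (forall i : 'I_k, v (l i) = rows i) ->
  strip_term s v l = k`!%:R * tie R (rowsx l) * tens s rows.
Proof.
move=> e; congr (_ * _); apply: eq_bigr => g _; congr (_ * _); apply: eq_bigr => i _.
by rewrite e.
Qed.

Lemma strip_term_low0 k (s : 'S_k) (v v' : 'I_3 -> C -> R) l : v ord_max =1 v' ord_max ->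
  low l = 0%N -> strip_term s v l = strip_term s v' l.
Proof.
move=> e l0; congr (_ * _); apply: eq_bigr => g _; congr (_ * _); apply: eq_bigr => i _.
have -> : l i = ord_max; last exact: e.
apply/eqP; apply: contraT => li; move/eqP: l0; rewrite cards_eq0 => /eqP/setP/(_ i).
by rewrite !inE li.
Qed.

Lemma strip_term_nd k (s : 'S_k) (v : 'I_3 -> C -> R) l : ~~ nondecr (rowsx l) -> strip_term s v l = 0.
Proof. by move=> /negPf nd; rewrite /strip_term /tie nd mul0r mulr0 mul0r. Qed.

Lemma row1_of_low k (l : {ffun 'I_k.+1 -> 'I_3}) : nondecr (rowsx l) -> low l = 1%N ->
  lrow1 k.+1 (l ord0) = l.
Proof.
move=> nd l1; apply/ffunP => i; rewrite ffunE; have := low_segment nd i; rewrite l1.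
case: (eqVneq (nat_of_ord i) 0%N) => [i0 _|i0]; first by congr (l _); apply: val_inj; rewrite /= i0.
by rewrite lt0n i0 => /eqP.
Qed.

Lemma row2_of_low k (l : {ffun 'I_k.+2 -> 'I_3}) : nondecr (rowsx l) -> low l = 2%N ->
  lrow2 k.+2 (l ord0) (l (inord 1)) = l.
Proof.
move=> nd l1; apply/ffunP => i; rewrite ffunE; have := low_segment nd i; rewrite l1.
case: (eqVneq (nat_of_ord i) 0%N) => [i0 _|i0]; first by congr (l _); apply: val_inj; rewrite /= i0.
case: (eqVneq (nat_of_ord i) 1%N) => [i1 _|i1]; first by congr (l _); apply: val_inj; rewrite /= inordK.
have -> : (2 <= i)%N by case: (nat_of_ord i) i0 i1 => [|[]].
by move=> /eqP.
Qed.

(** Only nondecreasing row assignments count, so the single point in a strip is the lowest one; it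
    may lie in either strip. *)
Lemma sum_low1 k (s : 'S_k) (v : 'I_3 -> C -> R) :
  \sum_(l : {ffun 'I_k -> 'I_3} | low l == 1%N) strip_term s v l =
  (0 < k)%:R * (wt1 R k * (tens s (vec1 (v r0) (v ord_max)) + tens s (vec1 (v r1) (v ord_max)))).
Proof.
case: k s => [|k] s.
  by rewrite mul0r big1 // => l /eqP l1; have := low_le l; rewrite l1.
rewrite mul1r (bigID (fun l => nondecr (rowsx l))) /= [X in _ + X]big1 ?addr0 => [|l /andP[_ nd]]; last first.
  exact: strip_term_nd.
rewrite (reindex_onto (@lrow1 k.+1) (fun l => l ord0)) /=; last first.
  by move=> l /andP[/eqP l1 nd]; exact: row1_of_low.
rewrite (eq_bigl (fun r => r != ord_max)) => [|r]; last first.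
  by rewrite low_row1 nondecr_row1 ffunE eqxx !andbT; case: (_ != _).
rewrite big_mkcond !big_ord_recr big_ord0 /= addr0 add0r.
have -> : widen_ord (leqnSn 2) (widen_ord (leqnSn 1) ord_max) = r0 by exact: val_inj.
have -> : widen_ord (leqnSn 2) ord_max = r1 by apply: val_inj; rewrite /= r1E.
have term r : strip_term s v (lrow1 k.+1 r) =
    k.+1`!%:R * tie R (rowsx (lrow1 k.+1 r)) * tens s (vec1 (v r) (v ord_max)).
  by apply: tens_strip_term => i; rewrite ffunE; case: (nat_of_ord i).
by rewrite !term tie_row1 /wt1 mulrDr.
Qed.

(** The two lowest points lie both in row 0, one in each strip, or both in row 1, and sharing a
    strip halves the tie weight. The mixed term multiplies two different laws in a fixed order,
    which is what makes an antisymmetric part visible. *)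
Lemma sum_low2 k (s : 'S_k) (v : 'I_3 -> C -> R) :
  \sum_(l : {ffun 'I_k -> 'I_3} | low l == 2%N) strip_term s v l =
  (1 < k)%:R * (wt2 R k * (tens s (vec2 (v r0) (v r0) (v ord_max)) / 2
     + tens s (vec2 (v r0) (v r1) (v ord_max)) + tens s (vec2 (v r1) (v r1) (v ord_max)) / 2)).
Proof.
case: k s => [|[|k]] s.
- by rewrite mul0r big1 // => l /eqP l1; have := low_le l; rewrite l1.
- by rewrite mul0r big1 // => l /eqP l1; have := low_le l; rewrite l1.
rewrite mul1r (bigID (fun l => nondecr (rowsx l))) /= [X in _ + X]big1 ?addr0 => [|l /andP[_ nd]]; last first.
  exact: strip_term_nd.
rewrite (reindex_onto (fun r => lrow2 k.+2 r.1 r.2) (fun l => (l ord0, l (inord 1)))) /=; last first.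
  by move=> l /andP[/eqP l1 nd]; exact: row2_of_low.
have term a b : a != ord_max -> b != ord_max -> (a <= b)%N ->
   strip_term s v (lrow2 k.+2 a b) = k.+2`!%:R * tie R (rowsx (lrow2 k.+2 a b)) * tens s (vec2 (v a) (v b) (v ord_max)).
  move=> a2 b2 ab; apply: tens_strip_term => i; rewrite ffunE.
  by case: (nat_of_ord i) => [|[]].
have r12 : r1 != ord_max by rewrite -val_eqE /= r1E.
have r01 : (r0 <= r1)%N by [].
rewrite (eq_bigl (mem [:: (r0, r0); (r0, r1); (r1, r1)])); last first.
  case=> a b /=; rewrite !ffunE /= inordK //= !xpair_eqE !eqxx !andbT !inE !xpair_eqE -!val_eqE /= r1E.
  have [ab|ba] := leqP a b.
    rewrite low_row2 // nondecr_row2 // andbT.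
    by case: a ab => [[|[|[|]]]] // ?; case: b => [[|[|[|]]]].
  have -> : nondecr (rowsx (lrow2 k.+2 a b)) = false.
    apply/negbTE/negP => /nondecrP/(_ ord0 (inord 1)); rewrite /rowsx !ffunE /= inordK //= => /(_ isT).
    by rewrite lez_nat leqNgt ba.
  rewrite andbF; case: a ba => [[|[|[|]]]] // ?; by case: b => [[|[|[|]]]].
rewrite -big_uniq /=; last first.
  by rewrite !inE !xpair_eqE -!val_eqE /= r1E.
rewrite !big_cons big_nil /= addr0 !term //.
by rewrite !tie_row2_eq // /wt2; ring.
Qed.

Definition delta (a : C) : C -> R := fun b => (b == a)%:R.

Lemma tens_vec1 k (s : 'S_k) (u p : C -> R) : (0 < k)%N ->
  tens s (vec1 u p) = \sum_a u a * tens s (vec1 (delta a) p).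
Proof.
case: k s => // k s _; rewrite /tens.
under [RHS]eq_bigr do rewrite mulr_sumr.
rewrite exchange_big; apply: eq_bigr => g _ /=.
rewrite (bigD1 (g ord0)) //= [X in _ = _ + X]big1 => [|a /negPf ga].
  by rewrite addr0 !big_ord_recl /= /delta eqxx mul1r mulrA.
by rewrite !big_ord_recl /= /delta eq_sym ga !mul0r mulr0.
Qed.

Lemma tens_vec2 k (s : 'S_k) (u u' p : C -> R) : (1 < k)%N ->
  tens s (vec2 u u' p) = \sum_a \sum_b u a * u' b * tens s (vec2 (delta a) (delta b) p).
Proof.
case: k s => [|[|k]] // s _; rewrite /tens.
under [RHS]eq_bigr => a _.
  under eq_bigr do rewrite mulr_sumr.
  rewrite exchange_big /=.
  over.
rewrite exchange_big; apply: eq_bigr => g _ /=.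
rewrite (bigD1 (g ord0)) //= [X in _ = _ + X]big1 => [|a /negPf ga].
  rewrite addr0 (bigD1 (g (lift ord0 ord0))) //= [X in _ = _ + X]big1 => [|b /negPf gb].
    rewrite addr0 !big_ord_recl /=.
    have -> a : delta a a = 1 by rewrite /delta eqxx.
    have -> a : delta a a = 1 by rewrite /delta eqxx.
    by rewrite !mul1r !mulrA.
  rewrite !big_ord_recl /= /delta [g _ == b]eq_sym gb.
  by rewrite mul0r mulr0 mul0r mulr0.
apply: big1 => b _; by rewrite !big_ord_recl /= /delta [g ord0 == a]eq_sym ga !mul0r mulr0.
Qed.

End LowSums.

(** * First and second order conditions at an extremum *)

(** Maximality over all finite models; minimality is expressed by changing the sign of [c]. *)
Definition extremal (R : realFieldType) (q : nat) (c : 'I_q -> R) (s : 'I_q -> permutation) : Prop :=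
  forall (V : finType) (m : V -> R) (x y : V -> int),
    (forall a, 0 <= m a) -> \sum_a m a = 1 ->
    \sum_i c i * mdens m x y (tagged (s i)) <= \sum_i c i / (perm_order (s i))`!%:R.

Section Tens.
Variables (R : rcfType) (C : finType) (x : C -> int) (p : C -> R).
Hypothesis p1 : \sum_a p a = 1.

Lemma tens_const k (s : 'S_k) (rows : nat -> C -> R) : (forall i : 'I_k, rows i = p) ->
  tens x s rows = k`!%:R^-1.
Proof.
move=> rp; rewrite -(sum_prod_tie k x p1) /tens.
pose re (g : {ffun 'I_k -> C}) := [ffun i => g (s^-1%g i)].
have reK : injective re.
  by move=> g h /ffunP e; apply/ffunP => i; have := e (s i); rewrite !ffunE permK.
rewrite (reindex_inj reK); apply: eq_bigr => g _; congr (_ * _).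
  rewrite [LHS](reindex_inj (@perm_inj _ s)); apply: eq_bigr => i _.
  by rewrite rp ffunE permK.
by apply: eq_tie => i; rewrite ffunE permK.
Qed.

End Tens.

Definition rowv (R : rcfType) (C : finType) (a b p : C -> R) (r : 'I_3) : C -> R :=
  if r == r0 then a else if r == r1 then b else p.

Section Conditions.
Variables (R : rcfType) (q : nat) (c : 'I_q -> R) (s : 'I_q -> permutation).
Hypothesis ext : extremal c s.
Variables (C : finType) (x : C -> int) (p : C -> R).
Hypotheses (p_gt0 : forall a, 0 < p a) (p1 : \sum_a p a = 1).

Let T := \sum_i c i / (perm_order (s i))`!%:R.
Let F (z : R) (a b : C -> R) := \sum_i c i * \sum_(l : {ffun 'I_(perm_order (s i)) -> 'I_3})
   (\prod_u strip_w z (l u)) * strip_term x (tagged (s i)) (rowv a b p) l.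

Let r10 : (r1 == r0) = false. Proof. by rewrite -val_eqE /= r1E. Qed.
Let m0 : (ord_max == r0) = false. Proof. by []. Qed.
Let m1 : (ord_max == r1) = false. Proof. by rewrite -val_eqE /= r1E. Qed.

Lemma rowvE a b : (rowv a b p r0 = a) * (rowv a b p r1 = b) * (rowv a b p ord_max = p).
Proof. by rewrite /rowv !eqxx r10 m0 m1. Qed.

Lemma strip_wE (z : R) :
  (strip_w z r0 = z) * (strip_w z r1 = z) * (strip_w z ord_max = 1 - 2 * z).
Proof. by rewrite /strip_w eqxx ![_ == ord_max]eq_sym m0 m1. Qed.

Lemma sum_I3 (f : 'I_3 -> R) : \sum_r f r = f r0 + f r1 + f ord_max.
Proof.
rewrite !big_ord_recr big_ord0 /= add0r; congr (f _ + f _ + _); apply: val_inj => //=.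
by rewrite r1E.
Qed.

(** The two strips have equal mass factors, so it is enough that [a] and [b] have total mass 2;
    neither has to be a probability law by itself. *)
Lemma strip_le z a b : 0 < z -> z < 1 / 2 -> (forall u, 0 <= a u) -> (forall u, 0 <= b u) ->
  \sum_u (a u + b u) = 2 -> F z a b <= T.
Proof.
move=> z0 z1 a0 b0 ab.
have wr := strip_wE z.
have := @ext _ (fun u : C * 'I_3 => strip_w z u.2 * rowv a b p u.2 u.1)
  (fun u => x u.1) (fun u => (u.2 : nat)%:Z).
have -> : F z a b = \sum_i c i * mdens (fun u : C * 'I_3 => strip_w z u.2 * rowv a b p u.2 u.1)
    (fun u => x u.1) (fun u => (u.2 : nat)%:Z) (tagged (s i)).
  by apply: eq_bigr => i _; congr (_ * _); rewrite strip_mdens.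
apply.
- case=> u r /=; apply: mulr_ge0.
    by rewrite /strip_w; case: ifP => _; lra.
  by rewrite /rowv; case: ifP => _ //; case: ifP => _ //; exact: ltW.
- rewrite -(pair_big predT predT (fun u r => strip_w z r * rowv a b p r u)) /=.
  under eq_bigr do rewrite sum_I3 !wr !rowvE -mulrDr.
  by rewrite big_split /= -!mulr_sumr ab p1; ring.
Qed.

(** With [p] in every row, rows and columns are independent, and every pattern of a given order is
    equally likely. *)
Lemma strip_base z : F z p p = T.
Proof.
apply: eq_bigr => i _; congr (_ * _).
have e (r : 'I_3) : rowv p p p r = p by rewrite /rowv; case: ifP => // _; case: ifP.
under eq_bigr => l _.
  rewrite (@tens_strip_term _ _ x _ _ _ l (fun _ => p)); last by move=> u; rewrite e.
  rewrite (tens_const x p1) // mulrAC mulfV ?pnatr_eq0 -?lt0n ?fact_gt0 // mul1r.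
  over.
rewrite (@sum_prod_tie R _ _ (strip_w z) (fun r => (r : nat)%:Z)) //.
by rewrite sum_I3 !strip_wE; ring.
Qed.

Lemma low0_eq k (sg : 'S_k) a b a' b' :
  \sum_(l : {ffun 'I_k -> 'I_3} | low l == 0%N) strip_term x sg (rowv a b p) l =
  \sum_(l : {ffun 'I_k -> 'I_3} | low l == 0%N) strip_term x sg (rowv a' b' p) l.
Proof.
apply: eq_bigr => l /eqP l0; apply: strip_term_low0 => // u; by rewrite !rowvE.
Qed.

(* First order in the mass of the strip, along [p + e a] for both signs of [e]. *)
Lemma first_order a b :
  \sum_i c i * ((0 < perm_order (s i))%:R * (wt1 R (perm_order (s i)) *
    (tens x (tagged (s i)) (vec1 (delta R a) p) - tens x (tagged (s i)) (vec1 (delta R b) p)))) = 0.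
Proof.
have [->|ab] := eqVneq a b.
  by apply: big1 => i _; rewrite subrr !mulr0.
pose e0 := Num.min (p a) (p b).
have e00 : 0 < e0 by rewrite lt_min !p_gt0.
pose L := \sum_i c i * ((0 < perm_order (s i))%:R * (wt1 R (perm_order (s i)) *
    (tens x (tagged (s i)) (vec1 (delta R a) p) - tens x (tagged (s i)) (vec1 (delta R b) p)))).
suff H e : `|e| <= e0 -> 2 * (e * L) <= 0.
  have h1 := H e0; have h2 := H (- e0); rewrite normrN gtr0_norm // in h1 h2.
  apply: (mulfI (lt0r_neq0 e00)); rewrite mulr0; apply/eqP; rewrite eq_le.
  by have := h1 (lexx _); have := h2 (lexx _); rewrite -/L; lra.
have e0a : e0 <= p a by rewrite ge_min lexx.
have e0b : e0 <= p b by rewrite ge_min lexx orbT.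
rewrite ler_norml => /andP[el ea].
pose f u := p u + e * (delta R a u - delta R b u).
have da u : delta R a u = (u == a)%:R by [].
have f0 u : 0 <= f u.
  rewrite /f /delta; have := p_gt0 u; case: (eqVneq u a) => [->|_].
    by rewrite (negPf ab) /=; lra.
  by case: (eqVneq u b) => [->|_] /=; lra.
have sd u : \sum_v delta R u v = 1.
  by rewrite (bigD1 u) //= /delta eqxx big1 ?addr0 // => v /negPf ->.
have f1 : \sum_u f u = 1.
  by rewrite big_split /= -mulr_sumr sumrB !sd p1 subrr mulr0 addr0.
pose D i (l : {ffun 'I_(perm_order (s i)) -> 'I_3}) :=
  strip_term x (tagged (s i)) (rowv f f p) l - strip_term x (tagged (s i)) (rowv p p p) l.
have tf k (sg : 'S_k) : (0 < k)%N -> tens x sg (vec1 f p) - tens x sg (vec1 p p) =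
    e * (tens x sg (vec1 (delta R a) p) - tens x sg (vec1 (delta R b) p)).
  move=> k0; rewrite !(tens_vec1 x sg _ _ k0) -!sumrB mulr_sumr; apply: eq_bigr => u _.
  by rewrite /f; ring.
have := @strip_order R 'I_q (fun i => perm_order (s i)) c D 1 (1 / 2).
rewrite (_ : \sum_i c i * \sum_(l | low l == 1%N) D i l = 2 * (e * L)); last first.
  rewrite /L !mulr_sumr; apply: eq_bigr => i _.
  rewrite sumrB !sum_low1 !rowvE; case: ltnP => k0; last by rewrite !mul0r subrr !mulr0.
  rewrite !mul1r -mulrBr -!mulr2n -mulrnBl tf //; ring.
apply; first by lra.
  move=> i [|j] // _; rewrite sumrB; apply/eqP; rewrite subr_eq0; apply/eqP.
  exact: low0_eq.
move=> z z0 z1.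
have := strip_le z0 z1 f0 f0; rewrite big_split /= f1 => /(_ erefl).
rewrite -(strip_base z) -subr_le0 /F -sumrB; apply: le_trans.
rewrite le_eqVlt; apply/orP; left; apply/eqP; apply: eq_bigr => i _.
by rewrite -mulrBr -sumrB; congr (_ * _); apply: eq_bigr => l _; rewrite mulrBr.
Qed.

(* Second order, for the pair of strips with column laws [p + e a + b] and
   [p + e a - b] together with its mirror image under [(e, b) -> (- e, - b)]: the
   contributions of order one cancel, and so do those of the symmetric part of
   the quadratic form up to [e ^+ 2]. *)
Lemma second_order a b :
  \sum_i c i * ((1 < perm_order (s i))%:R * (wt2 R (perm_order (s i)) *
    (tens x (tagged (s i)) (vec2 (delta R a) (delta R b) p) -
     tens x (tagged (s i)) (vec2 (delta R b) (delta R a) p)))) = 0.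
Proof.
have [->|ab] := eqVneq a b.
  by apply: big1 => i _; rewrite subrr !mulr0.
pose t i u v := c i * ((1 < perm_order (s i))%:R * (wt2 R (perm_order (s i)) *
    tens x (tagged (s i)) (vec2 (delta R u) (delta R v) p))).
pose W u v := \sum_i (t i u v - t i v u).
rewrite (eq_bigr (fun i => t i a b - t i b a)) => [|i _]; last by rewrite /t -!mulrBr.
rewrite -/(W a b).
(* Half of [p b] leaves room for a perturbation [e] of size at most half of [min (p a) (p b)]: the
   four weights used below stay nonnegative. *)
pose be := p b / 2.
have be0 : 0 < be by rewrite divr_gt0.
pose da u := delta R a u - delta R b u.
pose db u := be * delta R b u.
pose A := \sum_i \sum_u \sum_v t i u v * (da u * da v).
pose L := \sum_i \sum_u \sum_v t i u v * (da u * db v - db u * da v).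
have LE : L = be * W a b.
  have dE u : delta R u = (fun v => (v == u)%:R) by [].
  rewrite /L /W mulr_sumr; apply: eq_bigr => i _.
  have pick (f : C -> R) u : \sum_v f v * delta R u v = f u.
    rewrite (bigD1 u) //= dE eqxx mulr1 big1 ?addr0 // => v /negPf ->.
    by rewrite mulr0.
  transitivity (\sum_u (be * (t i u b * da u) - be * ((t i u a - t i u b) * delta R b u))).
    apply: eq_bigr => u _.
    rewrite -(pick (fun v => be * (t i u v * da u)) b).
    have -> : be * ((t i u a - t i u b) * delta R b u) = \sum_v (be * (t i u v * delta R b u)) * da v.
      under [RHS]eq_bigr do rewrite mulrBr.
      by rewrite sumrB !pick; ring.
    by rewrite -sumrB; apply: eq_bigr => v _; rewrite /db; ring.
  rewrite sumrB.
  have -> : \sum_u be * ((t i u a - t i u b) * delta R b u) = be * (t i b a - t i b b).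
    by rewrite -mulr_sumr pick.
  have -> : \sum_u be * (t i u b * da u) = be * (t i a b - t i b b).
    rewrite -mulr_sumr; under eq_bigr do rewrite mulrBr.
    by rewrite sumrB !(pick (fun u => t i u b)).
  by ring.
suff L0 : L = 0 by apply: (mulfI (lt0r_neq0 be0)); rewrite -LE L0 mulr0.
pose e0 := Num.min (p a) (p b) / 2.
have e00 : 0 < e0 by rewrite divr_gt0 // lt_min !p_gt0.
have Be : 2 * L = 0; last by lra.
apply: (@quadratic_le0 R (4 * A) (2 * L) e0 e00) => e he.
have [ea eb] : `|e| <= p a / 2 /\ `|e| <= p b / 2.
  by move: he; rewrite /e0 ler_pdivlMr // le_min => /andP[]; lra.
pose f1 u := p u + e * da u + db u; pose f2 u := p u + e * da u - db u.
pose g1 u := p u - e * da u - db u; pose g2 u := p u - e * da u + db u.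
have pos u : [/\ 0 <= f1 u, 0 <= f2 u, 0 <= g1 u & 0 <= g2 u].
  rewrite /f1 /f2 /g1 /g2 /da /db /delta; have pu := p_gt0 u.
  move: ea eb; rewrite !ler_norml => /andP[e1 e2] /andP[e3 e4].
  case: (eqVneq u a) => [ua|_].
    by rewrite ua (negPf ab) /=; split; lra.
  by case: (eqVneq u b) => [ub|_] /=; rewrite ?ub /be; split; rewrite /be; lra.
have sd u : \sum_v delta R u v = 1.
  by rewrite (bigD1 u) //= /delta eqxx big1 ?addr0 // => v /negPf ->.
have sda : \sum_u da u = 0 by rewrite sumrB !sd subrr.
pose D i (l : {ffun 'I_(perm_order (s i)) -> 'I_3}) :=
  strip_term x (tagged (s i)) (rowv f1 f2 p) l + strip_term x (tagged (s i)) (rowv g1 g2 p) l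
  - 2 * strip_term x (tagged (s i)) (rowv p p p) l.
have := @strip_order R 'I_q (fun i => perm_order (s i)) c D 2 (1 / 2).
(* Polarisation: the symmetric part of the second-order form leaves only a multiple of e^2, while
   its antisymmetric part [L] enters linearly in [e], so that [quadratic_le0] isolates it. *)
rewrite (_ : \sum_i c i * \sum_(l | low l == 2%N) D i l = e ^+ 2 * (4 * A) - e * (2 * L)); last first.
  rewrite /A /L !mulr_sumr -sumrB; apply: eq_bigr => i _.
  rewrite sumrB big_split /= -mulr_sumr !sum_low2 !rowvE.
  rewrite -!(mulrA e) !mulr_sumr.
  case: (ltnP 1 (perm_order (s i))) => k1; last first.
    rewrite !mul0r !mulr0 addr0 subr0 mulr0; apply/esym.
    rewrite -sumrB; apply: big1 => u _; rewrite !mulr_sumr -sumrB; apply: big1 => v _.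
    by rewrite /t ltnNge k1 /=; ring.
  rewrite !(tens_vec2 x (tagged (s i)) _ _ _ k1) !mul1r.
  set w := wt2 R _; pose tt u v := tens x (tagged (s i)) (vec2 (delta R u) (delta R v) p).
  have tE u v : t i u v = c i * (w * tt u v) by rewrite /t k1 mul1r.
  rewrite -sumrB !mulr_suml -!big_split /= !mulr_sumr -!big_split /= -sumrB /= mulr_sumr.
  apply: eq_bigr => u _.
  rewrite !mulr_suml -!big_split /= !mulr_sumr -!big_split /= -!sumrB /= mulr_sumr.
  apply: eq_bigr => v _; rewrite tE -/(tt u v) /f1 /f2 /g1 /g2; by field.
apply; first by lra.
  move=> i [|[|j]] // _; rewrite sumrB big_split /= -mulr_sumr.
    by rewrite (low0_eq _ f1 f2 p p) (low0_eq _ g1 g2 p p); ring.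
  rewrite !sum_low1 !rowvE; case: ltnP => k0; last by rewrite !mul0r mulr0 addr0 subr0.
  rewrite !mul1r !(tens_vec1 x (tagged (s i)) _ _ k0) -!big_split /=.
  rewrite -mulrDr -big_split /= mulrCA -mulrBr mulr_sumr -sumrB big1 ?mulr0 // => u _.
  by rewrite /f1 /f2 /g1 /g2; ring.
move=> z z0 z1.
have h1 : F z f1 f2 <= T.
  apply: strip_le => //; try by move=> u; have [] := pos u.
  rewrite (eq_bigr (fun u => 2 * p u + 2 * (e * da u))) => [|u _]; last by rewrite /f1 /f2; ring.
  by rewrite big_split /= -!mulr_sumr p1 sda; ring.
have h2 : F z g1 g2 <= T.
  apply: strip_le => //; try by move=> u; have [] := pos u.
  rewrite (eq_bigr (fun u => 2 * p u - 2 * (e * da u))) => [|u _]; last by rewrite /g1 /g2; ring.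
  by rewrite sumrB /= -!mulr_sumr p1 sda; ring.
have : F z f1 f2 + F z g1 g2 - 2 * F z p p <= 0 by rewrite strip_base; lra.
apply: le_trans; rewrite le_eqVlt; apply/orP; left; apply/eqP.
rewrite /F mulr_sumr -big_split -sumrB /=; apply: eq_bigr => i _.
rewrite mulrCA -mulrDr -mulrBr; congr (_ * _).
rewrite mulr_sumr -big_split -sumrB /=; apply: eq_bigr => l _; rewrite /D; ring.
Qed.

End Conditions.

Lemma poly_eq0_at0 (R : rcfType) (p : {poly R}) (t0 : R) : 0 < t0 ->
  (forall t, 0 < t -> t < t0 -> p.[t] = 0) -> p.[0] = 0.
Proof.
move=> t0p hp; apply/eqP; rewrite eq_le (poly_le0_at0 t0p) => [|t h1 h2]; last by rewrite hp.
rewrite -oppr_le0 -hornerN; apply: (poly_le0_at0 t0p) => t h1 h2.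
by rewrite hornerN hp // oppr0.
Qed.

Section Tens.
Variables (R : rcfType) (C : finType) (x : C -> int).

Lemma eq_tens k (s : 'S_k) (rows rows' : nat -> C -> R) : (forall l a, rows l a = rows' l a) ->
  tens x s rows = tens x s rows'.
Proof.
by move=> e; apply: eq_bigr => g _; congr (_ * _); apply: eq_bigr => l _; rewrite e.
Qed.

Lemma tens_poly k (s : 'S_k) (rows : nat -> C -> {poly R}) :
  {P : {poly R} | forall t, P.[t] = tens x s (fun l a => (rows l a).[t])}.
Proof.
exists (\sum_(g : {ffun 'I_k -> C}) (\prod_(l < k) rows l (g l)) * (tie R (fun i => x (g (s i))))%:P).
move=> t; rewrite horner_sum; apply: eq_bigr => g _; rewrite hornerM hornerC; congr (_ * _).
by rewrite horner_prod.
Qed.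

End Tens.

Section Closed.
Variables (R : rcfType) (q : nat) (c : 'I_q -> R) (s : 'I_q -> permutation).
Hypothesis ext : extremal c s.
Variables (C : finType) (x : C -> int) (p : C -> R).
Hypotheses (p_ge0 : forall a, 0 <= p a) (p1 : \sum_a p a = 1).

(** Mixing with the uniform law gives positive laws for 0 < t < 1. The conditions are polynomial in
    [t], hence persist at t = 0, that is, for laws with empty columns. *)
Let mix (u : C) : {poly R} := (p u)%:P + (#|C|%:R^-1 - p u) *: 'X.

Let C0 : (0 < #|C|)%N.
Proof.
rewrite lt0n; apply/negP => /eqP/card0_eq C0; move: p1.
rewrite big1 => [/esym/eqP|u _]; first by rewrite oner_eq0.
by have := C0 u; rewrite inE.
Qed.

Let mixE t u : (mix u).[t] = p u + (#|C|%:R^-1 - p u) * t.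
Proof. by rewrite hornerD hornerZ hornerX hornerC. Qed.

Let mix_gt0 t u : 0 < t -> t < 1 -> 0 < (mix u).[t].
Proof.
move=> t0 t1; rewrite mixE.
have h : 0 < #|C|%:R^-1 :> R by rewrite invr_gt0 ltr0n.
have := p_ge0 u; have := mulr_gt0 t0 h; have : 0 <= p u * (1 - t) by rewrite mulr_ge0 // subr_ge0 ltW.
by lra.
Qed.

Let mix1 t : \sum_u (mix u).[t] = 1.
Proof.
under eq_bigr do rewrite mixE.
rewrite big_split /= -mulr_suml sumrB p1 sumr_const -[_^-1 *+ _]mulr_natl mulfV ?pnatr_eq0 -?lt0n //.
by rewrite subrr mul0r addr0.
Qed.

Lemma first_order_closed a b :
  \sum_i c i * ((0 < perm_order (s i))%:R * (wt1 R (perm_order (s i)) *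
    (tens x (tagged (s i)) (vec1 (delta R a) p) - tens x (tagged (s i)) (vec1 (delta R b) p)))) = 0.
Proof.
pose rw d l (u : C) : {poly R} := vec1 (fun u => (delta R d u)%:P) mix l u.
have rwE t d l u : (rw d l u).[t] = vec1 (delta R d) (fun v => (mix v).[t]) l u.
  by case: l => [|l] //=; rewrite hornerC.
pose P i d := sval (tens_poly x (tagged (s i)) (rw d)).
have PE i d t : (P i d).[t] = tens x (tagged (s i)) (vec1 (delta R d) (fun v => (mix v).[t])).
  by rewrite /P; case: tens_poly => Q /= ->; apply: eq_tens => l u; exact: rwE.
have := @poly_eq0_at0 R (\sum_i (c i * ((0 < perm_order (s i))%:R * wt1 R (perm_order (s i)))) *: (P i a - P i b)) 1 ltr01.
have hE t : (\sum_i (c i * ((0 < perm_order (s i))%:R * wt1 R (perm_order (s i)))) *: (P i a - P i b)).[t]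
   = \sum_i c i * ((0 < perm_order (s i))%:R * (wt1 R (perm_order (s i)) * ((P i a).[t] - (P i b).[t]))).
  by rewrite horner_sum; apply: eq_bigr => i _; rewrite hornerZ hornerD hornerN !mulrA.
rewrite hE => h; apply: etrans (h _) => [|t t0 t1]; last first.
  rewrite hE -[RHS](first_order ext x (fun u => @mix_gt0 t u t0 t1) (mix1 t) a b).
  by apply: eq_bigr => i _; rewrite !PE.
apply: eq_bigr => i _; rewrite !PE; congr (_ * (_ * (_ * (_ - _)))); apply: eq_tens => -[|l] u //=.
  by rewrite mixE mulr0 addr0.
by rewrite mixE mulr0 addr0.
Qed.

Lemma second_order_closed a b :
  \sum_i c i * ((1 < perm_order (s i))%:R * (wt2 R (perm_order (s i)) *
    (tens x (tagged (s i)) (vec2 (delta R a) (delta R b) p) -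
     tens x (tagged (s i)) (vec2 (delta R b) (delta R a) p)))) = 0.
Proof.
pose rw d d' l (u : C) : {poly R} := vec2 (fun u => (delta R d u)%:P) (fun u => (delta R d' u)%:P) mix l u.
have rwE t d d' l u : (rw d d' l u).[t] = vec2 (delta R d) (delta R d') (fun v => (mix v).[t]) l u.
  by case: l => [|[|l]] //=; rewrite hornerC.
pose P i d d' := sval (tens_poly x (tagged (s i)) (rw d d')).
have PE i d d' t : (P i d d').[t] = tens x (tagged (s i)) (vec2 (delta R d) (delta R d') (fun v => (mix v).[t])).
  by rewrite /P; case: tens_poly => Q /= ->; apply: eq_tens => l u; exact: rwE.
have := @poly_eq0_at0 R (\sum_i (c i * ((1 < perm_order (s i))%:R * wt2 R (perm_order (s i)))) *: (P i a b - P i b a)) 1 ltr01.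
have hE t : (\sum_i (c i * ((1 < perm_order (s i))%:R * wt2 R (perm_order (s i)))) *: (P i a b - P i b a)).[t]
   = \sum_i c i * ((1 < perm_order (s i))%:R * (wt2 R (perm_order (s i)) * ((P i a b).[t] - (P i b a).[t]))).
  by rewrite horner_sum; apply: eq_bigr => i _; rewrite hornerZ hornerD hornerN !mulrA.
rewrite hE => h; apply: etrans (h _) => [|t t0 t1]; last first.
  rewrite hE -[RHS](second_order ext x (fun u => @mix_gt0 t u t0 t1) (mix1 t) a b).
  by apply: eq_bigr => i _; rewrite !PE.
apply: eq_bigr => i _; rewrite !PE; congr (_ * (_ * (_ * (_ - _)))); apply: eq_tens => -[|[|l]] u //=.
  by rewrite mixE mulr0 addr0.
by rewrite mixE mulr0 addr0.
Qed.

End Closed.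

(** * Empty columns that isolate the one or two lowest points *)

Definition cell (n : nat) (a : 'I_n) : int := (a : nat)%:Z.

(** The column of the point at position [i], when the distinguished point at position [u] is alone
    in column 1; in [step2] the distinguished points are alone in columns 1 and 3. *)
Definition step1 (u i : nat) : nat := if (i < u)%N then 0 else if i == u then 1 else 2.
Definition step2 (u v i : nat) : nat :=
  if (i < u)%N then 0 else if i == u then 1 else if (i < v)%N then 2 else if i == v then 3 else 4.

Section Kappa.
Variable R : rcfType.

(** For [u < k] this is 1 / (u! (k - 1 - u)!), that is, (k - 1)! times it is the binomial
    coefficient of a Bernstein polynomial. *)
Definition kap1 (k u : nat) : R := tie R (fun i : 'I_k => (step1 u i)%:Z).
Definition kap2 (k u v : nat) : R := tie R (fun i : 'I_k => (step2 u v i)%:Z).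

Lemma kap1_gt0 k u : 0 < kap1 k u.
Proof.
apply: tie_gt0; apply/nondecrP => i j ij; rewrite lez_nat /step1.
by do ![case: ifP => //]; lia.
Qed.

Lemma kap2_gt0 k u v : (u < v)%N -> 0 < kap2 k u v.
Proof.
move=> uv; apply: tie_gt0; apply/nondecrP => i j ij; rewrite lez_nat /step2.
by do ![case: ifP => //]; lia.
Qed.

Definition mass1 (X Z : R) (n : nat) : R := match n with 0 => X | 2 => Z | _ => 0 end.
Definition mass2 (X Y Z : R) (n : nat) : R := match n with 0 => X | 2 => Y | 4 => Z | _ => 0 end.

Lemma tens_reindex k (s : 'S_k) (C : finType) (x : C -> int) (rows : nat -> C -> R) :
  tens x s rows = \sum_(h : {ffun 'I_k -> C}) (\prod_i rows (s i) (h i)) * tie R (fun i => x (h i)).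
Proof.
pose re (h : {ffun 'I_k -> C}) := [ffun i => h (s^-1%g i)].
have reK : injective re.
  by move=> g h /ffunP e; apply/ffunP => i; have := e (s i); rewrite !ffunE permK.
rewrite /tens (reindex_inj reK); apply: eq_bigr => g _; congr (_ * _).
  by rewrite [LHS](reindex_inj (@perm_inj _ s)); apply: eq_bigr => i _; rewrite ffunE permK.
by apply: eq_tie => i; rewrite ffunE permK.
Qed.

Lemma prod_step1 k u (X Z : R) (F : nat -> R) : (u < k)%N ->
  (forall i, F i = if (i < u)%N then X else if i == u then 1 else Z) ->
  \prod_(i < k) F i = X ^+ u * Z ^+ (k - 1 - u).
Proof.
move=> uk FE; rewrite -(big_mkord predT F) (@big_cat_nat _ _ _ u) //=; last exact: ltnW.
rewrite [X in _ * X]big_ltn // FE ltnn eqxx mul1r.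
rewrite (@eq_big_nat _ _ _ 0 u _ (fun=> X)) => [|i /andP[_ iu]]; last by rewrite FE iu.
rewrite (@eq_big_nat _ _ _ u.+1 k _ (fun=> Z)) => [|i /andP[iu _]]; last first.
  by rewrite FE ltnNge ltnW // gtn_eqF.
by rewrite !prodr_const_nat subn0; congr (_ * _ ^+ _); lia.
Qed.

Lemma prod_step2 k u v (X Y Z : R) (F : nat -> R) : (u < v)%N -> (v < k)%N ->
  (forall i, F i = if (i < u)%N then X else if i == u then 1 else if (i < v)%N then Y
      else if i == v then 1 else Z) ->
  \prod_(i < k) F i = X ^+ u * Y ^+ (v - u - 1) * Z ^+ (k - 1 - v).
Proof.
move=> uv vk FE; rewrite -(big_mkord predT F) (@big_cat_nat _ _ _ u) //=; last by lia.
rewrite [X in _ * X]big_ltn ?(ltn_trans uv) // FE ltnn eqxx mul1r.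
rewrite [X in _ * X](@big_cat_nat _ _ _ v) //=; last exact: ltnW.
rewrite [X in _ * (_ * X)]big_ltn // FE ltnn eqxx ltnNge (ltnW uv) /= (gtn_eqF uv) mul1r.
rewrite (@eq_big_nat _ _ _ 0 u _ (fun=> X)) => [|i /andP[_ iu]]; last by rewrite FE iu.
rewrite (@eq_big_nat _ _ _ u.+1 v _ (fun=> Y)) => [|i /andP[iu iv]]; last first.
  by rewrite FE ltnNge ltnW // gtn_eqF // iv.
rewrite (@eq_big_nat _ _ _ v.+1 k _ (fun=> Z)) => [|i /andP[iv _]]; last first.
  rewrite FE ltnNge (ltnW (ltn_trans uv iv)) gtn_eqF ?(ltn_trans uv) // ltnNge ltnW //.
  by rewrite gtn_eqF.
by rewrite !prodr_const_nat subn0 mulrA; congr (_ * _ ^+ _ * _ ^+ _); lia.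
Qed.

(** One point sits in column 1 and all others avoid that column, so only one nondecreasing placement
    has nonzero mass: column 0 to the left of [u], column 2 to the right. *)
Lemma tens_step1 k (s : 'S_k) (u : 'I_k) (X Z : R) (rows : nat -> 'I_3 -> R) :
  (forall a, rows (s u) a = (a == 1%N :> nat)%:R) ->
  (forall i a, i != u -> rows (s i) a = mass1 X Z a) ->
  tens (@cell 3) s rows = kap1 k u * (X ^+ u * Z ^+ (k - 1 - u)).
Proof.
move=> ru ri; rewrite tens_reindex.
have st3 i : (step1 u i < 3)%N by rewrite /step1; do ![case: ifP => //].
pose h0 : {ffun 'I_k -> 'I_3} := [ffun i : 'I_k => Ordinal (st3 i)].
rewrite (bigD1 h0) //= [X in _ + X]big1 ?addr0 => [|h hn]; last first.
  have [/nondecrP nd|/negPf nd] := boolP (nondecr (fun i => cell (h i))); last by rewrite /tie nd mul0r mulr0.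
  have [z|nz] := eqVneq (\prod_i rows (s i) (h i)) 0; first by rewrite z mul0r.
  case/eqP: hn; apply/ffunP => i; apply: val_inj; rewrite ffunE /=.
  move/prodf_neq0: nz => nz.
  have hu : h u = 1%N :> nat.
    have [//|n1] := eqVneq (h u : nat) 1%N; by have := nz u isT; rewrite ru (negPf n1) eqxx.
  rewrite /step1; case: (ltngtP i u) => iu; last by rewrite (val_inj iu).
    have := nz i isT; rewrite ri; last by rewrite -val_eqE neq_ltn iu.
    have := nd i u (ltnW iu); rewrite lez_nat hu.
    by case: (nat_of_ord (h i)) => [|[|[|n]]] //=; rewrite eqxx.
  have := nz i isT; rewrite ri; last by rewrite -val_eqE neq_ltn iu orbT.
  have := nd u i (ltnW iu); rewrite lez_nat hu; have := ltn_ord (h i).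
  by case: (nat_of_ord (h i)) => [|[|[|n]]] //=; rewrite eqxx.
rewrite mulrC; congr (_ * _).
  by apply: eq_tie => i; rewrite /cell ffunE.
rewrite -(@prod_step1 k u X Z (fun i => if (i < u)%N then X else if i == u then 1 else Z)) //.
apply: eq_bigr => i _; have [->|iu] := eqVneq i u.
  by rewrite ru ffunE /= /step1 ltnn eqxx.
rewrite ri // ffunE /= /step1; rewrite -val_eqE in iu.
by case: ifP => //; rewrite (negPf iu).
Qed.

(** The same rigidity with points fixed in columns 1 and 3; such a placement exists only if [u] lies
    to the left of [v]. *)
Lemma tens_step2 k (s : 'S_k) (u v : 'I_k) (X Y Z : R) (rows : nat -> 'I_5 -> R) : u != v ->
  (forall a, rows (s u) a = (a == 1%N :> nat)%:R) ->
  (forall a, rows (s v) a = (a == 3%N :> nat)%:R) ->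
  (forall i a, i != u -> i != v -> rows (s i) a = mass2 X Y Z a) ->
  tens (@cell 5) s rows = (u < v)%N%:R * (kap2 k u v * (X ^+ u * Y ^+ (v - u - 1) * Z ^+ (k - 1 - v))).
Proof.
move=> uvn ru rv ri; rewrite tens_reindex.
have key (h : {ffun 'I_k -> 'I_5}) : nondecr (fun i => cell (h i)) -> \prod_i rows (s i) (h i) != 0 ->
   (u < v)%N /\ forall i, h i = step2 u v i :> nat.
  move=> /nondecrP nd /prodf_neq0 nz.
  have hu : h u = 1%N :> nat by have [//|n1] := eqVneq (h u : nat) 1%N; by have := nz u isT; rewrite ru (negPf n1) eqxx.
  have hv : h v = 3%N :> nat by have [//|n1] := eqVneq (h v : nat) 3%N; by have := nz v isT; rewrite rv (negPf n1) eqxx.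
  have uv : (u < v)%N.
    rewrite ltnNge; apply/negP => /nd; by rewrite lez_nat hu hv.
  split=> // i; rewrite /step2.
  have [->|iu] := eqVneq i u; first by rewrite ltnn eqxx.
  have [->|iv] := eqVneq i v.
    by rewrite [(v < u)%N]ltnNge (ltnW uv) /= ltnn eqxx (gtn_eqF uv).
  have := nz i isT; rewrite ri // => hi.
  rewrite -val_eqE in iu; rewrite -val_eqE in iv.
  have := ltn_ord (h i); move: hi.
  case: ifP => [/ltnW/nd|/negbT]; rewrite ?lez_nat ?hu.
    by case: (nat_of_ord (h i)) => [|[|[|[|[|n]]]]] //=; rewrite eqxx.
  rewrite -leqNgt => /nd; rewrite lez_nat hu (negPf iu).
  case: ifP => [/ltnW/nd|/negbT]; rewrite ?lez_nat ?hv.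
    by case: (nat_of_ord (h i)) => [|[|[|[|[|n]]]]] //=; rewrite eqxx.
  rewrite -leqNgt => /nd; rewrite lez_nat hv (negPf iv).
  by case: (nat_of_ord (h i)) => [|[|[|[|[|n]]]]] //=; rewrite eqxx.
have zero (h : {ffun 'I_k -> 'I_5}) : ~~ ((u < v)%N && [forall i, h i == step2 u v i :> nat]) ->
   (\prod_i rows (s i) (h i)) * tie R (fun i => cell (h i)) = 0.
  move=> no; have [nd|/negPf nd] := boolP (nondecr (fun i => cell (h i))); last by rewrite /tie nd mul0r mulr0.
  have [z|nz] := eqVneq (\prod_i rows (s i) (h i)) 0; first by rewrite z mul0r.
  have [uv e] := key h nd nz; case/negP: no; rewrite uv; apply/forallP => i; exact/eqP.
case: ltnP => uv; last first.
  by rewrite mul0r big1 // => h _; apply: zero; rewrite ltnNge uv.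
have st5 i : (step2 u v i < 5)%N by rewrite /step2; do ![case: ifP => //].
pose h0 : {ffun 'I_k -> 'I_5} := [ffun i : 'I_k => Ordinal (st5 i)].
rewrite (bigD1 h0) //= [X in _ + X]big1 ?addr0 => [|h hn]; last first.
  apply: zero; apply: contraNN hn => /andP[_ /forallP e]; apply/eqP/ffunP => i; apply: val_inj.
  by rewrite ffunE /=; apply/eqP.
rewrite mul1r mulrC; congr (_ * _).
  by apply: eq_tie => i; rewrite /cell ffunE.
rewrite -(@prod_step2 k u v X Y Z (fun i => if (i < u)%N then X else if i == u then 1 else
   if (i < v)%N then Y else if i == v then 1 else Z)) //.
apply: eq_bigr => i _; have [->|iu] := eqVneq i u.
  by rewrite ru ffunE /= /step2 ltnn eqxx.
have [->|iv] := eqVneq i v.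
  by rewrite rv ffunE /= /step2 [(v < u)%N]ltnNge (ltnW uv) /= ltnn eqxx (gtn_eqF uv).
rewrite ri // ffunE /= /step2; rewrite -val_eqE in iu; rewrite -val_eqE in iv.
by case: ifP => //; rewrite (negPf iu); case: ifP => //; rewrite (negPf iv).
Qed.

End Kappa.

(** * Symmetries of the square, and the identities at its bottom side *)

Definition flip (k : nat) : 'S_k := perm (@rev_ord_inj k).

Definition pinv (s : permutation) : permutation := existT (fun k => 'S_k) (tag s) (tagged s)^-1%g.
Definition pcompl (s : permutation) : permutation :=
  existT (fun k => 'S_k) (tag s) (tagged s * flip (tag s))%g.

(* Junk value [0] when [j] is not smaller than the order. *)
Definition value (s : permutation) (j : nat) : nat :=
  if insub j is Some o then tagged s o else 0.
Definition pos (s : permutation) (j : nat) : nat := value (pinv s) j.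

Lemma valueE (s : permutation) (o : 'I_(tag s)) : value s o = tagged s o.
Proof. by rewrite /value valK. Qed.

Lemma value_lt s j : (j < perm_order s)%N -> (value s j < perm_order s)%N.
Proof. by move=> jk; rewrite -[j]/(nat_of_ord (Ordinal jk)) valueE. Qed.

Lemma pos_lt s j : (j < perm_order s)%N -> (pos s j < perm_order s)%N.
Proof. exact: (@value_lt (pinv s)). Qed.

Lemma posK s j : (j < perm_order s)%N -> value s (pos s j) = j.
Proof.
move=> jk; rewrite -[j in LHS]/(nat_of_ord (Ordinal jk)) /pos.
by rewrite (@valueE (pinv s)) valueE /= permKV.
Qed.

Lemma valueK s j : (j < perm_order s)%N -> pos s (value s j) = j.
Proof.
by move=> jk; rewrite -[j in LHS]/(nat_of_ord (Ordinal jk)) valueE /pos (@valueE (pinv s)) /= permK.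
Qed.

Lemma pinvK : involutive pinv.
Proof. by case=> k s; rewrite /pinv /= invgK. Qed.

Lemma pos_pinv s j : pos (pinv s) j = value s j.
Proof. by rewrite /pos pinvK. Qed.

Lemma pos_pcompl s j : (j < perm_order s)%N -> pos (pcompl s) j = pos s (perm_order s - 1 - j).
Proof.
move=> jk; rewrite /pos -[j in LHS]/(nat_of_ord (Ordinal jk)) (@valueE (pinv (pcompl s))) /= invMg permM.
rewrite -(@valueE (pinv s)) /=; congr value.
have -> : (flip (tag s))^-1%g (Ordinal jk) = rev_ord (Ordinal jk).
  by apply: (@perm_inj _ (flip (tag s))); rewrite permKV permE rev_ordK.
by rewrite /= /perm_order; lia.
Qed.

Lemma flipE k (i : 'I_k) : flip k i = rev_ord i.
Proof. by rewrite permE. Qed.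

Lemma flipV k : (flip k)^-1%g = flip k.
Proof.
apply/permP => i; apply: (@perm_inj _ (flip k)).
by rewrite permKV !flipE rev_ordK.
Qed.

Section Symmetry.
Variable R : rcfType.

Lemma mdens_inv (V : finType) (m : V -> R) (x y : V -> int) k (s : 'S_k) :
  mdens m x y s^-1 = mdens m y x s.
Proof.
pose re (g : {ffun 'I_k -> V}) := [ffun i => g (s^-1%g i)].
have reK : injective re.
  by move=> g h /ffunP e; apply/ffunP => i; have := e (s i); rewrite !ffunE permK.
rewrite /mdens (reindex_inj reK); congr (_ * _); apply: eq_bigr => g _.
rewrite -mulrA [tie R _ * tie R _]mulrC mulrA; congr (_ * _ * _).
- by rewrite [RHS](reindex_inj (@perm_inj _ s^-1%g)); apply: eq_bigr => i _; rewrite ffunE.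
- by apply: eq_tie => i; rewrite /= ffunE invgK permK.
- by apply: eq_tie => i; rewrite /= ffunE.
Qed.

Lemma tie_opp k (c : 'I_k -> int) : tie R (fun i => - c i) = tie R (c \o flip k).
Proof.
rewrite /tie card_stab_perm (@eq_stab_rel _ (fun i => - c i) c) => [|i j]; last by rewrite eqr_opp.
congr ((nat_of_bool _)%:R / _).
apply/nondecrP/nondecrP => h i j ij.
  rewrite /= -lerN2; apply: h; rewrite !flipE /=; lia.
have := h (rev_ord j) (rev_ord i); rewrite /= !flipE !rev_ordK lerN2; apply; lia.
Qed.

Lemma mdens_flip (V : finType) (m : V -> R) (x y : V -> int) k (s : 'S_k) :
  mdens m x y (s * flip k)%g = mdens m x (fun v => - y v) s.
Proof.
congr (_ * _); apply: eq_bigr => f _; congr (_ * _).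
rewrite (tie_opp (fun v => y (f (s^-1%g v)))); apply: eq_tie => i.
by rewrite /= invMg permM flipV.
Qed.

(** Models are closed under exchanging the coordinates, so a condition at the bottom side also holds
    at the left side; combined with [extremal_comp], it holds at all four sides. *)
Lemma extremal_inv q (c : 'I_q -> R) s : extremal c s -> extremal c (fun i => pinv (s i)).
Proof.
move=> h V m x y m0 m1; apply: le_trans (h V m y x m0 m1).
by apply: ler_sum => i _; rewrite mdens_inv.
Qed.

Lemma extremal_comp q (c : 'I_q -> R) s : extremal c s -> extremal c (fun i => pcompl (s i)).
Proof.
move=> h V m x y m0 m1; apply: le_trans (h V m x (fun v => - y v) m0 m1).
by apply: ler_sum => i _; rewrite mdens_flip.
Qed.

End Symmetry.

Section Edge.
Variables (R : rcfType) (q : nat) (c : 'I_q -> R) (s : 'I_q -> permutation).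
Hypothesis ext : extremal c s.

Lemma pos_permV (t : permutation) (o : 'I_(tag t)) : pos t o = (tagged t)^-1%g o.
Proof. by rewrite /pos (@valueE (pinv t)). Qed.

(** Columns 0 and 2 have masses [X] and [Z], and column 1 is empty. Put the lowest point in column 1
    and compare with column [b]; averaging over [b] with respect to the law itself turns the second
    term into the product value 1 / k!. *)
Lemma edge_first (X Z : R) : 0 <= X -> 0 <= Z -> X + Z = 1 ->
  \sum_i c i * ((0 < perm_order (s i))%:R * ((perm_order (s i))%:R *
    (kap1 R (perm_order (s i)) (pos (s i) 0) *
      (X ^+ pos (s i) 0 * Z ^+ (perm_order (s i) - 1 - pos (s i) 0))
     - (perm_order (s i))`!%:R^-1))) = 0.
Proof.
move=> X0 Z0 XZ.
pose p (a : 'I_3) := mass1 X Z a.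
have p0 a : 0 <= p a by rewrite /p /mass1; case: (nat_of_ord a) => [|[|[|]]].
have p1 : \sum_a p a = 1 by rewrite !big_ord_recr big_ord0 /= /p /= add0r addr0.
pose T b i := tens (@cell 3) (tagged (s i)) (vec1 (delta R b) p).
have W b := first_order_closed ext (@cell 3) p0 p1 (inord 1) b.
transitivity (\sum_b p b * \sum_i c i * ((0 < perm_order (s i))%:R * (wt1 R (perm_order (s i)) *
    (T (inord 1) i - T b i)))); last first.
  by apply: big1 => b _; rewrite W mulr0.
under [RHS]eq_bigr do rewrite mulr_sumr.
rewrite exchange_big; apply: eq_bigr => i _ /=; rewrite {}/T.
case: (s i) => -[|k] t /=.
  by rewrite mul0r mulr0 big1 // => b _; rewrite mul0r !mulr0.
rewrite wt1E !mul1r.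
under [RHS]eq_bigr do rewrite mul1r [p _ * _]mulrC -!mulrA [(_ - _) * _]mulrC.
rewrite -!mulr_sumr; congr (_ * (_ * _)).
under [RHS]eq_bigr do rewrite mulrBr.
rewrite sumrB -mulr_suml p1 mul1r -(tens_vec1 (@cell 3) t p p) //.
rewrite (@tens_const _ _ (@cell 3) p p1 _ _ (vec1 p p)); last by move=> j; case: (nat_of_ord j).
congr (_ - _); apply/esym.
have ue : pos (existT (fun k => 'S_k) k.+1 t) 0 = t^-1%g ord0.
  by rewrite -[0%N]/(nat_of_ord (ord0 : 'I_k.+1)) pos_permV.
rewrite ue; apply: tens_step1 => [a|j a ju].
  by rewrite permKV /= /delta -val_eqE /= inordK.
have -> : (t j : nat) = (t j).-1.+1.
  rewrite prednK // lt0n; apply: contraNN ju => /eqP tj.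
  by rewrite -(permK t j); apply/eqP; congr (_ _); apply: val_inj.
by [].
Qed.

Definition edge_term (k u v : nat) (X Y Z : R) : R :=
  (u < v)%N%:R * (kap2 R k u v * (X ^+ u * Y ^+ (v - u - 1) * Z ^+ (k - 1 - v))).

(** Columns 0, 2 and 4 have masses [X], [Y], [Z], and the two lowest points lie in the empty columns
    1 and 3. The exponents then count the remaining points left of, between and right of them. *)
Lemma edge_second (X Y Z : R) : 0 <= X -> 0 <= Y -> 0 <= Z -> X + Y + Z = 1 ->
  \sum_i c i * ((1 < perm_order (s i))%:R * (wt2 R (perm_order (s i)) *
    (edge_term (perm_order (s i)) (pos (s i) 0) (pos (s i) 1) X Y Z
     - edge_term (perm_order (s i)) (pos (s i) 1) (pos (s i) 0) X Y Z))) = 0.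
Proof.
move=> X0 Y0 Z0 XYZ.
pose p (a : 'I_5) := mass2 X Y Z a.
have p0 a : 0 <= p a by rewrite /p /mass2; case: (nat_of_ord a) => [|[|[|[|[|]]]]].
have p1 : \sum_a p a = 1 by rewrite !big_ord_recr big_ord0 /= /p /= add0r !addr0.
rewrite -[RHS](second_order_closed ext (@cell 5) p0 p1 (inord 1) (inord 3)).
apply: eq_bigr => i _; case: (s i) => -[|[|k]] t /=; rewrite ?mul0r //; congr (_ * (_ * (_ * _))).
pose o0 : 'I_k.+2 := ord0; pose o1 : 'I_k.+2 := inord 1.
have o1E : nat_of_ord o1 = 1%N by rewrite inordK.
have u0 : pos (existT (fun k => 'S_k) k.+2 t) 0 = t^-1%g o0.
  by rewrite -[0%N]/(nat_of_ord o0) pos_permV.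
have u1 : pos (existT (fun k => 'S_k) k.+2 t) 1 = t^-1%g o1.
  by rewrite -[in LHS]o1E pos_permV.
have o01 : o0 != o1 by rewrite -val_eqE /= o1E.
have big_val j : j != t^-1%g o0 -> j != t^-1%g o1 -> exists n, (t j : nat) = n.+2.
  move=> j0 j1; have : t j != o0 by apply: contraNN j0 => /eqP <-; rewrite permK.
  have : t j != o1 by apply: contraNN j1 => /eqP <-; rewrite permK.
  rewrite -!val_eqE /= o1E; case: (nat_of_ord (t j)) => [|[|n]] // _ _; by exists n.
have d1 a : delta R (inord 1 : 'I_5) a = (a == 1%N :> nat)%:R.
  by rewrite /delta -val_eqE /= inordK.
have d3 a : delta R (inord 3 : 'I_5) a = (a == 3%N :> nat)%:R.
  by rewrite /delta -val_eqE /= inordK.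
rewrite u0 u1; congr (_ - _); apply/esym; apply: tens_step2.
- by rewrite (inj_eq perm_inj).
- by move=> a; rewrite permKV /= d1.
- by move=> a; rewrite permKV o1E /= d3.
- by move=> j a j0 j1; have [n ->] := big_val j j0 j1.
- by rewrite (inj_eq perm_inj) eq_sym.
- by move=> a; rewrite permKV o1E /= d1.
- by move=> a; rewrite permKV /= d3.
- by move=> j a j1 j0; have [n ->] := big_val j j0 j1.
Qed.

End Edge.

(** * Polynomials with few terms that vanish on a simplex *)

Section OneVariable.
Variables (R : rcfType) (I : finType).

(** Divide by t^m and let [t] tend to 0. *)
Lemma lowest_order (B : {set I}) (d : I -> R) (a b : I -> nat) (m : nat) :
  (forall i, i \in B -> (m <= a i)%N) ->
  (forall t, 0 < t -> t < 1 -> \sum_(i in B) d i * (t ^+ a i * (1 - t) ^+ b i) = 0) ->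
  \sum_(i in B | a i == m) d i = 0.
Proof.
move=> ma h.
pose P : {poly R} := \sum_(i in B) d i *: ('X ^+ (a i - m) * (1 - 'X) ^+ b i).
have PE t : P.[t] = \sum_(i in B) d i * (t ^+ (a i - m) * (1 - t) ^+ b i).
  rewrite horner_sum; apply: eq_bigr => i _; rewrite hornerZ hornerM !horner_exp.
  by rewrite hornerD hornerN hornerX hornerC.
have := @poly_eq0_at0 R P 1 ltr01; rewrite PE => P0; apply: etrans (P0 _) => [|t t0 t1].
  rewrite [RHS](bigID (fun i => a i == m)) /= [X in _ + X]big1 ?addr0 => [|i /andP[iB an]].
    by apply: eq_bigr => i /andP[_ /eqP ->]; rewrite subnn expr0 subr0 expr1n !mulr1.
  by rewrite expr0n subn_eq0 leqNgt ltn_neqAle eq_sym an ma // mul0r mulr0.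
apply: (mulfI (lt0r_neq0 (exprn_gt0 m t0))); rewrite mulr0 -[RHS](h t t0 t1) PE mulr_sumr.
by apply: eq_bigr => i iB; rewrite mulrCA [in RHS](_ : a i = m + (a i - m))%N ?exprD ?mulrA // subnKC ?ma.
Qed.

Lemma sum0_card (D : {set I}) (d : I -> R) (i0 : I) : i0 \in D ->
  (forall i, i \in D -> d i != 0) -> \sum_(i in D) d i = 0 -> (1 < #|D|)%N.
Proof.
move=> i0D dn s0; rewrite ltnNge; apply/negP => c1.
have /cards1P[j Dj] : #|D| == 1%N by rewrite eqn_leq c1; apply/card_gt0P; exists i0.
have jD : j \in D by rewrite Dj set11.
by move: s0 (dn j jD); rewrite Dj big_set1 => ->; rewrite eqxx.
Qed.

(* The terms of lowest order in [t] cancel, and so do those of lowest order in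
   [1 - t]; with only two terms both would have the same exponents. *)
Lemma vanishing_card (B : {set I}) (d : I -> R) (a b : I -> nat) (i0 : I) : i0 \in B ->
  (forall i, i \in B -> d i != 0) ->
  (forall i j, i \in B -> j \in B -> a i = a j -> b i = b j -> i = j) ->
  (forall t, 0 < t -> t < 1 -> \sum_(i in B) d i * (t ^+ a i * (1 - t) ^+ b i) = 0) ->
  (2 < #|B|)%N.
Proof.
move=> i0B dn inj h.
have two (f g : I -> nat) : (forall t, 0 < t -> t < 1 -> \sum_(i in B) d i * (t ^+ f i * (1 - t) ^+ g i) = 0) ->
   exists m, (1 < #|[set i in B | f i == m]|)%N.
  move=> hf; have [i iB imin] := @arg_minnP _ i0 (fun j => j \in B) f i0B.
  exists (f i); apply: (@sum0_card _ d i); first by rewrite inE iB eqxx.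
    by move=> j; rewrite inE => /andP[jB _]; exact: dn.
  by rewrite -[RHS](lowest_order imin hf); apply: eq_bigl => j; rewrite inE.
have [m hm] := two a b h.
have [m' hm'] : exists m, (1 < #|[set i in B | b i == m]|)%N.
  apply: (two b a) => t t0 t1; rewrite -[RHS](h (1 - t)); try by lra.
  by apply: eq_bigr => i _; rewrite subKr [_ ^+ b i * _]mulrC.
rewrite ltnNge; apply/negP => B2.
have sub (f : I -> nat) n : (1 < #|[set i in B | f i == n]|)%N -> forall i, i \in B -> f i = n.
  move=> hn i; have /eqP <- : [set i in B | f i == n] == B.
    by rewrite eqEcard (leq_trans B2 hn) andbT; apply/fintype.subsetP => j; rewrite inE => /andP[].
  by rewrite inE => /andP[_ /eqP].
have /card_gt1P[i [j [iD jD ij]]] := hm.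
move: iD jD ij; rewrite !inE => /andP[iB _] /andP[jB _].
by rewrite (inj i j iB jB) ?eqxx // ?(sub a m hm) ?(sub b m' hm').
Qed.

End OneVariable.

Lemma poly_eq0_unit (R : realFieldType) (p : {poly R}) :
  (forall t, 0 < t -> t < 1 -> p.[t] = 0) -> p = 0.
Proof.
move=> h; apply/eqP; apply: contraT => p0.
pose rs := [seq (n.+2%:R^-1 : R) | n <- iota 0 (size p)].
have urs : uniq rs.
  rewrite map_inj_uniq ?iota_uniq // => m n /invr_inj/eqP.
  by rewrite eqr_nat => /eqP[].
have := @max_poly_roots _ p rs p0 _ urs; rewrite size_map size_iota ltnn; apply.
apply/allP => _ /mapP[n _ ->]; apply/eqP/h; first by rewrite invr_gt0 ltr0n.
by rewrite invf_lt1 ?ltr1n ?ltr0n.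
Qed.

(** As [a] and [b] differ, one of the exponents 1, [a], [b] differs from the other two, and its
    coefficient stands alone. *)
Lemma three_powers (R : realFieldType) (c1 c2 c3 : R) (a b : nat) : a != b ->
  (forall t, 0 < t -> t < 1 -> c1 * t + c2 * t ^+ a + c3 * t ^+ b = 0) ->
  [|| c1 == 0, c2 == 0 | c3 == 0].
Proof.
move=> ab h.
have P0 : c1 *: 'X + c2 *: 'X^a + c3 *: 'X^b = 0.
  by apply: poly_eq0_unit => t t0 t1; rewrite !hornerE h.
have co n : c1 * (n == 1)%N%:R + c2 * (n == a)%N%:R + c3 * (n == b)%N%:R = 0.
  by have := congr1 (fun p : {poly R} => p`_n) P0; rewrite !coefD !coefZ coefX !coefXn coef0.
have [a1|a1] := eqVneq a 1%N.
  have b1 : (b == 1)%N = false by apply/negbTE; rewrite -a1 eq_sym.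
  have := co b; rewrite b1 eq_sym (negPf ab) eqxx !mulr0 !add0r mulr1 => ->.
  by rewrite eqxx !orbT.
have [b1|b1] := eqVneq b 1%N.
  have := co a; rewrite (negPf ab) (negPf a1) eqxx !mulr0 addr0 add0r mulr1 => ->.
  by rewrite eqxx orbT.
by have := co 1%N; rewrite [(1 == a)%N]eq_sym [(1 == b)%N]eq_sym (negPf a1) (negPf b1) !mulr0 !addr0 mulr1 => ->; rewrite eqxx.
Qed.

(** Each power is at most 1/2, with equality only for exponent 1. *)
Lemma two_powers (R : realFieldType) (a b : nat) : (0 < a)%N -> (0 < b)%N ->
  (2^-1 : R) ^+ a + 2^-1 ^+ b = 1 -> a = 1%N /\ b = 1%N.
Proof.
have half n : (0 < n)%N -> (2^-1 : R) ^+ n <= 2^-1.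
  by case: n => // n _; rewrite exprS ler_piMr ?exprn_ile1 //; lra.
have quarter n : (1 < n)%N -> (2^-1 : R) ^+ n < 2^-1.
  by case: n => [|[|n]] // _; rewrite exprS; have := half n.+1 isT; lra.
move=> a0 b0 e; have ha := half a a0; have hb := half b b0; split.
  by apply/eqP; rewrite eqn_leq a0 andbT leqNgt; apply/negP => /quarter; lra.
by apply/eqP; rewrite eqn_leq b0 andbT leqNgt; apply/negP => /quarter; lra.
Qed.

Section Three.
Variables (u v w : 'I_3).
Hypothesis uvw : uniq [:: u; v; w].

Lemma mem_three x : x \in [:: u; v; w].
Proof.
have := @subset_cardP _ (mem [:: u; v; w]) (mem 'I_3).
rewrite (card_uniqP uvw) card_ord => /(_ erefl) => h.
have : mem [:: u; v; w] =i mem 'I_3 by apply: h; apply/fintype.subsetP.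
by move/(_ x) => ->.
Qed.

Lemma big_three (T : Type) (z : T) (op : Monoid.com_law z) (F : 'I_3 -> T) :
  \big[op/z]_x F x = op (F u) (op (F v) (F w)).
Proof.
rewrite (perm_big [:: u; v; w]) /=; last first.
  apply: uniq_perm => //; first exact: index_enum_uniq.
  by move=> x; rewrite mem_three mem_index_enum.
by rewrite !big_cons big_nil Monoid.mulm1.
Qed.

End Three.

Lemma third (u v : 'I_3) : u != v -> exists w, uniq [:: u; v; w].
Proof.
move=> uv; exists (inord (3 - u - v)); rewrite /= !inE !negb_or uv -!val_eqE /=.
have := ltn_ord u; have := ltn_ord v; move: uv; rewrite -val_eqE /= => uv hu hv.
by rewrite inordK; lia.
Qed.

Lemma third1 (u : 'I_3) : exists v w, uniq [:: u; v; w].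
Proof.
have [v uv] : exists v, u != v.
  exists (if u == ord0 then ord_max else ord0).
  by have [->|] := eqVneq u ord0.
by have [w h] := third uv; exists v, w.
Qed.

Section Newton.
Variables (R : rcfType) (I : finType) (A : {set I}) (d : I -> R) (e : I -> 'I_3 -> nat).
Hypothesis dn : forall i, i \in A -> d i != 0.
Hypothesis inj : forall i j, i \in A -> j \in A -> e i =1 e j -> i = j.
Hypothesis A5 : (#|A| <= 5)%N.
Hypothesis mins : forall v, exists2 i, i \in A & e i v = 0%N.

Let mono i (X : 'I_3 -> R) := \prod_v X v ^+ e i v.

Hypothesis vanish : forall X : 'I_3 -> R, (forall v, 0 <= X v) -> \sum_v X v = 1 ->
  \sum_(i in A) d i * mono i X = 0.

(** The terms that survive on the edge [X u = 0] of the simplex. *)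
Let facet u := [set i in A | e i u == 0%N].

Let pt (v w : 'I_3) (t : R) (x : 'I_3) : R := if x == v then t else if x == w then 1 - t else 0.

Let ptE u v w t : uniq [:: u; v; w] ->
  (pt v w t u = 0) * (pt v w t v = t) * (pt v w t w = 1 - t).
Proof.
rewrite /= !inE negb_or => /andP[/andP[uv uw] /andP[vw _]].
by rewrite /pt eqxx (negPf uv) (negPf uw) [w == v]eq_sym (negPf vw) eqxx.
Qed.

Let pt_ge0 v w t x : 0 <= t -> t <= 1 -> 0 <= pt v w t x.
Proof. by move=> t0 t1; rewrite /pt; case: ifP => // _; case: ifP => // _; lra. Qed.

Let pt_sum u v w t : uniq [:: u; v; w] -> \sum_x pt v w t x = 1.
Proof. by move=> U; rewrite (big_three U) /= !(ptE t U); ring. Qed.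

Let mono_pt u v w t i : uniq [:: u; v; w] ->
  mono i (pt v w t) = 0 ^+ e i u * (t ^+ e i v * (1 - t) ^+ e i w).
Proof. by move=> U; rewrite /mono (big_three U) /= !(ptE t U). Qed.

Lemma facet_sum u v w t : uniq [:: u; v; w] -> 0 <= t -> t <= 1 ->
  \sum_(i in facet u) d i * (t ^+ e i v * (1 - t) ^+ e i w) = 0.
Proof.
move=> U t0 t1; have := vanish (fun x => pt_ge0 v w x t0 t1) (pt_sum t U).
rewrite (bigID (fun i => e i u == 0%N)) /= [X in _ + X]big1 ?addr0 => [|i /andP[_ ei]]; last first.
  by rewrite (mono_pt _ _ U) expr0n (negPf ei) mul0r mulr0.
move=> h; apply: etrans h; apply: eq_big => [i|i /[!inE]/andP[_ /eqP ei]]; first by rewrite inE.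
by rewrite (mono_pt _ _ U) ei expr0 mul1r.
Qed.

(** On the edge [X u = 0] an identity in one variable remains, to which [vanishing_card] applies. *)
Lemma card_facet u : (2 < #|facet u|)%N.
Proof.
have [i iA ei] := mins u; have [v [w U]] := third1 u.
apply: (@vanishing_card R I (facet u) d (fun i => e i v) (fun i => e i w) i).
- by rewrite inE iA ei eqxx.
- by move=> j /[!inE] /andP[/dn].
- move=> j j' /[!inE] /andP[jA /eqP ej] /andP[jA' /eqP ej'] h h'.
  apply: inj => // x; have := mem_three U x; rewrite !inE => /or3P[] /eqP -> //.
  by rewrite ej ej'.
- by move=> t t0 t1; apply: (facet_sum U); exact: ltW.
Qed.

Lemma vertex_sum u v : u != v -> \sum_(i in facet u :&: facet v) d i = 0.
Proof.
move=> uv; have [w U] := third uv.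
have := facet_sum U (lexx 0) ler01.
rewrite (bigID (fun i => e i v == 0%N)) /= [X in _ + X]big1 ?addr0 => [|i /andP[_ ei]]; last first.
  by rewrite expr0n (negPf ei) mul0r mulr0.
move=> h; apply: etrans h; apply: eq_big => [i|i /[!inE]/andP[_ /andP[_ /eqP ei]]].
  by rewrite !inE; case: (i \in A) => //=.
by rewrite ei subr0 expr1n expr0 !mulr1.
Qed.

(** Two facets of at least three terms each must meet among five terms. At the corresponding corner
    of the simplex the nonzero coefficients of the common terms add up to 0, so there are at least
    two of them. *)
Lemma card_vertex u v : u != v -> (1 < #|facet u :&: facet v|)%N.
Proof.
move=> uv; have c : (0 < #|facet u :&: facet v|)%N.
  have := cardsU (facet u) (facet v); have := card_facet u; have := card_facet v.
  have : (#|facet u :|: facet v| <= 5)%N.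
    apply: leq_trans A5; apply: subset_leq_card; apply/fintype.subsetP => i.
    by rewrite !inE => /orP[] /andP[].
  have : (#|facet u :&: facet v| <= #|facet u|)%N by rewrite subset_leq_card // finset.subsetIl.
  by lia.
case/card_gt0P: c => i iD; apply: (@sum0_card _ _ _ d i iD); last exact: vertex_sum.
by move=> j /[!inE] /andP[/andP[/dn]].
Qed.

(** Without a constant term the three corner sets would be disjoint and would need six terms. *)
Lemma origin_exists : exists2 o, o \in A & forall v, e o v = 0%N.
Proof.
have [v [w U]] := third1 ord0; pose u : 'I_3 := ord0.
have [uv uw vw] : [/\ u != v, u != w & v != w].
  by move: U; rewrite /= !inE negb_or => /andP[/andP[-> ->] /andP[->]].
have [|no] := boolP [exists o in A, [forall x, e o x == 0%N]].
  by case/exists_inP => o oA /forallP h; exists o => // x; exact/eqP.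
exfalso; have := card_vertex uv; have := card_vertex uw; have := card_vertex vw.
have tri i : i \in A -> ~~ [&& e i u == 0, e i v == 0 & e i w == 0]%N.
  move=> iA; apply: contraNN no => /and3P[iu iv iw]; apply/exists_inP; exists i => //.
  apply/forallP => x; have := mem_three U x; by rewrite !inE => /or3P[] /eqP ->.
set E1 := facet v :&: facet w; set E2 := facet u :&: facet w; set E3 := facet u :&: facet v.
move=> c1 c2 c3.
have d12 : [disjoint E1 & E2].
  rewrite -setI_eq0; apply/eqP/setP => i; rewrite !inE.
  by case: (boolP (i \in A)) => //= /tri; do 3 case: (e i _ == 0%N).
have d123 : [disjoint E1 :|: E2 & E3].
  rewrite -setI_eq0; apply/eqP/setP => i; rewrite !inE.
  by case: (boolP (i \in A)) => //= /tri; do 3 case: (e i _ == 0%N).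
have : (#|E1 :|: E2 :|: E3| <= 5)%N.
  apply: leq_trans A5; apply: subset_leq_card; apply/fintype.subsetP => i.
  by rewrite !inE -!andbA => /orP[/orP[]|] /andP[].
have /eqP -> : #|E1 :|: E2 :|: E3| == (#|E1 :|: E2| + #|E3|)%N by rewrite (leq_card_setU _ _).
have /eqP -> : #|E1 :|: E2| == (#|E1| + #|E2|)%N by rewrite (leq_card_setU _ _).
by lia.
Qed.

Lemma axis_exists o : o \in A -> (forall v, e o v = 0%N) -> forall w, exists i,
  [/\ i \in A, (0 < e i w)%N & forall u, u != w -> e i u = 0%N].
Proof.
move=> oA eo w; have [u [v U]] := third1 w.
have [wu wv uv] : [/\ w != u, w != v & u != v].
  by move: U; rewrite /= !inE negb_or => /andP[/andP[-> ->] /andP[->]].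
have /card_gt1P[i [j [iD jD ij]]] := card_vertex uv.
have [k kD ko] : exists2 k, k \in facet u :&: facet v & k != o.
  by have [io|] := eqVneq i o; [exists j; rewrite // -io eq_sym | exists i].
move: kD; rewrite !inE => /andP[/andP[kA /eqP ku] /andP[_ /eqP kv]].
exists k; split=> // [|x xw]; last first.
  by have := mem_three U x; rewrite !inE (negPf xw) /= => /orP[] /eqP ->.
rewrite lt0n; apply: contraNN ko => /eqP kw; apply/eqP/inj => // x; rewrite eo.
by have := mem_three U x; rewrite !inE => /or3P[] /eqP ->.
Qed.

(** The polynomial is [d o] times 1 - X - Y - Z. A constant term and one pure power of each variable
    make four terms, so at most one term is left over. Edges avoided by the leftover term determine
    the pure powers, and then it must vanish as well. *)
Lemma newton_normal : exists o (P : 'I_3 -> I),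
  [/\ o \in A, forall w, P w \in A, forall i, i \in A -> i = o \/ exists w, i = P w,
      forall v, e o v = 0%N & (forall w v, e (P w) v = (v == w)) /\ forall w, d (P w) = - d o].
Proof.
have [o oA eo] := origin_exists.
have [P hP] := fin_all_exists (axis_exists oA eo).
have PA w : P w \in A by have [] := hP w.
have Pw w : (0 < e (P w) w)%N by have [] := hP w.
have Pu w u : u != w -> e (P w) u = 0%N by have [_ _] := hP w; apply.
have Pinj : injective P.
  move=> w w' ePw; apply/eqP; apply: contraT => ww.
  by have := Pw w; rewrite ePw Pu.
have Po w : P w != o by apply: contraTneq (Pw w) => ->; rewrite eo.
pose S := o |: [set P w | w : 'I_3].
have cS : #|S| = 4.
  rewrite cardsU1 card_imset // card_ord (_ : o \notin _) //.
  by apply/imsetP => -[w _ /esym/eqP]; rewrite (negPf (Po w)).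
have SA : S \subset A.
  apply/fintype.subsetP => i; rewrite !inE => /orP[/eqP -> //|/imsetP[w _ ->] //].
pose Rest := A :\: S.
have cR : (#|Rest| <= 1)%N.
  have := cardsID S A; rewrite (finset.setIidPr SA) cS -/Rest => h.
  by have := A5; rewrite -h; lia.
have sumA (f : I -> R) : \sum_(i in A) f i = f o + \sum_w f (P w) + \sum_(i in Rest) f i.
  rewrite (big_setID S) /= (finset.setIidPr SA); congr (_ + _).
  rewrite /S big_setU1 /=; last by apply/imsetP => -[w _ /esym/eqP]; rewrite (negPf (Po w)).
  by congr (_ + _); rewrite big_imset //= => w w' _ _; apply: Pinj.
have mono_o X : mono o X = 1 by rewrite /mono big1 // => v _; rewrite eo expr0.
have mono_P w X : mono (P w) X = X w ^+ e (P w) w.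
  rewrite /mono (bigD1 w) //= big1 ?mulr1 // => v vw; by rewrite Pu ?expr0.
have H (X : 'I_3 -> R) : (forall v, 0 <= X v) -> \sum_v X v = 1 ->
    d o + \sum_w d (P w) * X w ^+ e (P w) w + \sum_(i in Rest) d i * mono i X = 0.
  move=> X0 X1; rewrite -[RHS](vanish X0 X1) sumA mono_o mulr1; congr (_ + _ + _).
  by apply: eq_bigr => w _; rewrite mono_P.
(* Values on the edge [X u = 0], when no remaining term lives there. *)
have edge u v w : uniq [:: u; v; w] -> (forall i, i \in Rest -> e i u != 0%N) ->
    [/\ d (P v) = - d o, d (P w) = - d o, e (P v) v = 1%N & e (P w) w = 1%N].
  move=> U hu.
  have h t : 0 <= t -> t <= 1 -> d o + (d (P v) * t ^+ e (P v) v + d (P w) * (1 - t) ^+ e (P w) w) = 0.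
    move=> t0 t1; have := H _ (fun x => pt_ge0 v w x t0 t1) (pt_sum t U).
    rewrite (big_three U) /= !(ptE t U) expr0n eqn0Ngt Pw mulr0 add0r big1 ?addr0 // => i iR.
    by rewrite (mono_pt _ _ U) expr0n (negPf (hu i iR)) mul0r mulr0.
  have := h 0 (lexx 0) ler01; have := h 1 ler01 (lexx 1).
  rewrite subrr subr0 !expr1n !expr0n ![_ == 0%N]eqn0Ngt !Pw /= => h1 h2.
  have dv : d (P v) = - d o by lra.
  have dw : d (P w) = - d o by lra.
  (* The midpoint of the edge gives 2^-a + 2^-b = 1 for the two exponents. *)
  have hh : d o + (d (P v) * 2^-1 ^+ e (P v) v + d (P w) * (1 - 2^-1) ^+ e (P w) w) = 0 by apply: h; lra.
  have e2 : 1 - 2^-1 = 2^-1 :> R by lra.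
  have sum1 : (2^-1 : R) ^+ e (P v) v + 2^-1 ^+ e (P w) w = 1.
    by apply: (mulfI (dn oA)); move: hh; rewrite e2 dv dw; lra.
  by have [] := two_powers (Pw v) (Pw w) sum1.
(* If the leftover term were another pure power of [X w], an edge ending at the corner [w] would
   give [d o * t + d (P w) * t ^ a + d i * t ^ b = 0] with [a != b], which [three_powers]
   excludes. *)
have [|noaxis] := boolP [exists i in Rest, exists w, [forall (u | u != w), e i u == 0%N]].
  case/exists_inP => i iR /existsP[w /forall_inP hu]; exfalso.
  have [u [v U]] := third1 w.
  have Rest1 : Rest = [set i].
    by apply/eqP; rewrite eq_sym eqEcard cards1 cR sub1set iR.
  have [iA iS] : i \in A /\ i \notin S by move: iR; rewrite inE => /andP[].
  have iu : e i u = 0%N.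
    by apply/eqP/hu; move: U; rewrite /= !inE negb_or eq_sym => /andP[/andP[->]].
  have iv : e i v = 0%N.
    by apply/eqP/hu; move: U; rewrite /= !inE negb_or [v == w]eq_sym => /andP[/andP[_ ->]].
  have iw : e i w != 0%N.
    apply: contraNN iS => /eqP iw; rewrite inE; apply/orP; left; rewrite inE; apply/eqP/inj => // x.
    by rewrite eo; have := mem_three U x; rewrite !inE => /or3P[] /eqP ->.
  have iPw : e (P w) w != e i w.
    apply: contraNneq iS => ePi; rewrite inE; apply/orP; right; apply/imsetP; exists w => //.
    have [wu wv] : u != w /\ v != w.
      by move: U; rewrite /= !inE negb_or [w == u]eq_sym [w == v]eq_sym => /andP[/andP[]].
    apply: inj => // x; have := mem_three U x; rewrite !inE => /or3P[] /eqP -> //.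
      by rewrite iu Pu.
    by rewrite iv Pu.
  have [du dv eu ev] : [/\ d (P u) = - d o, d (P v) = - d o, e (P u) u = 1%N & e (P v) v = 1%N].
    by apply: (edge w) => // j; rewrite Rest1 inE => /eqP ->.
  have U' : uniq [:: u; v; w].
    by move: U; rewrite /= !inE !negb_or [w == u]eq_sym [w == v]eq_sym => /and3P[/andP[-> ->] -> _].
  have := @three_powers R (d o) (d (P w)) (d i) _ _ iPw.
  rewrite (negPf (dn oA)) (negPf (dn (PA w))) (negPf (dn iA)) => h3; suff: false by []; apply: h3 => t t0 t1.
  have t0' : 0 <= 1 - t by lra.
  have t1' : 1 - t <= 1 by lra.
  have := H _ (fun x => pt_ge0 v w x t0' t1') (pt_sum (1 - t) U').
  rewrite (big_three U') /= !(ptE (1 - t) U') expr0n eqn0Ngt Pw mulr0 add0r Rest1 big_set1.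
  rewrite (mono_pt _ _ U') iu iv dv ev !expr0 expr1 !mul1r subKr.
  by lra.
(* A leftover term involves at least two variables, so for each [u] it vanishes on some edge
   [X w = 0] with [w != u]. *)
have hfree u : exists w, u != w /\ forall i, i \in Rest -> e i w != 0%N.
  have [v [w U]] := third1 u.
  have [uv uw] : u != v /\ u != w by move: U; rewrite /= !inE negb_or => /andP[/andP[]].
  have [R0|/set0Pn[i iR]] := eqVneq Rest finset.set0.
    by exists w; split=> // i; rewrite R0 inE.
  have Rest1 : Rest = [set i].
    by apply/eqP; rewrite eq_sym eqEcard cards1 cR sub1set iR.
  have [iw|iw] := eqVneq (e i w) 0%N; last by exists w; split=> // j; rewrite Rest1 inE => /eqP ->.
  have [iv|iv] := eqVneq (e i v) 0%N; last by exists v; split=> // j; rewrite Rest1 inE => /eqP ->.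
  case/negP: noaxis; apply/exists_inP; exists i => //; apply/existsP; exists u.
  apply/forall_inP => x xu; have := mem_three U x; rewrite !inE (negPf xu) /= => /orP[] /eqP ->; exact/eqP.
have unit u : d (P u) = - d o /\ e (P u) u = 1%N.
  have [w [uw hw]] := hfree u.
  have wu : w != u by rewrite eq_sym.
  by have [v /edge/(_ hw)[]] := third wu.
(* At the centre of the simplex the four known terms cancel, so a leftover term would be a nonzero
   number equal to 0. *)
have R0 : Rest = finset.set0.
  apply/eqP; apply: contraT => /set0Pn[i iR].
  have Rest1 : Rest = [set i].
    by apply/eqP; rewrite eq_sym eqEcard cards1 cR sub1set iR.
  have iA : i \in A by move: iR; rewrite inE => /andP[].
  have s3 (z : R) : \sum_(w : 'I_3) z = 3 * z by rewrite sumr_const card_ord mulr_natl.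
  have p3 (v : 'I_3) : 0 <= 3^-1 :> R by rewrite invr_ge0 ler0n.
  have t3 : \sum_(v : 'I_3) 3^-1 = 1 :> R by rewrite s3 mulfV ?pnatr_eq0.
  have := H _ p3 t3; rewrite Rest1 big_set1.
  under eq_bigr => w _ do rewrite (unit w).1 (unit w).2 expr1.
  rewrite s3 => h0; have : d i * mono i (fun=> 3^-1) = 0.
    by rewrite -[RHS]h0; field.
  move/eqP; rewrite mulf_eq0 (negPf (dn iA)) /mono => /prodf_eq0[w _].
  by rewrite expf_eq0 invr_eq0 pnatr_eq0 andbF.
exists o, P; split=> //; last split=> [w v|w].
- move=> i iA; have : i \in S.
    apply: contraT => iS; have : i \in Rest by rewrite inE iS.
    by rewrite R0 inE.
  by rewrite !inE => /orP[/eqP|/imsetP[w _]]; [left|right; exists w].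
- by have [->|vw] := eqVneq v w; [rewrite (unit w).2 | rewrite Pu].
- by have [] := unit w.
Qed.

End Newton.

Section Closure.
Variables (R : rcfType) (I : finType) (A : {set I}) (d : I -> R) (e : I -> 'I_3 -> nat) (mu : 'I_3 -> nat).

(* Common factors can be cancelled at interior points, and the boundary of the
   simplex is reached by continuity. *)
Lemma vanish_closed : (forall i v, i \in A -> (mu v <= e i v)%N) ->
  (forall X : 'I_3 -> R, (forall v, 0 < X v) -> \sum_v X v = 1 ->
    \sum_(i in A) d i * \prod_v X v ^+ e i v = 0) ->
  forall X : 'I_3 -> R, (forall v, 0 <= X v) -> \sum_v X v = 1 ->
    \sum_(i in A) d i * \prod_v X v ^+ (e i v - mu v) = 0.
Proof.
move=> hmu h X X0 X1.
pose Y v : {poly R} := (X v)%:P + (3^-1 - X v) *: 'X.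
have YE v t : (Y v).[t] = X v + (3^-1 - X v) * t by rewrite hornerD hornerZ hornerX hornerC.
pose P := \sum_(i in A) d i *: \prod_v Y v ^+ (e i v - mu v).
have PE t : P.[t] = \sum_(i in A) d i * \prod_v (Y v).[t] ^+ (e i v - mu v).
  rewrite horner_sum; apply: eq_bigr => i _; rewrite hornerZ horner_prod; congr (_ * _).
  by apply: eq_bigr => v _; rewrite horner_exp.
have := @poly_eq0_at0 R P 1 ltr01; rewrite PE => P0; apply: etrans (P0 _) => [|t t0 t1].
  by apply: eq_bigr => i _; congr (_ * _); apply: eq_bigr => v _; rewrite YE mulr0 addr0.
have Yt v : 0 < (Y v).[t].
  rewrite YE; have := X0 v; have := mulr_gt0 t0 (_ : 0 < 3^-1 :> R).
  have : 0 <= X v * (1 - t) by rewrite mulr_ge0 // subr_ge0 ltW.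
  by rewrite invr_gt0 ltr0n => h1 /(_ isT) h2 h3; lra.
have Y1 : \sum_v (Y v).[t] = 1.
  under eq_bigr do rewrite YE.
  rewrite big_split /= -mulr_suml sumrB X1 sumr_const card_ord -[_^-1 *+ _]mulr_natl mulfV ?pnatr_eq0 //.
  by rewrite subrr mul0r addr0.
have nz : \prod_v (Y v).[t] ^+ mu v != 0.
  by apply/prodf_neq0 => v _; rewrite expf_neq0 // gt_eqF.
apply: (mulfI nz); rewrite mulr0 -[RHS](h _ Yt Y1) PE mulr_sumr; apply: eq_bigr => i iA.
rewrite mulrCA -big_split /=; congr (_ * _); apply: eq_bigr => v _.
by rewrite -exprD subnKC // hmu.
Qed.

End Closure.

(** * Signed weights of pairs of positions: the dichotomy *)

Section Net.
Variables (R : rcfType) (I : finType) (J : {set I}) (c : I -> R) (k u v : I -> nat).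

(* Signed weight of the items of order [K] for which [{u, v}] is [{x, y}]. *)
Definition net (K x y : nat) : R :=
  \sum_(i in J | [&& k i == K, u i == x & v i == y]) c i
  - \sum_(i in J | [&& k i == K, u i == y & v i == x]) c i.

Lemma netC K x y : net K y x = - net K x y.
Proof. by rewrite /net opprB. Qed.

Hypothesis cpos : forall i, i \in J -> 0 < c i.
Hypothesis uv : forall i, i \in J -> [/\ u i != v i, (u i < k i)%N & (v i < k i)%N].

Let a i := minn (u i) (v i).
Let b i := maxn (u i) (v i).
Let sg i : R := if (u i < v i)%N then 1 else -1.
Let key i := (k i, a i, b i).

Lemma netE i : i \in J -> net (k i) (a i) (b i) = \sum_(j in J | key j == key i) sg j * c j.
Proof.
move=> iJ; have [/eqP uvi _ _] := uv iJ.
rewrite (bigID (fun j => u j < v j)%N) /= /net -sumrN; congr (_ + _).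
  apply: eq_big => [j|j /andP[_ /and3P[_ /eqP h1 /eqP h2]]].
    case jJ: (j \in J) => //=; have [/eqP uvj _ _] := uv jJ.
    rewrite !xpair_eqE /a /b; case: (k j == k i) => //=.
    by apply/andP/andP => [[/eqP h1 /eqP h2]|[/andP[/eqP h1 /eqP h2] h3]]; split; lia.
  by rewrite /sg h1 h2 /a /b (_ : (_ < _)%N = true) ?mul1r //; lia.
apply: eq_big => [j|j /andP[_ /and3P[_ /eqP h1 /eqP h2]]].
  case jJ: (j \in J) => //=; have [/eqP uvj _ _] := uv jJ.
  rewrite !xpair_eqE /a /b; case: (k j == k i) => //=.
  by apply/andP/andP => [[/eqP h1 /eqP h2]|[/andP[/eqP h1 /eqP h2] h3]]; split; lia.
by rewrite /sg h1 h2 /a /b (_ : (_ < _)%N = false) ?mulN1r //; lia.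
Qed.

(** The three gaps left of, between and right of the two positions; they recover the order and the
    unordered pair ([key_exp]). *)
Definition edge_exp (i : I) (w : 'I_3) : nat :=
  match nat_of_ord w with 0 => a i | 1 => b i - a i - 1 | _ => k i - 1 - b i end.

Variable K : nat -> nat -> nat -> R.
Hypothesis K_gt0 : forall i, i \in J -> 0 < K (k i) (a i) (b i).
Hypothesis J5 : (#|J| <= 5)%N.
Hypothesis F2 : forall X : 'I_3 -> R, (forall w, 0 < X w) -> \sum_w X w = 1 ->
  \sum_(i in J) sg i * c i * (K (k i) (a i) (b i) * \prod_w X w ^+ edge_exp i w) = 0.

Let N i := net (k i) (a i) (b i).
(** One chosen item per key, so that different representatives have different monomials, as
    [newton_normal] requires. *)
Let rep i := odflt i [pick j in J | key j == key i].

Lemma repP i : i \in J -> rep i \in J /\ key (rep i) = key i.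
Proof.
move=> iJ; rewrite /rep; case: pickP => [j /andP[jJ /eqP] //|/(_ i)].
by rewrite iJ eqxx.
Qed.

Lemma rep_key i j : i \in J -> j \in J -> key i = key j -> rep i = rep j.
Proof.
move=> iJ jJ e; rewrite /rep (eq_pick (_ : _ =1 [pred l in J | key l == key j])) => [|l]; last by rewrite /= e.
by case: pickP => //= /(_ j) /=; rewrite jJ eqxx.
Qed.

Lemma key_ab i j : key i = key j -> [/\ k i = k j, a i = a j & b i = b j].
Proof. by case=> -> -> ->. Qed.

Lemma N_key i j : key i = key j -> N i = N j.
Proof. by move=> /key_ab[e1 e2 e3]; rewrite /N e1 e2 e3. Qed.

Lemma exp_key i j : key i = key j -> edge_exp i =1 edge_exp j.
Proof. by move=> /key_ab[e1 e2 e3] w; rewrite /edge_exp e1 e2 e3. Qed.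

Lemma key_exp i j : i \in J -> j \in J -> edge_exp i =1 edge_exp j -> key i = key j.
Proof.
move=> iJ jJ e; have [/eqP i1 i2 i3] := uv iJ; have [/eqP j1 j2 j3] := uv jJ.
have := e ord0; have := e ord_max; have := e (inord 1).
rewrite /edge_exp !inordK //= /key /a /b => h1 h2 h3.
by congr (_, _, _); lia.
Qed.

Let A := [set i in J | (rep i == i) && (N i != 0)].

Lemma rep_sum (X : 'I_3 -> R) : (forall w, 0 < X w) -> \sum_w X w = 1 ->
  \sum_(i in A) N i * K (k i) (a i) (b i) * \prod_w X w ^+ edge_exp i w = 0.
Proof.
move=> X0 X1; rewrite -[RHS](F2 X0 X1) [RHS](partition_big rep (mem J)) /=; last first.
  by move=> i iJ; have [] := repP iJ.
rewrite (eq_bigl (fun i => (i \in J) && ((rep i == i) && (N i != 0)))); last by move=> i; rewrite inE.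
rewrite big_mkcondr /=; apply: eq_bigr => j jJ.
have [rj|rj] := eqVneq (rep j) j; last first.
  rewrite /= big_pred0 // => i; apply/negbTE; apply: contraNN rj => /andP[iJ /eqP ri].
  have [rJ rk] := repP iJ; rewrite ri in rJ rk.
  by rewrite -[X in _ == X]ri; apply/eqP/rep_key.
rewrite (eq_bigl (fun i => (i \in J) && (key i == key j))); last first.
  move=> i; case iJ: (i \in J) => //=; apply/eqP/eqP => [e|e].
    by have [_] := repP iJ; rewrite e.
  by rewrite (rep_key iJ jJ e).
rewrite (eq_bigr (fun i => sg i * c i * (K (k j) (a j) (b j) * \prod_w X w ^+ edge_exp j w))); last first.
  move=> i /andP[iJ /eqP e]; have [-> -> ->] := key_ab e; congr (_ * (_ * _)).
  by apply: eq_bigr => w _; rewrite (exp_key e).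
rewrite -mulr_suml -netE // -/(N j) mulrA; case: eqVneq => //= ->; by rewrite !mul0r.
Qed.

Lemma A_empty : A = finset.set0 -> forall m x y, net m x y = 0.
Proof.
move=> A0 m x y.
have N0 i : i \in J -> N i = 0.
  move=> iJ; have [rJ rk] := repP iJ; apply/eqP; apply: contraT => Ni.
  have : rep i \in A by rewrite inE rJ (rep_key rJ iJ rk) eqxx (N_key rk).
  by rewrite A0 inE.
have [i /andP[iJ /andP[/eqP km /orP[] /andP[/eqP ux /eqP vy]]]|no] :=
    pickP [pred i in J | (k i == m) && ((u i == x) && (v i == y) || (u i == y) && (v i == x))].
- have := N0 i iJ; rewrite /N /a /b km ux vy; case: (ltnP x y) => // _.
  by rewrite netC => /eqP; rewrite oppr_eq0 => /eqP.
- have := N0 i iJ; rewrite /N /a /b km ux vy; case: (ltnP y x) => // _.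
  by rewrite netC => /eqP; rewrite oppr_eq0 => /eqP.
rewrite /net !big_pred0 ?subr0 // => i; apply/negbTE/negP => /andP[iJ /and3P[h1 h2 h3]].
  by have := no i; rewrite /= iJ h1 h2 h3 orbT.
by have := no i; rewrite /= iJ h1 h2 h3.
Qed.

Hypothesis corner0 : exists2 i, i \in J & u i = 0%N.
Hypothesis corner1 : exists2 i, i \in J & (u i).+1 = k i.

Lemma edge_dichotomy : (forall m x y, net m x y = 0) \/
  exists m s, [/\ (1 < m)%N,
   forall i, i \in J -> key i \in [:: (m, 0, m.-1); (m.+1, 1, m); (m.+1, 0, m); (m.+1, 0, m.-1)]%N,
   0 < s * net m 0 m.-1 &
   [/\ s * net m.+1 1 m < 0, s * net m.+1 0 m < 0 & s * net m.+1 0 m.-1 < 0]].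
Proof.
have [A0|/set0Pn[i0 i0A]] := eqVneq A finset.set0; [left; exact: A_empty | right].
have AJ i : i \in A -> [/\ i \in J, rep i = i & N i != 0] by rewrite inE => /and3P[-> /eqP].
have amin w : exists2 i, i \in A & forall j, j \in A -> (edge_exp i w <= edge_exp j w)%N.
  have [i iA h] := @arg_minnP _ i0 (fun j => j \in A) (fun j => edge_exp j w) i0A.
  by exists i.
have [mi miA hmi] := fin_all_exists2 amin.
pose mu w := edge_exp (mi w) w.
have muA i w : i \in A -> (mu w <= edge_exp i w)%N by exact: hmi.
have [||||X X0 X1|o [P [oA PA OP eo [eP dP]]]] :=
  @newton_normal R I A (fun i => N i * K (k i) (a i) (b i)) (fun i w => edge_exp i w - mu w)%N.
- by move=> i /AJ[iJ _ Ni]; rewrite mulf_neq0 // gt_eqF ?K_gt0.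
- move=> i j iA jA e; have [iJ <- _] := AJ i iA; have [jJ <- _] := AJ j jA.
  apply/rep_key/key_exp => // w; have := e w; have := muA i w iA; have := muA j w jA; lia.
- by apply: leq_trans J5; apply/subset_leq_card/fintype.subsetP => i /AJ[].
- by move=> w; exists (mi w); [exact: miA | rewrite subnn].
- exact: (vanish_closed muA rep_sum).
have [oJ _ No] := AJ o oA.
have PJ w : P w \in J by have [] := AJ _ (PA w).
have eP' w x : edge_exp (P w) x = (edge_exp o x + (x == w))%N.
  by have := eP w x; have := eo x; have := muA o x oA; have := muA _ x (PA w); lia.
pose w1 : 'I_3 := inord 1.
have w1E : w1 = 1%N :> nat by rewrite inordK.
have keyP w : [/\ k (P w) = (k o).+1, a (P w) = (a o + (w == ord0))%N &
    b (P w) = (b o + (w == ord0) + (w == w1))%N].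
  have := eP' w ord0; have := eP' w w1; have := eP' w ord_max.
  have [/eqP i1 i2 i3] := uv oJ; have [/eqP j1 j2 j3] := uv (PJ w).
  rewrite /edge_exp w1E /= /a /b -!val_eqE /= w1E; have := ltn_ord w.
  case: (nat_of_ord w) => [|[|[|]]] //= _ h1 h2 h3; split; lia.
(* A further class would have zero net weight, hence at least two items. *)
have keyJ i : i \in J -> key i = key o \/ exists w, key i = key (P w).
  move=> iJ; have [rJ rk] := repP iJ.
  have [rA|rA] := boolP (rep i \in A).
    by have [ro|[w rw]] := OP _ rA; [left; rewrite -ro | right; exists w; rewrite -rw].
  exfalso; have Ni : N i = 0.
    by apply/eqP; apply: contraNT rA => Ni; rewrite inE rJ (rep_key rJ iJ rk) eqxx (N_key rk).
  pose Ci := [set j in J | key j == key i].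
  have : (1 < #|Ci|)%N.
    apply: (@sum0_card _ _ _ (fun j => sg j * c j) i); first by rewrite inE iJ eqxx.
      move=> j; rewrite inE => /andP[jJ _]; apply: mulf_neq0; last by rewrite gt_eqF ?cpos.
      by rewrite /sg; case: ifP => _; rewrite ?oppr_eq0 oner_eq0.
    by rewrite -[RHS]Ni /N netE //; apply: eq_bigl => j; rewrite inE.
  have dis : [disjoint A & Ci].
    rewrite -setI_eq0; apply/eqP/setP => j; rewrite !inE; apply/negbTE/negP.
    move=> /andP[/and3P[jJ /eqP rj Nj] /andP[_ /eqP e]].
    by move: Nj; rewrite (N_key e) Ni eqxx.
  have : (#|A :|: Ci| <= 5)%N.
    by apply: leq_trans J5; apply/subset_leq_card/fintype.subsetP => j; rewrite !inE => /orP[] /andP[].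
  have /eqP -> : #|A :|: Ci| == (#|A| + #|Ci|)%N by rewrite (leq_card_setU _ _).
  have Pinj : injective P.
    move=> w w' e; apply/eqP; apply: contraT => ww; have := eP' w w; rewrite e eP' eqxx (negPf ww); lia.
  have : (#|o |: [set P w | w : 'I_3]| <= #|A|)%N.
    apply/subset_leq_card/fintype.subsetP => j; rewrite !inE => /orP[/eqP ->|/imsetP[w _ ->]].
      by move: oA; rewrite inE.
    by have := PA w; rewrite inE.
  rewrite cardsU1 card_imset // card_ord (_ : o \notin _) //; first by lia.
  apply/imsetP => -[w _ e]; have := eP' w w; rewrite -e eqxx; lia.
have [ui0 ui1] := (corner0, corner1).
have a0 : a o = 0%N.
  have [i iJ ui] := corner0; have [_ i2 i3] := uv iJ.
  have ai : a i = 0%N by rewrite /a ui min0n.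
  have [/key_ab[_ <- _]//|[w /key_ab[_ h _]]] := keyJ i iJ.
  by have [_ h' _] := keyP w; lia.
have bE : (b o).+1 = k o.
  have [i iJ ui] := corner1; have [i1 i2 i3] := uv iJ.
  have bi : (b i).+1 = k i by rewrite /b; lia.
  have [_ o2 o3] := uv oJ; have bo : (b o < k o)%N by rewrite /b; lia.
  have [/key_ab[<- _ <-]//|[w /key_ab[h1 _ h2]]] := keyJ i iJ.
  have [h3 _ h4] := keyP w.
  have : ((w == ord0) + (w == w1) <= 1)%N by case: eqP => [->|_]; rewrite -?val_eqE /= ?w1E //; case: eqP.
  by lia.
have ab : (a o < b o)%N by have [/eqP o1 _ _] := uv oJ; rewrite /a /b; lia.
exists (k o), (N o).
have bm : b o = (k o).-1 by lia.
(* The coefficients compared by [newton_normal] contain the positive factors [K], so only the signs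
   of the net weights are compared here. *)
have dN w : N o * N (P w) < 0.
  have := dP w; have := K_gt0 oJ; have := K_gt0 (PJ w).
  set Ko := K (k o) _ _; set Kp := K (k (P w)) _ _ => hp ho e.
  have : N o * N (P w) * Kp = - (N o ^+ 2 * Ko) by rewrite -mulrA e; ring.
  have : 0 < N o ^+ 2 * Ko by rewrite mulr_gt0 // exprn_even_gt0 // No orbT.
  move=> h1 h2; have : N o * N (P w) * Kp < 0 by rewrite h2 oppr_lt0.
  by rewrite pmulr_llt0.
have NP w x y : (a (P w)) = x -> b (P w) = y -> N o * net (k o).+1 x y < 0.
  by move=> <- <-; have [<- _ _] := keyP w; exact: dN.
have [h01 h02 h03] := keyP ord0; have [h11 h12 h13] := keyP w1; have [h21 h22 h23] := keyP ord_max.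
rewrite -!val_eqE /= ?w1E a0 bm /= ?addn0 ?addn1 in h01 h02 h03 h11 h12 h13 h21 h22 h23.
have ko : (1 < k o)%N by lia.
have kp : (k o).-1.+1 = k o by lia.
rewrite kp in h03 h13.
split=> //.
- move=> i iJ; rewrite !inE; have [->|[w ->]] := keyJ i iJ.
    by rewrite /key a0 bm eqxx.
  have [w0|[w0|w0]] : w = ord0 \/ w = w1 \/ w = ord_max.
    have := ltn_ord w; case e: (nat_of_ord w) => [|[|[|]]] // _.
    - by left; apply: val_inj.
    - by right; left; apply: val_inj; rewrite /= w1E.
    - by right; right; apply: val_inj.
  + by rewrite w0 /key h01 h02 h03 eqxx !orbT.
  + by rewrite w0 /key h11 h12 h13 eqxx !orbT.
  + by rewrite w0 /key h21 h22 h23 eqxx !orbT.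
- have -> : net (k o) 0 (k o).-1 = N o by rewrite /N a0 bm.
  by rewrite -expr2 exprn_even_gt0 // No orbT.
- by split; [apply: (NP ord0) | apply: (NP w1) | apply: (NP ord_max)].
Qed.

End Net.

(** * The conditions at the bottom side for the active items *)

Lemma sum_perm_at (R : realFieldType) (k : nat) (f : 'I_k.+1 -> R) :
  \sum_(s : 'S_k.+1) f (s^-1%g ord0) = k`!%:R * \sum_u f u.
Proof.
have h j : \sum_(s : 'S_k.+1) f (s^-1%g ord0) = \sum_(s : 'S_k.+1) f (s^-1%g j).
  rewrite (reindex_inj (mulIg (tperm ord0 j))); apply: eq_bigr => s _.
  by rewrite invMg permM tpermV tpermL.
have k0 : k.+1%:R != 0 :> R by rewrite pnatr_eq0.
apply: (mulfI k0); rewrite mulrA -natrM -factS.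
transitivity (\sum_(j : 'I_k.+1) \sum_(s : 'S_k.+1) f (s^-1%g j)).
  by rewrite -(eq_bigr _ (fun j _ => h j)) sumr_const card_ord mulr_natl.
rewrite exchange_big /= (eq_bigr (fun=> \sum_u f u)) => [|s _].
  by rewrite sumr_const card_Sn mulr_natl.
by rewrite [RHS](reindex_inj (@perm_inj _ s^-1%g)).
Qed.

Section Kap.
Variable R : rcfType.

(** The binomial theorem, obtained by summing over all patterns: with the lowest point in column 1,
    some pattern occurs with total probability 1. *)
Lemma kap1_sum k (X Z : R) : X + Z = 1 ->
  k`!%:R * \sum_(u : 'I_k.+1) kap1 R k.+1 u * (X ^+ u * Z ^+ (k.+1 - 1 - u)) = 1.
Proof.
move=> XZ; pose rows (l : nat) (a : 'I_3) : R := vec1 (delta R (inord 1)) (fun a : 'I_3 => mass1 X Z a) l a.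
rewrite -(sum_perm_at (fun u : 'I_k.+1 => kap1 R k.+1 u * (X ^+ u * Z ^+ (k.+1 - 1 - u)))).
transitivity (\sum_(s : 'S_k.+1) tens (@cell 3) s rows).
  apply: eq_bigr => s _; apply/esym; apply: tens_step1 => [a|j a ju].
    by rewrite permKV /rows /= /delta -val_eqE /= inordK.
  have -> : (s j : nat) = (s j).-1.+1; last by [].
  rewrite prednK // lt0n; apply: contraNN ju => /eqP tj.
  by rewrite -(permK s j); apply/eqP; congr (_ _); apply: val_inj.
rewrite /tens exchange_big /= (eq_bigr (fun g : {ffun 'I_k.+1 -> 'I_3} => \prod_(l < k.+1) rows l (g l))); last first.
  by move=> g _; rewrite -mulr_sumr -[RHS]mulr1 -(sum_tie R (fun i => cell (g i))).
rewrite -(bigA_distr_bigA (fun (l : 'I_k.+1) a => rows l a)) big1 // => -[[|l] hl] _ /=.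
  by rewrite (bigD1 (inord 1)) //= /rows /= /delta eqxx big1 ?addr0 // => i /negPf ->.
by rewrite !big_ord_recr big_ord0 /= add0r addr0.
Qed.

Lemma kap1_0 k : k`!%:R * kap1 R k.+1 0 = 1.
Proof.
rewrite -[RHS](@kap1_sum k 0 1); last by rewrite add0r.
rewrite big_ord_recl /= expr0 expr1n !mulr1 big1 ?addr0 // => i _.
by rewrite /= expr0n mul0r mulr0.
Qed.

Lemma kap1_last k : k`!%:R * kap1 R k.+1 k = 1.
Proof.
rewrite -[RHS](@kap1_sum k 1 0); last by rewrite addr0.
rewrite big_ord_recr /= subSS subn0 subnn expr0 expr1n !mulr1 big1 ?add0r // => i _.
by rewrite expr0n subn_eq0 leqNgt ltn_ord mulr0 mulr0.
Qed.

End Kap.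

Definition active (R : rcfType) q (c : 'I_q -> R) (s : 'I_q -> permutation) : {set 'I_q} :=
  [set i | (0 < c i) && (1 < perm_order (s i))%N].

Definition bnet (R : rcfType) q (c : 'I_q -> R) (s : 'I_q -> permutation) : nat -> nat -> nat -> R :=
  net (active c s) c (fun i => perm_order (s i)) (fun i => pos (s i) 0) (fun i => pos (s i) 1).

(** The conditions derived above are equalities, hence insensitive to the sign of [c]; maxima and
    minima are treated together up to the last step. *)
Definition two_sided (R : rcfType) q (c : 'I_q -> R) (s : 'I_q -> permutation) : Prop :=
  extremal c s \/ extremal (fun i => - c i) s.

Section Bottom.
Variables (R : rcfType) (q : nat) (c : 'I_q -> R) (s : 'I_q -> permutation).
Hypothesis c0 : forall i, 0 <= c i.
Hypothesis ext : two_sided c s.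
Let J := active c s.
Let k i := perm_order (s i).

Lemma two_sided_inv : two_sided c (fun i => pinv (s i)).
Proof. by case: ext => h; [left | right]; exact: extremal_inv. Qed.

Lemma two_sided_comp : two_sided c (fun i => pcompl (s i)).
Proof. by case: ext => h; [left | right]; exact: extremal_comp. Qed.

Lemma off_active i : i \notin J -> c i = 0 \/ (k i <= 1)%N.
Proof.
rewrite inE negb_and -leNgt -leqNgt => /orP[h|]; last by right.
by left; apply/eqP; rewrite eq_le h c0.
Qed.

(** Items outside [J] have coefficient 0 or order at most 1, and in those orders the term is 0. *)
Lemma bernstein (X Z : R) : 0 <= X -> 0 <= Z -> X + Z = 1 ->
  \sum_(i in J) c i * ((k i)%:R * (kap1 R (k i) (pos (s i) 0) *
     (X ^+ pos (s i) 0 * Z ^+ (k i - 1 - pos (s i) 0)) - (k i)`!%:R^-1)) = 0.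
Proof.
move=> X0 Z0 XZ; pose F i : R := (0 < k i)%N%:R * ((k i)%:R * (kap1 R (k i) (pos (s i) 0) *
     (X ^+ pos (s i) 0 * Z ^+ (k i - 1 - pos (s i) 0)) - (k i)`!%:R^-1)).
have : \sum_i c i * F i = 0.
  case: ext => h; first exact (edge_first h X0 Z0 XZ).
  apply: oppr_inj; rewrite oppr0 -[RHS](edge_first h X0 Z0 XZ) -sumrN.
  by apply: eq_bigr => i _; rewrite mulNr.
rewrite (bigID (mem J)) /= [X in _ + X]big1 ?addr0 => [h|i iJ].
  apply: etrans h; apply: eq_bigr => i; rewrite inE => /andP[_ k1]; congr (_ * _).
  by rewrite /F (ltn_trans _ k1) // mul1r.
have [->|] := off_active iJ; first by rewrite mul0r.
rewrite /F leq_eqVlt => /orP[/eqP k1|]; last by rewrite ltnS leqn0 => /eqP ->; rewrite mul0r mulr0.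
have p0 : pos (s i) 0 = 0%N.
  by apply/eqP; rewrite -leqn0 -ltnS -k1 pos_lt // -/(k i) k1.
rewrite p0 k1 -[kap1 R 1 0]mul1r (_ : 1 * kap1 R 1 0 = 1) ?(kap1_0 R 0) //.
by rewrite !expr0 invr1 !mulr1 subrr !mulr0.
Qed.

Definition om i : R := c i / ((k i).-1)`!%:R.

Lemma om_gt0 i : i \in J -> 0 < om i.
Proof. by rewrite inE => /andP[h _]; rewrite divr_gt0 // ltr0n fact_gt0. Qed.

Let om_fact i : i \in J -> c i * ((k i)%:R * (k i)`!%:R^-1) = om i.
Proof.
rewrite inE /om => /andP[_]; rewrite -/(k i); case: (k i) => // n _ /=.
have n1 : n.+1%:R != 0 :> R by rewrite pnatr_eq0.
by rewrite factS natrM invfM [n.+1%:R * _]mulrA mulfV ?mul1r.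
Qed.

(** The Bernstein identity at X = 0, where only items with the lowest value in the first position
    survive. *)
Lemma corner_first : \sum_(i in J | pos (s i) 0 == 0%N) om i * (k i)%:R = \sum_(i in J) om i.
Proof.
have := bernstein (lexx 0) ler01 (add0r 1).
under eq_bigr do rewrite mulrBr mulrBr.
rewrite sumrB => /eqP; rewrite subr_eq0 => /eqP h.
rewrite -(eq_bigr _ om_fact) -h [RHS](bigID (fun i => pos (s i) 0 == 0%N)) /=.
rewrite [X in _ = _ + X]big1 ?addr0 => [|i /andP[_ /negPf p0]]; last by rewrite expr0n p0 mul0r !mulr0.
apply: eq_bigr => i /andP[iJ /eqP ->]; rewrite expr0 expr1n !mulr1 /om.
move: iJ; rewrite inE => /andP[_]; rewrite -/(k i); case: (k i) => // n _ /=.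
have n0 : n`!%:R != 0 :> R by rewrite pnatr_eq0 -lt0n fact_gt0.
have := kap1_0 R n; move=> /(canRL (mulKf n0)); rewrite mulr1 => ->.
by ring.
Qed.

Lemma corner_last : \sum_(i in J | (pos (s i) 0).+1 == k i) om i * (k i)%:R = \sum_(i in J) om i.
Proof.
have := bernstein ler01 (lexx 0) (addr0 1).
under eq_bigr do rewrite mulrBr mulrBr.
rewrite sumrB => /eqP; rewrite subr_eq0 => /eqP h.
rewrite -(eq_bigr _ om_fact) -h [RHS](bigID (fun i => (pos (s i) 0).+1 == k i)) /=.
rewrite [X in _ = _ + X]big1 ?addr0 => [|i /andP[iJ p0]]; last first.
  rewrite expr0n (_ : (_ == _) = false) ?mulr0 //; apply/negbTE; apply: contraNN p0.
  move: iJ; rewrite inE => /andP[_ k1]; have := @pos_lt (s i) 0 (ltn_trans (ltn0Sn 0) k1).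
  rewrite -/(k i); lia.
apply: eq_bigr => i /andP[iJ /eqP e]; rewrite -e subSS subn0 subnn expr0 expr1n !mulr1 /om -e.
have n0 : (pos (s i) 0)`!%:R != 0 :> R by rewrite pnatr_eq0 -lt0n fact_gt0.
have := kap1_last R (pos (s i) 0); move=> /(canRL (mulKf n0)); rewrite mulr1 => ->.
by rewrite /=; ring.
Qed.

Lemma active_pos i : i \in J ->
  [/\ pos (s i) 0 != pos (s i) 1, (pos (s i) 0 < k i)%N & (pos (s i) 1 < k i)%N].
Proof.
rewrite inE => /andP[_ k1]; have k0 := ltn_trans (ltn0Sn 0) k1.
split; try exact: pos_lt.
by apply/negP => /eqP e; have := posK k1; rewrite -e posK.
Qed.

(** The corner identities have positive right-hand sides, which supplies the items with lowest value
    at either end that [edge_dichotomy] asks for. *)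
Lemma bottom_dichotomy : (#|J| <= 5)%N -> J != finset.set0 -> (forall m x y, bnet c s m x y = 0) \/
  exists m z, [/\ (1 < m)%N,
   forall i, i \in J -> (k i, minn (pos (s i) 0) (pos (s i) 1), maxn (pos (s i) 0) (pos (s i) 1))
      \in [:: (m, 0, m.-1); (m.+1, 1, m); (m.+1, 0, m); (m.+1, 0, m.-1)]%N,
   0 < z * bnet c s m 0 m.-1 &
   [/\ z * bnet c s m.+1 1 m < 0, z * bnet c s m.+1 0 m < 0 & z * bnet c s m.+1 0 m.-1 < 0]].
Proof.
move=> J5 /set0Pn[i0 i0J].
have omJ : 0 < \sum_(i in J) om i.
  rewrite (bigD1 i0) //= ltr_pwDl ?om_gt0 // sumr_ge0 // => i /andP[/om_gt0/ltW].
  by [].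
have corner (P : pred 'I_q) : \sum_(i in J | P i) om i * (k i)%:R = \sum_(i in J) om i -> exists2 i, i \in J & P i.
  move=> h; have [i /andP[iJ Pi]|no] := pickP [pred i in J | P i]; first by exists i.
  by move: omJ; rewrite -h big_pred0 ?ltxx.
apply: (@edge_dichotomy R _ J c k _ _ _ active_pos (fun k a b => wt2 R k * kap2 R k a b)).
- by move=> i; rewrite inE => /andP[].
- move=> i iJ; have [/eqP i1 i2 i3] := active_pos iJ.
  by rewrite mulr_gt0 ?wt2_gt0 // kap2_gt0 // -/(k i); lia.
- exact: J5.
- move=> X X0 X1; pose w1 : 'I_3 := inord 1.
  have w1E : w1 = 1%N :> nat by rewrite inordK.
  have U : uniq [:: ord0; w1; ord_max] by rewrite /= !inE -!val_eqE /= w1E.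
  have X1' : X ord0 + X w1 + X ord_max = 1 by rewrite -X1 (big_three U) /= addrA.
  pose F i : R := (1 < k i)%N%:R * (wt2 R (k i) *
    (edge_term (k i) (pos (s i) 0) (pos (s i) 1) (X ord0) (X w1) (X ord_max)
     - edge_term (k i) (pos (s i) 1) (pos (s i) 0) (X ord0) (X w1) (X ord_max))).
  have : \sum_i c i * F i = 0.
    have e2 c' (h : extremal c' s) := edge_second h (ltW (X0 ord0)) (ltW (X0 w1)) (ltW (X0 ord_max)) X1'.
    case: ext => h; first exact (e2 _ h).
    apply: oppr_inj; rewrite oppr0 -[RHS](e2 _ h) -sumrN.
    by apply: eq_bigr => i _; rewrite mulNr.
  rewrite (bigID (mem J)) /= [X in _ + X]big1 ?addr0 => [h|i iJ]; last first.
    have [->|] := off_active iJ; first by rewrite mul0r.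
    by rewrite /F ltnNge => ->; rewrite mul0r mulr0.
  apply: etrans h; apply: eq_bigr => i iJ; have [uvi _ _] := active_pos iJ.
  rewrite mulrAC [RHS]mulrC; congr (_ * _).
  rewrite /F (big_three U) /= /edge_exp w1E /= /edge_term.
  have -> : (1 < k i)%N by move: iJ; rewrite inE => /andP[].
  rewrite mul1r; case: (ltngtP (pos (s i) 0) (pos (s i) 1)) uvi => //= _ _.
    by rewrite mul0r subr0; ring.
  by rewrite mul0r sub0r; ring.
- by have [i iJ /eqP e] := corner _ corner_first; exists i.
- by have [i iJ /eqP e] := corner _ corner_last; exists i.
Qed.

End Bottom.

(** The counting device of the later arguments: six distinct labels of active items contradict the
    bound 5. *)
Lemma size_le_card (I : finType) (J : {set I}) (T : eqType) (f : I -> T) (L : seq T) : uniq L ->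
  (forall x, x \in L -> exists2 i, i \in J & f i = x) -> (size L <= #|J|)%N.
Proof.
move=> uL h; rewrite cardE -(size_map f); apply: uniq_leq_size => // x /h[i iJ <-].
by apply: map_f; rewrite mem_enum.
Qed.

Section NetFacts.
Variables (R : rcfType) (I : finType) (J : {set I}) (c : I -> R) (k u v : I -> nat).
Hypothesis cpos : forall i, i \in J -> 0 < c i.

Lemma net_pos_item K x y : 0 < net J c k u v K x y ->
  exists2 i, i \in J & [/\ k i = K, u i = x & v i = y].
Proof.
move=> h; have [i /andP[iJ /and3P[/eqP h1 /eqP h2 /eqP h3]]|no] :=
  pickP [pred i in J | [&& k i == K, u i == x & v i == y]]; first by exists i.
move: h; rewrite /net big_pred0 // sub0r oppr_gt0 ltNge sumr_ge0 // => i /andP[/cpos/ltW //].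
Qed.

Lemma net_neg_item K x y : net J c k u v K x y < 0 ->
  exists2 i, i \in J & [/\ k i = K, u i = y & v i = x].
Proof. by rewrite -oppr_gt0 -netC => /net_pos_item. Qed.

(** All weights are positive, so the contribution of [i] can only be cancelled by an item with the
    two positions exchanged. *)
Lemma net0_partner i : i \in J -> net J c k u v (k i) (u i) (v i) = 0 ->
  exists2 j, j \in J & [/\ k j = k i, u j = v i & v j = u i].
Proof.
move=> iJ h.
have [j /andP[jJ /and3P[/eqP h1 /eqP h2 /eqP h3]]|no] :=
  pickP [pred j in J | [&& k j == k i, u j == v i & v j == u i]]; first by exists j.
move: h; rewrite /net [X in _ - X]big_pred0 // subr0 (bigD1 i) /=; last by rewrite iJ !eqxx.
move/eqP; rewrite gt_eqF // ltr_pwDl ?cpos // sumr_ge0 // => j /andP[/andP[/cpos/ltW]].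
by [].
Qed.

End NetFacts.

Lemma eq_net (R : rcfType) (I : finType) (J : {set I}) (c : I -> R) (k u v u' v' : I -> nat) K x y x' y' :
  (forall i, i \in J -> k i = K -> (u i == x) && (v i == y) = (u' i == x') && (v' i == y')) ->
  (forall i, i \in J -> k i = K -> (u i == y) && (v i == x) = (u' i == y') && (v' i == x')) ->
  net J c k u v K x y = net J c k u' v' K x' y'.
Proof.
move=> h1 h2; congr (_ - _); apply: eq_bigl => i; case iJ: (i \in J) => //=;
  case: eqP => //= e; by [exact: h1 | exact: h2].
Qed.

(** The second alternative of [bottom_dichotomy], the shape of a multiple of 1 - X - Y - Z: [m] is
    the order of the constant term, and [z] serves to fix the sign. *)
Definition exceptional (R : rcfType) q (c : 'I_q -> R) (s : 'I_q -> permutation) (m : nat) (z : R) : Prop :=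
  [/\ (1 < m)%N,
   forall i, i \in active c s ->
     (perm_order (s i), minn (pos (s i) 0) (pos (s i) 1), maxn (pos (s i) 0) (pos (s i) 1))
      \in [:: (m, 0, m.-1); (m.+1, 1, m); (m.+1, 0, m); (m.+1, 0, m.-1)]%N,
   0 < z * bnet c s m 0 m.-1 &
   [/\ z * bnet c s m.+1 1 m < 0, z * bnet c s m.+1 0 m < 0 & z * bnet c s m.+1 0 m.-1 < 0]].

Section Exceptional.
Variables (R : rcfType) (q : nat) (c : 'I_q -> R) (s : 'I_q -> permutation) (m : nat) (z : R).
Hypothesis exc : exceptional c s m z.
Let J := active c s.
Let k i := perm_order (s i).

Let cpos i : i \in J -> 0 < c i. Proof. by rewrite inE => /andP[]. Qed.

Lemma exceptional_order i : i \in J -> k i = m \/ k i = m.+1.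
Proof.
case: exc => _ h _ _ /h; rewrite !inE !xpair_eqE -/(k i).
by case/or4P => /andP[/andP[/eqP -> _] _]; [left|right|right|right].
Qed.

Lemma exceptional_key i : i \in J -> k i = m ->
  minn (pos (s i) 0) (pos (s i) 1) = 0%N /\ maxn (pos (s i) 0) (pos (s i) 1) = m.-1.
Proof.
case: exc => _ h _ _ /h + km; rewrite !inE !xpair_eqE -/(k i) km => /or4P[].
- by case/andP => /andP[_ /eqP ->] /eqP ->.
- by rewrite -{1}[m]addn0 -addn1 eqn_add2l.
- by rewrite -{1}[m]addn0 -addn1 eqn_add2l.
- by rewrite -{1}[m]addn0 -addn1 eqn_add2l.
Qed.

(** The sign of a single net weight decides, for all three classes of order [m.+1] at once, which of
    the values 0 and 1 stands to the left. *)
Lemma exceptional_items : let b := 0 < bnet c s m 0 m.-1 in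
  exists i0 i1 i2 i3, [/\ [/\ i0 \in J, i1 \in J, i2 \in J & i3 \in J],
   [/\ k i0 = m, k i1 = m.+1, k i2 = m.+1 & k i3 = m.+1] &
   [/\ if b then (pos (s i1) 0, pos (s i1) 1) = (m, 1%N) else (pos (s i1) 0, pos (s i1) 1) = (1%N, m),
       if b then (pos (s i2) 0, pos (s i2) 1) = (m, 0%N) else (pos (s i2) 0, pos (s i2) 1) = (0%N, m) &
       if b then (pos (s i3) 0, pos (s i3) 1) = (m.-1, 0%N) else (pos (s i3) 0, pos (s i3) 1) = (0%N, m.-1)]].
Proof.
case: exc => _ _ h0 [h1 h2 h3] b.
case: (ltgtP 0 z) => z0; last by move: h0; rewrite -z0 mul0r ltxx.
  rewrite !pmulr_rlt0 ?pmulr_rgt0 // in h0 h1 h2 h3.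
  rewrite /b h0.
  have [i0 i0J [e0 _ _]] := net_pos_item cpos h0.
  have [i1 i1J [e1 f1 g1]] := net_neg_item cpos h1.
  have [i2 i2J [e2 f2 g2]] := net_neg_item cpos h2.
  have [i3 i3J [e3 f3 g3]] := net_neg_item cpos h3.
  by exists i0, i1, i2, i3; split; split; rewrite ?f1 ?f2 ?f3 ?g1 ?g2 ?g3.
rewrite !nmulr_rlt0 ?nmulr_rgt0 // in h0 h1 h2 h3.
rewrite /b ltNge (ltW h0) /=.
have [i0 i0J [e0 _ _]] := net_neg_item cpos h0.
have [i1 i1J [e1 f1 g1]] := net_pos_item cpos h1.
have [i2 i2J [e2 f2 g2]] := net_pos_item cpos h2.
have [i3 i3J [e3 f3 g3]] := net_pos_item cpos h3.
by exists i0, i1, i2, i3; split; split; rewrite ?f1 ?f2 ?f3 ?g1 ?g2 ?g3.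
Qed.

End Exceptional.

Lemma pos_inj (t : permutation) a b : (a < perm_order t)%N -> (b < perm_order t)%N ->
  pos t a = pos t b -> a = b.
Proof. by move=> ha hb e; rewrite -(posK ha) e posK. Qed.

Lemma pos_eqP (t : permutation) a b : (a < perm_order t)%N -> (b < perm_order t)%N ->
  (pos t a == pos t b) = (a == b).
Proof. by move=> ha hb; apply/eqP/eqP => [/pos_inj->|->]. Qed.

Lemma net_pair (R : rcfType) (I : finType) (J : {set I}) (c : I -> R) (k u v : I -> nat) i j :
  i \in J -> j \in J -> k j = k i -> (forall l, l \in J -> k l = k i -> l = i \/ l = j) ->
  u j = v i -> v j = u i -> u i != v i ->
  net J c k u v (k i) (u i) (v i) = c i - c j.
Proof.
move=> iJ jJ kj only uj vj uv; congr (_ - _).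
  rewrite (big_pred1 i) // => l; apply/andP/eqP => [[lJ /and3P[/eqP kl /eqP ul /eqP vl]]|->].
    by have [//|e] := only l lJ kl; move: uv; rewrite -ul e uj eqxx.
  by rewrite !eqxx.
rewrite (big_pred1 j) // => l; apply/andP/eqP => [[lJ /and3P[/eqP kl /eqP ul /eqP vl]]|->].
  by have [e|//] := only l lJ kl; move: uv; rewrite -ul e eqxx.
by rewrite kj uj vj !eqxx.
Qed.

Lemma other_of_three (a b c : nat) : (a < 3)%N -> (b < 3)%N -> (c < 3)%N ->
  a != b -> a != c -> b != c -> a = (3 - b - c)%N.
Proof. lia. Qed.

Lemma minmax_cases a b n : minn a b = 0%N -> maxn a b = n ->
  (a = 0%N /\ b = n) \/ (b = 0%N /\ a = n).
Proof. lia. Qed.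

Lemma uniq_keys m : (2 < m)%N ->
  uniq [:: (m, 1); (m, 0); (m.-1, 0)]%N && uniq [:: (1, m); (0, m); (0, m.-1)]%N.
Proof. by case: m => // m; rewrite /= !inE !xpair_eqE !negb_or; lia. Qed.

(** * Excluding the exceptional alternative *)

Section NoExceptional.
Variables (R : rcfType) (c : 'I_5 -> R) (s : 'I_5 -> permutation).
Hypothesis c0 : forall i, 0 <= c i.
Hypothesis ext : two_sided c s.
Let J := active c s.
Hypothesis Jn : J != finset.set0.
Let k i := perm_order (s i).
Let top i := pcompl (s i).
Let left_ i := pinv (s i).

Let J5 : (#|J| <= 5)%N. Proof. by apply: leq_trans (max_card _) _; rewrite card_ord. Qed.
Let cpos i : i \in J -> 0 < c i. Proof. by rewrite inE => /andP[]. Qed.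
Let k1 i : i \in J -> (1 < k i)%N. Proof. by rewrite inE => /andP[]. Qed.

Lemma top_pos i : i \in J -> pos (top i) 0 = pos (s i) (k i - 1) /\ pos (top i) 1 = pos (s i) (k i - 2).
Proof.
move=> /k1 h; rewrite /top !pos_pcompl -/(k i) //; last exact: ltn_trans h.
by rewrite subn0 -subnDA.
Qed.

Let dich (t : 'I_5 -> permutation) : two_sided c t -> active c t = J ->
  (forall m x y, bnet c t m x y = 0) \/ exists m z, exceptional c t m z.
Proof. by move=> et eJ; apply: bottom_dichotomy; rewrite ?eJ. Qed.

Lemma exceptional_bnet_neq0 t m z : exceptional c t m z -> bnet c t m 0 m.-1 != 0.
Proof. by case=> _ _ h _; apply: contraTneq h => ->; rewrite mulr0 ltxx. Qed.

(** In order 2 the two top values are the two bottom values in the other order, so for m = 2 the top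
    side is exceptional too, with opposite sign. The items of order 3 demanded by both sides and one
    item of order 2 are at least six. *)
Lemma exceptional_gt2 m z : exceptional c s m z -> (2 < m)%N.
Proof.
move=> exc; have m1 : (1 < m)%N by case: exc.
rewrite ltn_neqAle m1 andbT; apply/negP => /eqP m2; move: exc; rewrite -{}m2 => exc.
have [i0 [i1 [i2 [i3 [[i0J i1J i2J i3J] [e0 e1 e2 e3] q]]]]] := exceptional_items exc.
have N2 : bnet c top 2 0 1 = - bnet c s 2 0 1.
  rewrite -netC; apply: eq_net => i iJ ki; have [-> ->] := top_pos iJ; rewrite (ki : k i = 2%N) andbC //.
case: (dich (two_sided_comp ext) erefl) => [Z|[m' [z' exc']]].
  by have := exceptional_bnet_neq0 exc; rewrite -oppr_eq0 -N2 Z eqxx.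
have [j0 [j1 [j2 [j3 [[j0J j1J j2J j3J] [f0 f1 f2 f3] r]]]]] := exceptional_items exc'.
have m2 : m' = 2%N.
  have o1 : k i0 = m' \/ k i0 = m'.+1 := exceptional_order exc' i0J.
  have o2 : k i1 = m' \/ k i1 = m'.+1 := exceptional_order exc' i1J.
  by move: o1 o2; rewrite /k e0 e1; lia.
move: f0 f1 f2 f3 r; rewrite {}m2 => f0 f1 f2 f3.
have third i : i \in J -> k i = 3%N -> [/\ pos (s i) 0 < 3, pos (s i) 1 < 3 & pos (s i) 2 < 3]%N /\
    [/\ pos (s i) 0 != pos (s i) 1, pos (s i) 0 != pos (s i) 2 & pos (s i) 1 != pos (s i) 2].
  move=> iJ ki; have lt a : (a < 3)%N -> (pos (s i) a < 3)%N by move=> h; rewrite -ki pos_lt // -/(k i) ki.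
  by split; split; rewrite ?lt // pos_eqP // -/(k i) ki.
have [t1 t1'] := top_pos j1J; have [t2 t2'] := top_pos j2J; have [t3 t3'] := top_pos j3J.
have [[a1 a2 a3] [a4 a5 a6]] := third _ j1J f1.
have [[b1 b2 b3] [b4 b5 b6]] := third _ j2J f2.
have [[d1 d2 d3] [d4 d5 d6]] := third _ j3J f3.
rewrite -[bnet c (fun _ => _) _ _ _]/(bnet c top 2 0 1) N2 oppr_gt0 /=; move: q; rewrite /=.
rewrite (f1 : k j1 = 3%N) (f2 : k j2 = 3%N) (f3 : k j3 = 3%N) /top -?[(3 - 1)%N]/2%N -?[(3 - 2)%N]/1%N /= in t1 t1' t2 t2' t3 t3'.
rewrite t1 t1' t2 t2' t3 t3'.
(* The label (9, 9) marks order 2; no pair of positions in order 3 equals it. *)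
move=> q r; pose f i := if k i == 2%N then (9, 9)%N else (pos (s i) 0, pos (s i) 1).
have fE i x y : k i = 3%N -> pos (s i) 0 = x -> pos (s i) 1 = y -> f i = (x, y) by rewrite /f => -> -> ->.
have f9 : f i0 = (9, 9)%N by rewrite /f /k e0.
suff [L [uL sL hL]] : exists L : seq (nat * nat), [/\ uniq L, size L = 6%N & forall x, x \in L -> exists2 i, i \in J & f i = x].
  by have := leq_trans (size_le_card uL hL) J5; rewrite sL.
have nz : bnet c s 2 0 1 != 0 := exceptional_bnet_neq0 exc.
have [bp|] := ltP 0 (bnet c s 2 0 1).
  move: q r; rewrite bp (lt_gtF bp) => -[[p1 q1] [p2 q2] [p3 q3]] [[p4 q4] [p5 q5] [p6 q6]].
  exists [:: (9, 9); (2, 1); (2, 0); (1, 0); (0, 2); (1, 2)]%N; split=> // x; rewrite !inE.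
  case/or4P=> [||| /or3P[]] /eqP ->.
  - by exists i0.
  - by exists i1 => //; apply: fE.
  - by exists i2 => //; apply: fE.
  - by exists i3 => //; apply: fE.
  - by exists j1 => //; apply: fE => //; rewrite (other_of_three a1 a2 a3) // p4 q4.
  - by exists j2 => //; apply: fE => //; rewrite (other_of_three b1 b2 b3) // p5 q5.
rewrite le_eqVlt (negPf nz) /= => bn; move: q r; rewrite bn (lt_gtF bn) => -[[p1 q1] [p2 q2] [p3 q3]] [[p4 q4] [p5 q5] [p6 q6]].
exists [:: (9, 9); (1, 2); (0, 2); (0, 1); (1, 0); (2, 0)]%N; split=> // x; rewrite !inE.
case/or4P=> [||| /or3P[]] /eqP ->.
- by exists i0.
- by exists i1 => //; apply: fE.
- by exists i2 => //; apply: fE.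
- by exists i3 => //; apply: fE.
- by exists j2 => //; apply: fE => //; rewrite (other_of_three b1 b2 b3) // p5 q5.
- by exists j3 => //; apply: fE => //; rewrite (other_of_three d1 d2 d3) // p6 q6.
Qed.

(** The top side is not exceptional as well, because the two lowest and the two highest values of
    [i0] cannot occupy the same two end positions. So [i0] has a top partner [j], and with [i1],
    [i2], [i3] these are all the active items. Then [i0] and [j] have equal weights and agree on the
    two lowest values, and both alternatives fail at the left side. *)
Lemma not_exceptional m z : ~ exceptional c s m z.
Proof.
move=> exc; have m2 := exceptional_gt2 exc.
have [i0 [i1 [i2 [i3 [[i0J i1J i2J i3J] [e0 e1 e2 e3] q]]]]] := exceptional_items exc.
have order_eq t m' z' : (forall i, perm_order (t i) = perm_order (s i)) -> active c t = J ->
    exceptional c t m' z' -> m' = m.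
  move=> kt eJ exc'.
  have a0 : i0 \in active c t by rewrite eJ.
  have a1 : i1 \in active c t by rewrite eJ.
  by have := exceptional_order exc' a0; have := exceptional_order exc' a1; rewrite !kt e0 e1; lia.
have lt i a : i \in J -> k i = m -> (a < m)%N -> (a < perm_order (s i))%N by move=> _ <-.
have key i (iJ : i \in J) (ki : k i = m) := exceptional_key exc iJ ki.
have [Z|[m' [z' exc']]] := dich (two_sided_comp ext) erefl; last first.
  have mm := order_eq top m' z' (fun _ => erefl) erefl exc'; subst m'.
  have [h1 h2] := key _ i0J e0; have [] := exceptional_key exc' i0J e0.
  have [-> ->] := top_pos i0J; rewrite /k e0 => h3 h4.
  have n1 : pos (s i0) 0 != pos (s i0) (m - 1) by rewrite pos_eqP ?lt //; lia.
  have n2 : pos (s i0) 1 != pos (s i0) (m - 1) by rewrite pos_eqP ?lt //; lia.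
  lia.
have [j jJ [kj pj pj']] := net0_partner cpos i0J (Z (k i0) (pos (top i0) 0) (pos (top i0) 1)).
have {}kj : k j = m := etrans kj e0.
have [tj tj'] := top_pos jJ; have [t0 t0'] := top_pos i0J.
rewrite /= -/(top j) tj tj' -/(top i0) t0 t0' kj /k e0 in pj pj'.
have nn : pos (s i0) (m - 1) != pos (s i0) (m - 2) by rewrite pos_eqP ?lt //; lia.
have ji : j != i0 by apply: contraNneq nn => e; rewrite -[X in X == _]pj' e.
have u123 : uniq [:: i1; i2; i3].
  apply: (@map_uniq _ _ (fun x => (pos (s x) 0, pos (s x) 1))) => /=.
  have /andP[v1 v2] := uniq_keys m2.
  by case: (0 < _) q => -[x1 x2 x3]; rewrite ?x1 ?x2 ?x3.
have only l : l \in J -> k l = m -> l = i0 \/ l = j.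
  move=> lJ kl; have [->|li] := eqVneq l i0; first by left.
  have [->|lj] := eqVneq l j; first by right.
  exfalso; have neq x y : k x = m -> k y = m.+1 -> x != y.
    by move=> kx ky; apply/eqP => e; move: ky; rewrite -e kx => /n_Sn.
  have U : uniq [:: l; i0; j; i1; i2; i3].
    rewrite /= in u123 *.
    by rewrite u123 !inE !negb_or li lj [i0 == j]eq_sym ji /= !neq.
  suff /leq_trans/(_ J5) : (6 <= #|J|)%N by [].
  apply: (size_le_card U (f := id)) => x; rewrite !inE => h; exists x => //; move: h.
  by case/or4P => [||| /or3P[]] /eqP ->.
have ke0 : k i0 = m := e0.
(* Only [i0] and [j] have order [m], and their weights cancel in a vanishing net weight of the top
   side. *)
have cj : c i0 = c j.
  apply/eqP; rewrite -subr_eq0; apply/eqP.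
  rewrite -[RHS](Z (k i0) (pos (top i0) 0) (pos (top i0) 1)).
  apply/esym; apply: (@net_pair _ _ J c k (fun i => pos (top i) 0) (fun i => pos (top i) 1) i0 j) => //.
  - by rewrite kj ke0.
  - by rewrite ke0.
  - by rewrite t0' tj kj ke0.
  - by rewrite t0 tj' kj ke0.
  - by rewrite t0 t0' ke0.
have m_gt1 : (1 < m)%N by exact: ltnW.
have m_gt0 : (0 < m)%N by exact: ltnW.
have m1_neq0 : m.-1 <> 0%N by move: m2; clear; lia.
have iK x : (x < m)%N -> value (s i0) (pos (s i0) x) = x by move=> xm; rewrite posK // lt.
have jK x : (x < m)%N -> value (s j) (pos (s j) x) = x by move=> xm; rewrite posK // lt.
have iK' x : (x < m)%N -> pos (s i0) (value (s i0) x) = x by move=> xm; rewrite valueK // lt.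
have jK' x : (x < m)%N -> pos (s j) (value (s j) x) = x by move=> xm; rewrite valueK // lt.
have [a1 a2] := key _ i0J e0; have [b1 b2] := key _ jJ kj.
(* If the positions were exchanged, the net weight at the bottom would be [c i0 - c j], which is
   0. *)
have [same0 same1] : pos (s j) 0 = pos (s i0) 0 /\ pos (s j) 1 = pos (s i0) 1.
  have swapped x y : pos (s i0) 0 = x -> pos (s i0) 1 = y -> pos (s j) 0 = y -> pos (s j) 1 = x ->
      x <> y -> bnet c s m x y = 0.
    move=> h1 h2 h3 h4 xy; apply: etrans (_ : c i0 - c j = 0); last by rewrite cj subrr.
    rewrite -e0 -h1 -h2.
    apply: (@net_pair _ _ J c k (fun i => pos (s i) 0) (fun i => pos (s i) 1) i0 j) => //.
    - by rewrite kj ke0.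
    - by rewrite ke0.
    - by rewrite h3 h2.
    - by rewrite h4 h1.
    - by rewrite h1 h2; apply/eqP.
  have := exceptional_bnet_neq0 exc.
  have [[h1 h2]|[h1 h2]] := minmax_cases a1 a2; have [[h3 h4]|[h3 h4]] := minmax_cases b1 b2.
  - by rewrite h1 h2 h3 h4.
  - by rewrite (swapped _ _ h1 h2 h4 h3) ?eqxx // => /esym.
  - by rewrite /bnet netC -/(bnet c s m m.-1 0) (swapped _ _ h2 h1 h3 h4) ?oppr0 ?eqxx.
  - by rewrite h1 h2 h3 h4.
have ww : value (s j) 0 = value (s i0) 0 /\ (value (s i0) 0 <= 1)%N.
  have [[h1 h2]|[h1 h2]] := minmax_cases a1 a2.
    by have := iK 0%N m_gt0; have := jK 0%N m_gt0; rewrite same0 h1 => -> ->.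
  by have := iK 1%N m_gt1; have := jK 1%N m_gt1; rewrite same1 h1 => -> ->.
have w01 : value (s i0) 0 != value (s i0) 1.
  by apply/eqP => e; have := iK' 1%N m_gt1; rewrite -e iK'.
(* If the net weights at the left side vanish, the left partner of [i0] is [i0] or [j]; but these
   two have the same value in position 0. *)
have [Z'|[m' [z' exc']]] := dich (two_sided_inv ext) erefl.
  have [l lJ [kl pl pl']] := net0_partner cpos i0J (Z' (k i0) (pos (left_ i0) 0) (pos (left_ i0) 1)).
  rewrite /left_ !pos_pinv in pl pl'.
  have kl' : k l = m := etrans kl e0.
  have [e|e] := only l lJ kl'; subst l.
    by move: w01; rewrite pl eqxx.
  by move: w01; rewrite -pl ww.1 eqxx.
(* If the left side is exceptional, the first two values are 0 and [m.-1] in some order. The first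
   is at most 1, so both items have [m.-1] in position 1, although [j] exchanges the two highest
   values of [i0]. *)
have mm := order_eq left_ m' z' (fun _ => erefl) erefl exc'; subst m'.
have [] := exceptional_key exc' i0J e0; have [] := exceptional_key exc' jJ kj.
rewrite !pos_pinv ww.1 => g1 g2 g3 g4.
have low n : (n <= 1)%N -> n <> m.-1 by move: m2; clear; lia.
have v0 : value (s i0) 1 = m.-1.
  by have [[_ ->]|[_ /(low _ ww.2)]] := minmax_cases g3 g4.
have vj : value (s j) 1 = m.-1.
  by have [[_ ->]|[_ /(low _ ww.2)]] := minmax_cases g1 g2.
have q0 : pos (s i0) (m - 1) = 1%N by rewrite subn1 -v0 iK'.
have qj : pos (s j) (m - 1) = 1%N by rewrite subn1 -vj jK'.
by move: nn; rewrite q0 -pj qj eqxx.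
Qed.

Lemma bottom_zero m x y : bnet c s m x y = 0.
Proof.
by have [|[m' [z /not_exceptional]]] := dich ext erefl.
Qed.

End NoExceptional.

Lemma value_pcompl t j : (j < perm_order t)%N -> value (pcompl t) j = (perm_order t - 1 - value t j)%N.
Proof.
move=> jk; rewrite -[j]/(nat_of_ord (Ordinal jk)) (@valueE (pcompl t)) (@valueE t) /= permM flipE /=.
by rewrite subnS -subn1 subnAC.
Qed.

(** The reflection exchanging left and right, composed from the two symmetries already shown to
    preserve extremality. *)
Definition prev_ (t : permutation) : permutation := pinv (pcompl (pinv t)).

Lemma pos_prev t j : (j < perm_order t)%N -> pos (prev_ t) j = (perm_order t - 1 - pos t j)%N.
Proof. by move=> jk; rewrite pos_pinv value_pcompl. Qed.

(** * Partners under exchange, and a single order above 2 *)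

Section Classes.
Variables (R : rcfType) (c : 'I_5 -> R).
Hypothesis c0 : forall i, 0 <= c i.

Section View.
Variable s : 'I_5 -> permutation.
Hypothesis ext : two_sided c s.
Let J := active c s.
Let k i := perm_order (s i).

Let J5 : (#|J| <= 5)%N. Proof. by apply: leq_trans (max_card _) _; rewrite card_ord. Qed.
Let cpos i : i \in J -> 0 < c i. Proof. by rewrite inE => /andP[]. Qed.
Let k1 i : i \in J -> (1 < k i)%N. Proof. by rewrite inE => /andP[]. Qed.
Let Jn i : i \in J -> J != finset.set0. Proof. by move=> iJ; apply/set0Pn; exists i. Qed.

Lemma active_order_inj i a b : (a < k i)%N -> (b < k i)%N -> pos (s i) a = pos (s i) b -> a = b.
Proof. exact: pos_inj. Qed.

Lemma bottom_partner i : i \in J -> exists2 j, j \in J &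
  [/\ k j = k i, pos (s j) 0 = pos (s i) 1 & pos (s j) 1 = pos (s i) 0].
Proof. by move=> iJ; apply: (net0_partner cpos iJ); apply: bottom_zero => //; exact: Jn iJ. Qed.

Lemma top_partner i : i \in J -> exists2 j, j \in J &
  [/\ k j = k i, pos (s j) (k i - 1) = pos (s i) (k i - 2) & pos (s j) (k i - 2) = pos (s i) (k i - 1)].
Proof.
move=> iJ; have [|j jJ [kj e1 e2]] := net0_partner cpos iJ (u := fun i => pos (pcompl (s i)) 0) (v := fun i => pos (pcompl (s i)) 1) (k := k).
  by apply: (bottom_zero c0 (two_sided_comp ext)); exact: Jn iJ.
have [t1 t2] := top_pos iJ; have [t3 t4] := top_pos jJ.
exists j => //; split => //.
  by rewrite -t2 -e1 t3 -/(k j) kj.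
by rewrite -t1 -e2 t4 -/(k j) kj.
Qed.

Lemma left_net m x y : net J c k (fun i => value (s i) 0) (fun i => value (s i) 1) m x y = 0.
Proof.
have [J0|Jn0] := eqVneq J finset.set0.
  by rewrite /net J0 !big1 ?subr0 // => i /[!inE].
rewrite -[RHS](bottom_zero c0 (two_sided_inv ext) Jn0 m x y).
by apply: eq_net => i _ _; rewrite !pos_pinv.
Qed.

Lemma left_partner i : i \in J -> exists2 j, j \in J &
  [/\ k j = k i, value (s j) 0 = value (s i) 1 & value (s j) 1 = value (s i) 0].
Proof. by move=> iJ; exact: (net0_partner cpos iJ (left_net _ _ _)). Qed.

(** Bottom and top partners exchange the positions of the values 0, 1 and of the values 1, 2. These
    transpositions generate S_3, so all six patterns of order 3 would be active. *)
Lemma order_neq3 i : i \in J -> k i <> 3%N.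
Proof.
move=> iJ ki.
have lt j a : k j = 3%N -> (a < 3)%N -> (pos (s j) a < 3)%N by move=> kj h; rewrite -kj pos_lt // -/(k j) kj.
have neq j a b : k j = 3%N -> (a < 3)%N -> (b < 3)%N -> a != b -> pos (s j) a != pos (s j) b.
  by move=> kj ha hb; rewrite pos_eqP // -/(k j) kj.
pose tri j x y z := [/\ j \in J, k j = 3%N & [/\ pos (s j) 0 = x, pos (s j) 1 = y & pos (s j) 2 = z]].
have botS j x y z : tri j x y z -> exists l, tri l y x z.
  case=> jJ kj [h0 h1 h2]; have [l lJ [kl e1 e2]] := bottom_partner jJ.
  have kl3 : k l = 3%N by rewrite kl.
  exists l; split=> //; split; rewrite ?e1 ?e2 //.
  rewrite -h2 (@other_of_three (pos (s l) 2) (pos (s l) 0) (pos (s l) 1)) ?lt ?neq //.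
  by rewrite (@other_of_three (pos (s j) 2) (pos (s j) 1) (pos (s j) 0)) ?lt ?neq // e1 e2.
have topS j x y z : tri j x y z -> exists l, tri l x z y.
  case=> jJ kj [h0 h1 h2]; have [l lJ [kl e1 e2]] := top_partner jJ.
  have kl3 : k l = 3%N by rewrite kl.
  rewrite kj in e1 e2; rewrite -?[(3 - 1)%N]/2%N -?[(3 - 2)%N]/1%N in e1 e2.
  exists l; split=> //; split; rewrite ?e1 ?e2 //.
  rewrite -h0 (@other_of_three (pos (s l) 0) (pos (s l) 2) (pos (s l) 1)) ?lt ?neq //.
  by rewrite (@other_of_three (pos (s j) 0) (pos (s j) 1) (pos (s j) 2)) ?lt ?neq // e1 e2.
set x := pos (s i) 0; set y := pos (s i) 1; set z := pos (s i) 2.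
have xy : x != y by exact: neq.
have xz : x != z by exact: neq.
have yz : y != z by exact: neq.
have t0 : tri i x y z by [].
have [b tb] := botS _ _ _ _ t0; have [t tt] := topS _ _ _ _ t0.
have [bt tbt] := topS _ _ _ _ tb; have [u tu] := botS _ _ _ _ tt.
have [v tv] := botS _ _ _ _ tbt.
have U : uniq [:: (x, y); (y, x); (x, z); (y, z); (z, x); (z, y)].
  by rewrite /= !inE !xpair_eqE ![y == x]eq_sym ![z == x]eq_sym ![z == y]eq_sym !eqxx
    (negPf xy) (negPf xz) (negPf yz).
suff /leq_trans/(_ J5) : (6 <= #|J|)%N by [].
apply: (size_le_card U (f := fun j => (pos (s j) 0, pos (s j) 1))) => w; rewrite !inE.
have got j x' y' z' : tri j x' y' z' -> exists2 l, l \in J & (pos (s l) 0, pos (s l) 1) = (x', y').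
  by case=> jJ _ [e0 e1 _]; exists j; rewrite ?e0 ?e1.
by case/or4P => [||| /or3P[]] /eqP ->;
  [exact: got t0 | exact: got tb | exact: got tt | exact: got tbt | exact: got tu | exact: got tv].
Qed.

Section SmallClass.
Variable K : nat.
Hypothesis K4 : (3 < K)%N.
Let G := [set i in J | k i == K].
Hypothesis G3 : (#|G| <= 3)%N.
Variable i0 : 'I_5.
Hypothesis i0G : i0 \in G.
Hypothesis i00 : pos (s i0) 0 = 0%N.

(* Two different pairs of partners would need four items. *)
Lemma small_class_left j : j \in G ->
  (value (s j) 0 = 0%N /\ value (s j) 1 = value (s i0) 1) \/
  (value (s j) 0 = value (s i0) 1 /\ value (s j) 1 = 0%N).
Proof.
have GP l : l \in G -> l \in J /\ k l = K by rewrite inE => /andP[? /eqP].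
move=> jG; have [iJ ki] := GP _ i0G; have [jJ kj] := GP _ jG.
have K0 : (0 < K)%N by exact: ltn_trans K4.
have K1 : (1 < K)%N by exact: ltn_trans K4.
have w0 : value (s i0) 0 = 0%N by rewrite -[X in value _ X]i00 posK // -/(k i0) ki.
have wn l : l \in G -> value (s l) 0 != value (s l) 1.
  move=> /GP[lJ kl]; apply/eqP => e; have : pos (s l) (value (s l) 0) = pos (s l) (value (s l) 1) by rewrite e.
  by rewrite !valueK // -/(k l) kl.
have [i' iJ' [ki' a0 a1]] := left_partner iJ; have [j' jJ' [kj' b0 b1]] := left_partner jJ.
have iG' : i' \in G by rewrite inE iJ' ki' ki eqxx.
have jG' : j' \in G by rewrite inE jJ' kj' kj eqxx.
have ii : i0 != i' by apply: contraNneq (wn _ i0G) => e; rewrite {1}e a0.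
have jj : j != j' by apply: contraNneq (wn _ jG) => e; rewrite {1}e b0.
have [e|ji] := eqVneq j i0; first by left; rewrite e w0.
have [e|ji'] := eqVneq j i'; first by right; rewrite e a0 a1 w0.
have [e|ji2] := eqVneq j' i0; first by right; rewrite -b1 -b0 e w0.
have [e|ji2'] := eqVneq j' i'; first by left; rewrite -b1 -b0 e a0 a1 w0.
exfalso; have U : uniq [:: i0; i'; j; j'].
  by rewrite /= !inE !negb_or ii jj [i0 == j]eq_sym ji [i0 == j']eq_sym ji2 [i' == j]eq_sym ji' [i' == j']eq_sym ji2'.
suff /leq_trans/(_ G3) : (4 <= #|G|)%N by [].
apply: (size_le_card U (f := id)) => x; rewrite !inE => h; exists x => //; move: h.
by case/or4P => /eqP ->.
Qed.

Lemma small_class_first j : j \in G -> (pos (s j) 0 <= 1)%N.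
Proof.
move=> jG; have [jJ kj] : j \in J /\ k j = K by move: jG; rewrite inE => /andP[? /eqP].
have [[e _]|[_ e]] := small_class_left jG.
  by rewrite -e valueK // -/(k j) kj (ltn_trans _ K4).
by rewrite -e valueK // -/(k j) kj (ltn_trans _ K4).
Qed.

(** All items of the class have the same pair of values in their first two positions, one of them 0,
    and by [left_net] the two arrangements have equal weight. *)
Lemma small_class_half : \sum_(i in G) c i = 2 * \sum_(i in G | pos (s i) 0 == 0%N) c i.
Proof.
have GP l : l \in G -> l \in J /\ k l = K by rewrite inE => /andP[? /eqP].
have K0 : (0 < K)%N by exact: ltn_trans K4.
have p0 l : l \in G -> (pos (s l) 0 == 0%N) = (value (s l) 0 == 0%N).
  move=> /GP[lJ kl]; have lK : (0 < perm_order (s l))%N by rewrite -/(k l) kl.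
  by apply/eqP/eqP => e; [rewrite -[X in value _ X]e posK | rewrite -[X in pos _ X]e valueK].
have [iJ ki] := GP _ i0G.
have x0 : value (s i0) 1 != 0%N.
  have lt1 : (1 < perm_order (s i0))%N by rewrite -/(k i0) ki (ltn_trans _ K4).
  by apply/eqP => e; have := valueK lt1; rewrite e i00.
have := left_net K 0 (value (s i0) 1); rewrite /net => /eqP; rewrite subr_eq0 => /eqP e.
rewrite (bigID (fun i => pos (s i) 0 == 0%N)) /= mulr2n mulrDl mul1r; congr (_ + _).
transitivity (\sum_(i in J | [&& k i == K, value (s i) 0 == value (s i0) 1 & value (s i) 1 == 0%N]) c i).
  apply: eq_bigl => l; apply/andP/andP => [[lG h]|[lJ /and3P[/eqP kl /eqP h1 /eqP h2]]].
    have [lJ kl] := GP _ lG; split=> //; rewrite kl eqxx /=; move: h; rewrite (p0 _ lG).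
    by have [[-> _]|[-> ->]] := small_class_left lG; rewrite ?eqxx.
  have lG : l \in G by rewrite inE lJ kl eqxx.
  by split=> //; rewrite (p0 _ lG) h1.
rewrite -e; apply: eq_bigl => l; apply/andP/andP => [[lJ /and3P[/eqP kl /eqP h1 /eqP h2]]|[lG h]].
  have lG : l \in G by rewrite inE lJ kl eqxx.
  by split=> //; rewrite (p0 _ lG) h1.
have [lJ kl] := GP _ lG; split=> //; rewrite kl eqxx /=; move: h; rewrite (p0 _ lG).
by have [[-> ->]|[-> _]] := small_class_left lG; rewrite ?eqxx // (negPf x0).
Qed.

End SmallClass.

Let L := [set i in J | (2 < k i)%N].

(** In order 2 the positions of the two lowest values are the whole pattern, so the vanishing net
    weight equates its two patterns. *)
Lemma order_two_balanced :
  \sum_(i in J | (k i == 2%N) && (pos (s i) 0 == 0%N)) c i =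
  \sum_(i in J | (k i == 2%N) && (pos (s i) 0 != 0%N)) c i.
Proof.
have [J0|Jn0] := eqVneq J finset.set0.
  by rewrite J0 !big1 // => i /[!inE].
have := bottom_zero c0 ext Jn0 2 0 1; rewrite /bnet /net => /eqP; rewrite subr_eq0 => /eqP e.
have two i : i \in J -> k i = 2%N -> pos (s i) 0 = 0%N /\ pos (s i) 1 = 1%N \/ pos (s i) 0 = 1%N /\ pos (s i) 1 = 0%N.
  move=> iJ ki; have h : [/\ pos (s i) 0 < 2, pos (s i) 1 < 2 & pos (s i) 0 != pos (s i) 1]%N.
    by split; rewrite ?pos_eqP // -?/(k i) ?ki //; rewrite -[X in (_ < X)%N]ki pos_lt // -/(k i) ki.
  by case: h; case: (pos _ 0) => [|[|]] //; case: (pos _ 1) => [|[|]] // _ _ _; [left|right].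
apply: etrans (etrans e _); apply: eq_bigl => i; case iJ: (i \in J) => //=; rewrite -/(k i);
  case: eqP => //= ki; by have [[-> ->]|[-> ->]] := two i iJ ki.
Qed.

(** By their balance, the items of order 2 contribute equally to both sides of [corner_first] and
    drop out. *)
Lemma corner_large :
  \sum_(i in L | pos (s i) 0 == 0%N) om c s i * (k i)%:R = \sum_(i in L) om c s i.
Proof.
have split_ (P : pred 'I_5) (f : 'I_5 -> R) : \sum_(i in J | P i) f i =
    \sum_(i in L | P i) f i + \sum_(i in J | (k i == 2%N) && P i) f i.
  rewrite (bigID (fun i => 2 < k i)%N) /=; congr (_ + _); apply: eq_bigl => i.
    by rewrite [i \in L]inE -!andbA [P i && _]andbC.
  case iJ: (i \in J) => //=; rewrite andbC -leqNgt; congr (_ && _).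
  by rewrite eqn_leq k1 // andbT.
have := corner_first c0 ext; rewrite split_.
have := split_ xpredT (om c s); rewrite (eq_bigl (mem J)) => [->|i]; last by rewrite andbT.
rewrite [X in _ = X + _](eq_bigl (mem L)) => [e|i]; last by rewrite andbT.
suff h : \sum_(i in J | (k i == 2%N) && (pos (s i) 0 == 0%N)) om c s i * (k i)%:R =
    \sum_(i in J | (k i == 2%N) && true) om c s i by apply: (addIr _ _); rewrite h in e; exact: e.
have om2 i : k i = 2%N -> om c s i = c i by rewrite /om -/(k i) => -> /=; rewrite divr1.
rewrite (eq_bigr (fun i => c i * 2)) => [|i /andP[_ /andP[/eqP ki _]]]; last by rewrite om2 // ki.
rewrite -mulr_suml mulr_natr mulr2n {2}order_two_balanced.
rewrite [RHS](bigID (fun i => pos (s i) 0 == 0%N)) /=; congr (_ + _); apply: eq_big => i.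
- by rewrite andbT andbA.
- by case/andP => _ /andP[/eqP ki _]; rewrite om2.
- by rewrite andbT andbA.
- by case/andP => _ /andP[/eqP ki _]; rewrite om2.
Qed.

Lemma card_class i : i \in J -> (1 < #|[set j in J | k j == k i]|)%N.
Proof.
move=> iJ; have [j jJ [kj e0 e1]] := bottom_partner iJ.
apply/card_gt1P; exists i, j; split.
- by rewrite [i \in _]inE iJ eqxx.
- by rewrite [j \in _]inE jJ kj eqxx.
by have [uv _ _] := active_pos iJ; apply/eqP => e; move: uv; rewrite -e0 -e eqxx.
Qed.

End View.

Section OneOrder.
Variable s : 'I_5 -> permutation.
Hypothesis ext : two_sided c s.
Let J := active c s.
Let k i := perm_order (s i).
Let L := [set i in J | (2 < k i)%N].
Let G K := [set i in J | k i == K].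
Let s' i := prev_ (s i).

Let J5 : (#|J| <= 5)%N. Proof. by apply: leq_trans (max_card _) _; rewrite card_ord. Qed.

Lemma two_sided_prev : two_sided c s'.
Proof. by apply/two_sided_inv/two_sided_comp/two_sided_inv. Qed.

Let GE a l : (l \in G a) = (l \in J) && (k l == a). Proof. by rewrite [l \in G a]in_set. Qed.
Let LE l : (l \in L) = (l \in J) && (2 < k l)%N. Proof. by rewrite [l \in L]in_set. Qed.

Lemma class_disjoint a b i : a != b -> (i \in G a) && (i \in G b) = false.
Proof.
move=> ab; apply/negbTE/negP; rewrite !in_set => /andP[/andP[_ /eqP e1] /andP[_ /eqP e2]].
by move: ab; rewrite -e1 e2 eqxx.
Qed.

Lemma sub_class a : G a \subset J.
Proof. by apply/fintype.subsetP => i; rewrite [i \in _]in_set => /andP[]. Qed.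

Lemma card_classes2 a b : a != b -> #|G a :|: G b| = (#|G a| + #|G b|)%N.
Proof.
move=> ab; apply/eqP; rewrite (leq_card_setU _ _) -setI_eq0; apply/eqP/setP => i.
by rewrite in_setI in_set0 class_disjoint.
Qed.

Lemma card_classes a b : a != b -> (#|G a| + #|G b| <= 5)%N.
Proof.
move=> ab; apply: leq_trans J5; rewrite -card_classes2 //.
by apply: subset_leq_card; rewrite finset.subUset !sub_class.
Qed.

Lemma card_classes3 a b d : a != b -> a != d -> b != d -> (#|G a| + #|G b| + #|G d| <= 5)%N.
Proof.
move=> ab ad bd; apply: leq_trans J5; rewrite -card_classes2 //.
have <- : #|G a :|: G b :|: G d| = (#|G a :|: G b| + #|G d|)%N.
  apply/eqP; rewrite (leq_card_setU _ _) -setI_eq0; apply/eqP/setP => i.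
  by rewrite in_setI in_setU in_set0 andb_orl !class_disjoint.
by apply: subset_leq_card; rewrite !finset.subUset !sub_class.
Qed.

Lemma large_order i : i \in L -> i \in J /\ (3 < k i)%N.
Proof.
rewrite inE => /andP[iJ k2]; split=> //; rewrite ltn_neqAle k2 andbT.
by apply/eqP => e; apply: (order_neq3 ext iJ).
Qed.

(** Every class has at least two items, so with two orders each has at most three. In a small class
    with a lowest value in position 0, every lowest value is in position 0 or 1; hence the items [x]
    and [y] having it at the left and at the right end lie in different classes, and these exhaust
    [L]. If the classes have orders p, r and weights A, B, the corner identities and
    [small_class_half] give p A / 2 = A + B = r B / 2. Since p, r >= 4, this forces A = B and p =
    r. *)
Lemma one_order i j : i \in L -> j \in L -> k i = k j.
Proof.
move=> iL jL; apply/eqP; apply: contraT => ij.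
have omL l : l \in L -> 0 < om c s l by rewrite inE => /andP[/om_gt0].
have posL : 0 < \sum_(l in L) om c s l.
  by rewrite (bigD1 i) //= ltr_pwDl ?omL // sumr_ge0 // => l /andP[/omL/ltW].
have corner (t : 'I_5 -> permutation) :
    \sum_(l in L | pos (t l) 0 == 0%N) om c s l * (k l)%:R = \sum_(l in L) om c s l ->
    exists2 l, l \in L & pos (t l) 0 = 0%N.
  move=> h; have [l /andP[lL /eqP pl]|no] := pickP [pred l in L | pos (t l) 0 == 0%N]; first by exists l.
  by move: posL; rewrite -h big_pred0 ?ltxx.
have e1 := corner_large ext; have e2 := corner_large two_sided_prev.
have [x xL x0] := corner s e1; have [y yL y0] := corner s' e2.
have small l : l \in L -> (#|G (k l)| <= 3)%N.
  move=> lL; have [lJ l4] := large_order lL.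
  have [z zL zl] : exists2 z, z \in L & k l != k z.
    by have [e|] := eqVneq (k l) (k i); [exists j => //; rewrite e | exists i].
  have [zJ z4] := large_order zL.
  have := card_classes zl; have : (1 < #|G (k z)|)%N := card_class ext zJ.
  by clear; lia.
have [xJ x4] := large_order xL; have [yJ y4] := large_order yL.
have inG l : l \in J -> l \in G (k l) by move=> lJ; rewrite inE lJ eqxx.
have farx l : l \in G (k x) -> pos (s' l) 0 != 0%N.
  move=> lG; have := small_class_first ext x4 (small _ xL) (inG _ xJ) x0 lG.
  have [lJ kl] : l \in J /\ k l = k x by move: lG; rewrite inE => /andP[? /eqP].
  rewrite /s' pos_prev -?/(k l) ?kl; first by move: x4; clear; lia.
  by move: x4; clear; lia.
have fary l : l \in G (k y) -> pos (s l) 0 != 0%N.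
  move=> lG; have := small_class_first two_sided_prev y4 (small _ yL) (inG _ yJ) y0 lG.
  have [lJ kl] : l \in J /\ k l = k y by move: lG; rewrite inE => /andP[? /eqP].
  have l0 : (0 < perm_order (s l))%N by rewrite -/(k l) kl; move: y4; clear; lia.
  rewrite pos_prev // -/(k l) kl; have := pos_lt l0; rewrite -/(k l) kl.
  by move: y4; clear; lia.
have xy : k x != k y by apply: contraTneq (inG _ xJ) => e; apply/negP => h; have := fary x; rewrite -e => /(_ h); rewrite x0.
have LU : L = G (k x) :|: G (k y).
  apply/setP => l; rewrite in_setU !GE LE; case lJ: (l \in J) => //=; apply/idP/idP => [l2|]; last first.
    by case/orP => /eqP ->; [move: x4 | move: y4]; clear; lia.
  have [//|lx] := eqVneq (k l) (k x); have [//|ly] := eqVneq (k l) (k y).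
  exfalso; have := card_classes3 xy (_ : k x != k l) (_ : k y != k l).
  rewrite ![_ == k l]eq_sym => /(_ lx ly).
  have c1 : (1 < #|G (k l)|)%N := card_class ext lJ.
  have c2 : (1 < #|G (k x)|)%N := card_class ext xJ.
  have c3 : (1 < #|G (k y)|)%N := card_class ext yJ.
  by move: c1 c2 c3; clear; lia.
have sumL (P : pred 'I_5) (f : 'I_5 -> R) : \sum_(l in L | P l) f l =
    \sum_(l in G (k x) | P l) f l + \sum_(l in G (k y) | P l) f l.
  have LP l : (l \in L) = (l \in J) && ((k l == k x) || (k l == k y)).
    by rewrite LU in_setU !GE; case: (l \in J).
  rewrite (bigID (fun l => k l == k x)) /=; congr (_ + _); apply: eq_bigl => l; rewrite LP GE.
    by case: (l \in J); case: (k l == k x); rewrite /= ?andbT ?andbF.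
  case: (l \in J) => //=; case: eqVneq => [->|_] /=; first by rewrite andbF (negPf xy).
  by rewrite andbT.
pose S K := \sum_(l in G K) om c s l.
have half (t : 'I_5 -> permutation) (et : two_sided c t) z (kt : forall l, perm_order (t l) = k l)
    (At : active c t = J) : z \in L -> pos (t z) 0 = 0%N ->
    \sum_(l in G (k z) | pos (t l) 0 == 0%N) om c s l * (k l)%:R = (k z)%:R / 2 * S (k z).
  move=> zL z0; have [zJ z4] := large_order zL.
  have GtE : [set l in active c t | perm_order (t l) == k z] = G (k z).
    by apply/setP => l; rewrite GE in_set At kt.
  have h := @small_class_half t et (k z) z4.
  rewrite GtE in h; have {}h := h (small _ zL) z; rewrite GE zJ eqxx in h; have {}h := h isT z0.
  pose q := ((k z).-1)`!%:R : R.
  have omE l : l \in G (k z) -> om c s l = c l / q by rewrite GE => /andP[_ /eqP e]; rewrite /om -/(k l) e.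
  have -> : S (k z) = (\sum_(l in G (k z)) c l) / q.
    by rewrite mulr_suml; apply: eq_bigr => l /omE.
  rewrite h (eq_bigr (fun l => c l * ((k z)%:R / q))).
    by rewrite -mulr_suml; field; rewrite /q pnatr_eq0 -lt0n fact_gt0.
  move=> l /andP[lG _]; rewrite omE //; move: lG; rewrite GE => /andP[_ /eqP ->]; ring.
have tot : \sum_(l in L) om c s l = S (k x) + S (k y).
  have := sumL xpredT (om c s).
  by rewrite !(eq_bigl _ _ (fun l => andbT (l \in _))) => ->.
have Sx : (k x)%:R / 2 * S (k x) = S (k x) + S (k y).
  rewrite -tot -e1 sumL -(half s ext x (fun=> erefl) erefl xL x0) [X in _ + X]big1 ?addr0 // => l /andP[lG].
  by rewrite (negPf (fary l lG)).
have Sy : (k y)%:R / 2 * S (k y) = S (k x) + S (k y).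
  rewrite -tot -e2 sumL -(half s' two_sided_prev y (fun=> erefl) erefl yL y0) [X in X + _]big1 ?add0r // => l /andP[lG].
  by rewrite (negPf (farx l lG)).
have S0 z : z \in L -> 0 < S (k z).
  move=> zL; have [zJ _] := large_order zL.
  rewrite /S (bigD1 z) /=; last exact: inG.
  rewrite ltr_pwDl ?omL // sumr_ge0 // => l /andP[]; rewrite GE => /andP[lJ _] _.
  exact/ltW/om_gt0.
have Sx0 := S0 _ xL; have Sy0 := S0 _ yL.
have kx : 4 <= (k x)%:R :> R by rewrite ler_nat.
have ky : 4 <= (k y)%:R :> R by rewrite ler_nat.
have kxy : (k x)%:R != (k y)%:R :> R by rewrite eqr_nat.
exfalso; move: kx ky kxy Sx Sy Sx0 Sy0; move: (S (k x)) (S (k y)) => A B; clear.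
move: ((k x)%:R : R) ((k y)%:R : R) => p r hp hr pr hA hB A0 B0.
have h1 : A <= B by nra.
have h2 : B <= A by nra.
have AB : A = B by lra.
subst B; have p4 : p = 4 by apply: (mulIf (lt0r_neq0 A0)); lra.
have r4 : r = 4 by apply: (mulIf (lt0r_neq0 A0)); lra.
by rewrite p4 r4 eqxx in pr.
Qed.

End OneOrder.
End Classes.

(** * The common order is 4 *)

(** With X = t / (1 + t), Z = 1 / (1 + t) and denominators cleared, the identity says that the
    ordinary polynomial with coefficients [f] vanishes. *)
Lemma bernstein_coef (R : realFieldType) n (f : nat -> R) :
  (forall X Z, 0 <= X -> 0 <= Z -> X + Z = 1 -> \sum_(a < n.+1) f a * (X ^+ a * Z ^+ (n - a)) = 0) ->
  forall a, (a <= n)%N -> f a = 0.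
Proof.
move=> h.
have P0 : \poly_(a < n.+1) f a = 0.
  apply: poly_eq0_unit => t t0 t1; rewrite horner_poly.
  have d0 : 1 + t != 0 by rewrite gt_eqF // addr_gt0.
  have nz : (1 + t) ^+ n != 0 by rewrite expf_neq0.
  apply: (mulIf (invr_neq0 nz)); rewrite mul0r.
  have := h (t / (1 + t)) (1 + t)^-1; rewrite divr_ge0 ?invr_ge0 ?addr_ge0 ?ltW // => /(_ isT isT).
  rewrite -[X in _ + X = 1]mul1r -mulrDl [t + 1]addrC mulfV // => /(_ erefl) h0; apply: etrans h0.
  rewrite mulr_suml; apply: eq_bigr => a _; rewrite -mulrA; congr (_ * _).
  rewrite expr_div_n exprVn -mulrA -invfM -exprD subnKC //.
  by rewrite -ltnS.
by move=> a an; have := coef_poly n.+1 f a; rewrite P0 coef0 ltnS an.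
Qed.

Section OrderFour.
Variables (R : rcfType) (c : 'I_5 -> R).
Hypothesis c0 : forall i, 0 <= c i.
Variable s : 'I_5 -> permutation.
Hypothesis ext : two_sided c s.
Let J := active c s.
Let k i := perm_order (s i).
Let L := [set i in J | (2 < k i)%N].
Let V := \sum_(i in L) c i.

Let LE l : (l \in L) = (l \in J) && (2 < k l)%N. Proof. by rewrite [l \in L]in_set. Qed.
Let J5 : (#|J| <= 5)%N. Proof. by apply: leq_trans (max_card _) _; rewrite card_ord. Qed.
Let cpos i : i \in J -> 0 < c i. Proof. by rewrite inE => /andP[]. Qed.
Let k1 i : i \in J -> (1 < k i)%N. Proof. by rewrite inE => /andP[]. Qed.

(** The two patterns of order 2 contribute 2 Z - 1 and 2 X - 1 with equal total weights, and these
    cancel because X + Z = 1. *)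
Lemma bernstein_large (X Z : R) : 0 <= X -> 0 <= Z -> X + Z = 1 ->
  \sum_(i in L) c i * ((k i)%:R * (kap1 R (k i) (pos (s i) 0) *
     (X ^+ pos (s i) 0 * Z ^+ (k i - 1 - pos (s i) 0)) - (k i)`!%:R^-1)) = 0.
Proof.
move=> X0 Z0 XZ; have := bernstein c0 ext X0 Z0 XZ.
rewrite (bigID (fun i => 2 < k i)%N) /= [X in _ + X](_ : _ = 0) ?addr0 => [h|].
  by apply: etrans h; apply: eq_bigl => i; rewrite LE.
rewrite (eq_bigl (fun i => (i \in J) && (k i == 2%N))) => [|i]; last first.
  by case iJ: (i \in J) => //=; rewrite -leqNgt eqn_leq k1 // andbT.
have t2 i : i \in J -> k i = 2%N -> (pos (s i) 0 < 2)%N.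
  by move=> iJ ki; rewrite -[X in (_ < X)%N]ki pos_lt // -/(k i) ki.
rewrite (bigID (fun i => pos (s i) 0 == 0%N)) /=.
rewrite (eq_bigr (fun i => c i * (2 * Z - 1))); last first.
  move=> i /andP[/andP[iJ /eqP ki] /eqP p0]; rewrite -/(k i) ki p0.
  by have := kap1_0 R 1; rewrite mul1r => ->; rewrite -[(2 - 1 - 0)%N]/1%N -[2`!]/2%N expr0 expr1 !mul1r; field.
rewrite [X in _ + X](eq_bigr (fun i => c i * (2 * X - 1))); last first.
  move=> i /andP[/andP[iJ /eqP ki] p0]; rewrite -/(k i) ki.
  have -> : pos (s i) 0 = 1%N by have := t2 i iJ ki; case: (pos _ 0) p0 => [|[|]].
  by have := kap1_last R 1; rewrite mul1r => ->; rewrite -[(2 - 1 - 1)%N]/0%N -[2`!]/2%N expr0 expr1 mulr1 !mul1r; field.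
rewrite -!mulr_suml.
have := order_two_balanced c0 ext; rewrite -/k -/J => e.
rewrite (eq_bigl (fun i => (i \in J) && ((k i == 2%N) && (pos (s i) 0 == 0%N)))) => [|i]; last by rewrite andbA.
rewrite [X in _ + X * _](eq_bigl (fun i => (i \in J) && ((k i == 2%N) && (pos (s i) 0 != 0%N)))) => [|i]; last by rewrite andbA.
rewrite e -mulrDr [_ + _](_ : _ = 0) ?mulr0 //; have -> : Z = 1 - X by lra.
by ring.
Qed.

Variable i0 : 'I_5.
Hypothesis i0L : i0 \in L.
Let K := k i0.

Let V_gt0 : 0 < V.
Proof.
have cL l : l \in L -> 0 < c l by rewrite LE => /andP[/cpos].
by rewrite /V (bigD1 i0) //= ltr_pwDl ?cL // sumr_ge0 // => l /andP[/cL/ltW].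
Qed.

Let kL l : l \in L -> k l = K. Proof. by move=> lL; exact: (one_order c0 ext). Qed.

(** For a single order the identity says that a polynomial in Bernstein form is constant, so all its
    coefficients in that basis agree: the lowest value is uniformly distributed. *)
Lemma position_weight a : (a < K)%N -> \sum_(i in L | pos (s i) 0 == a) c i = V / K%:R.
Proof.
have K0 : (0 < K)%N by have [_] := large_order c0 ext i0L; apply: ltn_trans.
have KE : K = K.-1.+1 by rewrite prednK.
pose W a := \sum_(i in L | pos (s i) 0 == a) c i.
move=> aK; have Kn : K%:R != 0 :> R by rewrite pnatr_eq0 -lt0n.
apply: (mulfI Kn); rewrite mulrCA mulfV // mulr1; apply/eqP; rewrite -subr_eq0; apply/eqP.
have kp : kap1 R K a != 0 by rewrite gt_eqF // kap1_gt0.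
apply: (mulfI kp); rewrite mulr0.
have aK' : (a <= K.-1)%N by rewrite -ltnS -KE.
apply: (@bernstein_coef R K.-1 (fun a => kap1 R K a * (K%:R * W a - V))) aK' => X Z X0 Z0 XZ.
pose M a := kap1 R K a * (X ^+ a * Z ^+ (K.-1 - a)).
have kE x : kap1 R K.-1.+1 x = kap1 R K x by rewrite prednK.
have M1 : (K.-1)`!%:R * \sum_(a < K.-1.+1) M a = 1.
  rewrite -[RHS](@kap1_sum R K.-1 X Z XZ); congr (_ * _); apply: eq_bigr => b _.
  by rewrite /M subn1 kE.
have f0 : (K.-1)`!%:R != 0 :> R by rewrite pnatr_eq0 -lt0n fact_gt0.
transitivity (K%:R * \sum_(a < K.-1.+1) W a * M a - V * \sum_(a < K.-1.+1) M a).
  by rewrite !mulr_sumr -sumrB; apply: eq_bigr => b _; rewrite /M; ring.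
have -> : \sum_(a < K.-1.+1) W a * M a = \sum_(i in L) c i * M (pos (s i) 0).
  have pL i : i \in L -> (pos (s i) 0 < K.-1.+1)%N.
    by move=> iL; rewrite -KE -(kL iL) pos_lt // -/(k i) (kL iL).
  rewrite [RHS](partition_big (fun i => inord (pos (s i) 0) : 'I_(K.-1.+1)) predT) //=.
  apply: eq_bigr => b _; rewrite /W mulr_suml; apply: eq_big => [i|i /andP[_ /eqP ->] //].
  case iL: (i \in L) => //=; rewrite -val_eqE /= inordK ?pL //.
have /(canRL (mulKf f0)) -> := M1; rewrite mulr1.
have := bernstein_large X0 Z0 XZ.
rewrite (eq_bigr (fun i => K%:R * (c i * M (pos (s i) 0)) - c i * (K.-1)`!%:R^-1)).
  by rewrite sumrB -mulr_sumr -mulr_suml.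
move=> i iL; rewrite -/(k i) (kL iL) mulrBr mulrBr; congr (_ - _).
  by rewrite /M subn1; ring.
congr (_ * _); have -> : K`! = (K * (K.-1)`!)%N by rewrite [in LHS]KE factS -KE.
by rewrite natrM invfM mulrA mulfV ?mul1r.
Qed.

Lemma position_item a : (a < K)%N -> exists2 l, l \in L & pos (s l) 0 = a.
Proof.
move=> aK; have [l /andP[lL /eqP pl]|no] := pickP [pred l in L | pos (s l) 0 == a]; first by exists l.
have := position_weight aK; rewrite big_pred0 // => /esym/eqP; rewrite gt_eqF // divr_gt0 ?ltr0n //.
by apply: leq_ltn_trans aK.
Qed.

Lemma weighted_pairs (f : nat -> nat -> bool) :
  \sum_(l in L | f (pos (s l) 0) (pos (s l) 1)) c l =
  \sum_(x < K) \sum_(y < K) (f x y)%:R * \sum_(l in L | (pos (s l) 0 == x) && (pos (s l) 1 == y)) c l.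
Proof.
have K1 : (1 < K)%N by have := i0L; rewrite LE => /andP[_]; apply: ltn_trans.
have p0 l : l \in L -> (pos (s l) 0 < K)%N.
  by move=> lL; rewrite -(kL lL) pos_lt // -/(k l) kL // (ltn_trans _ K1).
have p1 l : l \in L -> (pos (s l) 1 < K)%N by move=> lL; rewrite -(kL lL) pos_lt // -/(k l) kL.
under [RHS]eq_bigr => x _ do under eq_bigr => y _ do rewrite big_mkcondr mulr_sumr.
under [RHS]eq_bigr => x _ do rewrite exchange_big /=.
rewrite [RHS]exchange_big [LHS]big_mkcondr /=; apply: eq_bigr => l lL.
rewrite (bigD1 (Ordinal (p0 l lL))) //= [X in _ + X]big1 ?addr0 => [|x xn]; last first.
  apply: big1 => y _; rewrite (_ : (pos (s l) 0 == x) = false) ?mulr0 //.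
  by apply: contraNF xn => /eqP e; apply/eqP/val_inj; rewrite /= e.
rewrite (bigD1 (Ordinal (p1 l lL))) //= [X in _ + X]big1 ?addr0 => [|y yn]; last first.
  rewrite (_ : (pos (s l) 1 == y) = false) ?andbF ?mulr0 //.
  by apply: contraNF yn => /eqP e; apply/eqP/val_inj; rewrite /= e.
by rewrite !eqxx /=; case: (f _ _); rewrite ?mul1r ?mul0r.
Qed.

(** Sum the vanishing net weights over all pairs of positions. *)
Lemma balanced : \sum_(l in L | (pos (s l) 0 < pos (s l) 1)%N) c l =
  \sum_(l in L | (pos (s l) 1 < pos (s l) 0)%N) c l.
Proof.
rewrite (weighted_pairs (fun x y => x < y)%N) (weighted_pairs (fun x y => y < x)%N) exchange_big /=.
apply: eq_bigr => x _; apply: eq_bigr => y _; congr (_ * _).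
have Jn : J != finset.set0 by apply/set0Pn; exists i0; move: i0L; rewrite LE => /andP[].
have K2 : (2 < K)%N by move: i0L; rewrite LE => /andP[].
have := bottom_zero c0 ext Jn K y x; rewrite /bnet /net => /eqP; rewrite subr_eq0 => /eqP e.
have red a b : \sum_(l in L | (pos (s l) 0 == a) && (pos (s l) 1 == b)) c l =
    \sum_(l in J | [&& k l == K, pos (s l) 0 == a & pos (s l) 1 == b]) c l.
  apply: eq_bigl => l; apply/andP/andP => [[lL h]|[lJ /and3P[/eqP h1 h2 h3]]].
    by move: (lL); rewrite LE => /andP[lJ _]; split=> //; rewrite h (kL lL) eqxx.
  by split; rewrite ?h2 ?h3 // LE lJ h1 K2.
by rewrite !red.
Qed.

(** The lowest value takes every position in some item, so K <= 5. If K = 5, there is exactly one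
    item per position, all of the same weight, and [balanced] would divide these five into two equal
    halves. *)
Lemma order_four : K = 4%N.
Proof.
have [_ K4] := large_order c0 ext i0L.
have LJ l : l \in L -> l \in J by rewrite LE => /andP[].
have [it hit] : exists it : 'I_K -> 'I_5, forall a, it a \in L /\ pos (s (it a)) 0 = a.
  by apply: (fin_all_exists (P := fun (a : 'I_K) l => l \in L /\ pos (s l) 0 = a)) => a;
    have [l lL pl] := position_item (ltn_ord a); exists l.
have K5 : (K <= 5)%N.
  apply: leq_trans J5; rewrite -[K](size_iota 0); apply: (size_le_card (f := fun l => pos (s l) 0)).
    exact: iota_uniq.
  move=> a; rewrite mem_iota => /andP[_ aK]; have [l lL pl] := position_item aK.
  by exists l => //; exact: LJ.
apply/eqP; rewrite eqn_leq K4 andbT leqNgt; apply/negP => K5'.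
have {K5 K5'} K5 : K = 5%N by apply/eqP; rewrite eqn_leq K5.
have pinj l l' : l \in L -> l' \in L -> pos (s l) 0 = pos (s l') 0 -> l = l'.
  move=> lL lL' e; apply/eqP; apply: contraT => ll.
  suff /leq_trans/(_ J5) : (6 <= #|J|)%N by [].
  (* The label 9 goes to [l']: a repeated position would yield the six labels 9, 0, .., 4. *)
  have -> : 6%N = size (9 :: iota 0 K)%N by rewrite /= size_iota K5.
  apply: (size_le_card (f := fun i => if i == l' then 9%N else pos (s i) 0)).
    by rewrite /= iota_uniq mem_iota K5.
  move=> a; rewrite inE => /orP[/eqP ->|]; first by exists l'; rewrite ?eqxx // LJ.
  rewrite mem_iota => /andP[_ aK]; have [i iL pi] := position_item aK.
  have [e'|ne] := eqVneq i l'; last by exists i; rewrite ?(negPf ne) // LJ.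
  by exists l; rewrite ?LJ // (negPf ll) e -e'.
have cV l : l \in L -> c l = V / K%:R.
  move=> lL; have pK : (pos (s l) 0 < K)%N.
    by rewrite -(kL lL) pos_lt // -/(k l) (kL lL) K5.
  rewrite -(position_weight pK) (big_pred1 l) // => l'; apply/andP/eqP => [[lL' /eqP e]|->]; last by rewrite lL eqxx.
  exact: pinj.
(* An odd number of equal weights cannot be split evenly. *)
have e : V = V / K%:R *+ (2 * #|[set l in L | (pos (s l) 0 < pos (s l) 1)%N]|).
  rewrite mulnC mulrnA mulr2n -sumr_const [in LHS]/V (bigID (fun l => pos (s l) 0 < pos (s l) 1)%N) /=.
  have -> : \sum_(l in L | ~~ (pos (s l) 0 < pos (s l) 1)%N) c l = \sum_(l in L | (pos (s l) 0 < pos (s l) 1)%N) c l.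
    rewrite balanced; apply: eq_bigl => l; case lL: (l \in L) => //=.
    have [n _ _] := active_pos (LJ _ lL); rewrite -leqNgt leq_eqVlt eq_sym (negPf n) //.
  by congr (_ + _); apply: eq_big => [l|l /andP[/cV ->]] //; rewrite [RHS]in_set.
move: e; rewrite K5 -mulr_natr -mulrA => /esym/(canRL (mulKf (lt0r_neq0 V_gt0))).
rewrite mulVf ?gt_eqF // => e.
have : (5 : R) = (2 * #|[set l in L | (pos (s l) 0 < pos (s l) 1)%N]|)%:R.
  by apply: (mulfI (_ : 5^-1 != 0)); rewrite ?invr_eq0 ?pnatr_eq0 // e mulVf ?pnatr_eq0.
by move/eqP; rewrite eqr_nat => /eqP; clear; lia.
Qed.

End OrderFour.

(** * Orders at most 2 do not affect the deviation from the mean *)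

Lemma mdens_sum (R : realFieldType) (V : finType) (m : V -> R) (x y : V -> int) k :
  \sum_a m a = 1 -> \sum_(t : 'S_k) mdens m x y t = 1.
Proof.
move=> m1; rewrite /mdens -mulr_sumr exchange_big /=.
have k0 : k`!%:R != 0 :> R by rewrite pnatr_eq0 -lt0n fact_gt0.
rewrite -[RHS](mulfV k0) -(sum_prod_tie k x m1); congr (_ * _); apply: eq_bigr => f _.
rewrite -mulr_sumr -[RHS]mulr1; congr (_ * _).
rewrite -(sum_tie R (fun i => y (f i))) (reindex_inj invg_inj); apply: eq_bigr => t _.
by rewrite invgK.
Qed.

Lemma perm_le1 k (u v : 'S_k) : (k <= 1)%N -> u = v.
Proof.
move=> k1; apply/permP => i; apply: val_inj => /=.
by have := ltn_ord (u i); have := ltn_ord (v i); lia.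
Qed.

Lemma perm2_cases (u : 'S_2) : u = (if pos (existT (fun k => 'S_k) 2%N u) 0 == 0%N then 1%g else flip 2).
Proof.
have e : pos (existT (fun k => 'S_k) 2%N u) 0 = u^-1%g ord0.
  by rewrite -[0%N]/(nat_of_ord (ord0 : 'I_2)) pos_permV.
have two (a b : 'I_2) : a != ord0 -> b != ord0 -> a = b.
  by case: a b => [[|[|]]] // ? [[|[|]]] // ? _ _; apply: val_inj.
have n1 : (ord_max : 'I_2) != ord0 by [].
have all2 (i : 'I_2) : i = ord0 \/ i = ord_max.
  by case: i => [[|[|]]] // ?; [left | right]; apply: val_inj.
have fl0 : flip 2 ord0 = ord_max by apply: val_inj; rewrite flipE.
have fl1 : flip 2 ord_max = ord0 by apply: val_inj; rewrite flipE.
rewrite e; case: eqP => [h|/eqP h].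
  have u0 : u ord0 = ord0 by rewrite -[in LHS](_ : u^-1%g ord0 = ord0) ?permKV //; apply: val_inj.
  apply/permP => i; rewrite perm1; have [->//|->] := all2 i; apply: two => //.
  by apply/eqP => e0; have := n1; rewrite -(inj_eq (@perm_inj _ u)) e0 u0 eqxx.
have h' : u^-1%g ord0 = ord_max by apply: two => //; rewrite -val_eqE.
have u1 : u ord_max = ord0 by rewrite -h' permKV.
apply/permP => i; have [->|->] := all2 i; last by rewrite u1 fl1.
by rewrite fl0; apply: two => //; apply/eqP => e0; have := n1; rewrite -(inj_eq (@perm_inj _ u)) u1 e0 eqxx.
Qed.

Section Neutral.
Variables (R : rcfType) (c : 'I_5 -> R).
Hypothesis c0 : forall i, 0 <= c i.
Variable s : 'I_5 -> permutation.
Hypothesis ext : two_sided c s.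
Let J := active c s.
Let k i := perm_order (s i).
Let L := [set i in J | (2 < k i)%N].
Let LE l : (l \in L) = (l \in J) && (2 < k l)%N. Proof. by rewrite [l \in L]in_set. Qed.

Variable D : permutation -> R.
Hypothesis D1 : forall n, (n <= 2)%N -> \sum_(t : 'S_n) D (existT (fun k => 'S_k) n t) = 1.

Let D_le1 t : (perm_order t <= 1)%N -> D t = 1.
Proof.
case: t => n u /= n1; rewrite -[RHS](D1 (leq_trans n1 _)) //.
by rewrite (big_pred1 u) // => v; rewrite (perm_le1 v u n1) /= eqxx.
Qed.

Let D_two : {d : R * R | d.1 + d.2 = 1 & forall t, perm_order t = 2%N ->
  D t = if pos t 0 == 0%N then d.1 else d.2}.
Proof.
exists (D (existT (fun k => 'S_k) 2%N 1%g), D (existT (fun k => 'S_k) 2%N (flip 2))) => /=.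
  rewrite -[RHS](D1 (leqnn 2)) (bigD1 1%g) //= (bigD1 (flip 2)) /=; last first.
    by apply/eqP => /permP/(_ ord0)/(congr1 val); rewrite flipE perm1.
  rewrite big_pred0 ?addr0 // => u; rewrite (perm2_cases u).
  by case: ifP => _; rewrite eqxx ?andbF.
case=> n u; rewrite /perm_order /= => n2; subst n.
by have := perm2_cases u; case: (pos _ 0 == 0%N) => h; congr (D (existT _ _ _)).
Qed.

(** Patterns of order at most 1 have density 1; the two patterns of order 2 have equal total weights
    and densities adding up to 1. Keeping [D] abstract serves both for models and for single
    permutations. *)
Lemma excess : \sum_i c i * D (s i) - \sum_i c i / (k i)`!%:R =
  \sum_(i in L) c i * (D (s i) - (k i)`!%:R^-1).
Proof.
rewrite -sumrB (eq_bigr (fun i => c i * (D (s i) - (k i)`!%:R^-1))) => [|i _]; last by rewrite mulrBr.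
rewrite (bigID (fun i => i \in L)) /= -[RHS]addr0; congr (_ + _).
have [[d1 d2] /= d12 dE] := D_two.
rewrite (bigID (fun i => i \in J)) /= [X in _ + X]big1 ?addr0 => [|i /andP[_ iJ]]; last first.
  have [->|ki] := off_active c0 iJ; first by rewrite mul0r.
  rewrite D_le1 // (_ : (k i)`! = 1%N) ?invr1 ?subrr ?mulr0 //.
  by move: ki; rewrite -/(k i); case: (k i) => [|[]].
have k2 i : i \in J -> i \notin L -> k i = 2%N.
  move=> iJ; rewrite LE iJ /= -leqNgt => k2; apply/eqP; rewrite eqn_leq k2.
  by move: iJ; rewrite inE => /andP[].
rewrite (bigID (fun i => pos (s i) 0 == 0%N)) /=.
rewrite (eq_bigr (fun i => c i * (d1 - 2^-1))) => [|i /andP[/andP[iL iJ] p0]]; last by rewrite (dE _ (k2 i iJ iL)) p0 (k2 i iJ iL).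
rewrite [X in _ + X](eq_bigr (fun i => c i * (d2 - 2^-1))) => [|i /andP[/andP[iL iJ] /negPf p0]]; last first.
  by rewrite (dE _ (k2 i iJ iL)) p0 (k2 i iJ iL).
rewrite -!mulr_suml; have := order_two_balanced c0 ext; rewrite -/k -/J => e.
have red (P : pred 'I_5) : \sum_(i < 5 | (i \notin L) && (i \in J) && P i) c i =
    \sum_(i in J | (k i == 2%N) && P i) c i.
  apply: eq_bigl => i; case iJ: (i \in J); rewrite ?andbF ?andbT //=; congr (_ && _).
  rewrite LE iJ /= -leqNgt eqn_leq; have : (1 < k i)%N by move: iJ; rewrite inE => /andP[].
  by move=> ->; rewrite andbT.
rewrite !red e -mulrDr [X in _ * X](_ : _ = 0) ?mulr0 //; lra.
Qed.

End Neutral.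

(** * Computable bounds for densities of order 4 in a permutation matrix *)

(** Binary numbers keep the later evaluations by [vm_compute] feasible. *)
Definition sum_bin (n : nat) (h : nat -> N) : N := foldr (fun a acc => N.add (h a) acc) 0%num (iota 0 n).

Lemma sum_binE (n : nat) (h : nat -> N) : (\sum_(a < n) N.to_nat (h a))%N = N.to_nat (sum_bin n h).
Proof.
rewrite -(big_mkord xpredT (fun a => N.to_nat (h a))) /sum_bin /index_iota subn0.
elim: (iota 0 n) => [|a s IH] /=; first by rewrite big_nil.
by rewrite big_cons IH N2Nat.inj_add.
Qed.

(* Summing over nondecreasing quadruples only keeps the evaluation short. *)
Definition sum_quads (n : nat) (g : nat -> nat -> nat -> nat -> N) : N :=
  sum_bin n (fun a => sum_bin n (fun b => if (a <= b)%N then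
    sum_bin n (fun c => if (b <= c)%N then
      sum_bin n (fun d => if (c <= d)%N then g a b c d else 0%num) else 0%num) else 0%num)).

Lemma sum_quadsE (n : nat) (g : nat -> nat -> nat -> nat -> N) :
  (\sum_(a < n) \sum_(b < n) \sum_(c < n) \sum_(d < n)
     (if [&& a <= b, b <= c & c <= d] then N.to_nat (g a b c d) else 0))%N = N.to_nat (sum_quads n g).
Proof.
rewrite /sum_quads -sum_binE; apply: eq_bigr => a _; rewrite -sum_binE; apply: eq_bigr => b _.
case: (a <= b)%N => /=; last by rewrite big1 // => c _; rewrite big1.
rewrite -sum_binE; apply: eq_bigr => c _; case: (b <= c)%N => /=; last by rewrite big1.
by rewrite -sum_binE; apply: eq_bigr => d _; case: (c <= d)%N.
Qed.

Section Quads.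
Variables (R : comNzRingType) (V : finType).

Lemma sum_ffun4 (F : {ffun 'I_4 -> V} -> R) : \sum_f F f =
  \sum_a \sum_b \sum_c \sum_d F [ffun i : 'I_4 => nth a [:: a; b; c; d] i].
Proof.
pose h (t : V * (V * (V * V))) : {ffun 'I_4 -> V} :=
  [ffun i : 'I_4 => nth t.1 [:: t.1; t.2.1; t.2.2.1; t.2.2.2] i].
have hb : bijective h.
  exists (fun f : {ffun 'I_4 -> V} => (f (inord 0), (f (inord 1), (f (inord 2), f (inord 3))))).
    by case=> a [b [c d]]; rewrite /h !ffunE /= !inordK.
  move=> f; apply/ffunP => i; rewrite ffunE /=.
  have := ltn_ord i; case e: (nat_of_ord i) => [|[|[|[|]]]] //= _;
    by congr (f _); apply: val_inj; rewrite /= inordK // e.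
rewrite (reindex h) /=; last exact: onW_bij.
rewrite -(pair_big predT predT (fun a t => F (h (a, t)))) /=; apply: eq_bigr => a _.
rewrite -(pair_big predT predT (fun b t => F (h (a, (b, t))))) /=; apply: eq_bigr => b _.
by rewrite -(pair_big predT predT (fun c d => F (h (a, (b, (c, d)))))).
Qed.

End Quads.

Section TieFour.
Variable R : realFieldType.

Definition seq_key (l : seq nat) (i : 'I_4) : int := (nth 0%N l i)%:Z.
Definition tie4 (l : seq nat) : R := tie R (seq_key l).

Definition o4 (i : nat) : 'I_4 := inord i.

Lemma ord4_cases (P : 'I_4 -> Prop) : P (o4 0) -> P (o4 1) -> P (o4 2) -> P (o4 3) -> forall i, P i.
Proof.
move=> h0 h1 h2 h3 i; have := ltn_ord i; case e: (nat_of_ord i) => [|[|[|[|]]]] // _.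
- by rewrite (_ : i = o4 0) //; apply: val_inj; rewrite /= inordK.
- by rewrite (_ : i = o4 1) //; apply: val_inj; rewrite /= inordK.
- by rewrite (_ : i = o4 2) //; apply: val_inj; rewrite /= inordK.
- by rewrite (_ : i = o4 3) //; apply: val_inj; rewrite /= inordK.
Qed.

Lemma seq_keyE a b c d : (seq_key [:: a; b; c; d] (o4 0) = a%:Z) * (seq_key [:: a; b; c; d] (o4 1) = b%:Z) *
  (seq_key [:: a; b; c; d] (o4 2) = c%:Z) * (seq_key [:: a; b; c; d] (o4 3) = d%:Z).
Proof. by rewrite /seq_key !inordK. Qed.

Lemma nondecr4 a b c d : nondecr (seq_key [:: a; b; c; d]) = [&& a <= b, b <= c & c <= d]%N.
Proof.
apply/nondecrP/and3P => [h|[ab bc cd] i j].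
  have h' i j : (i < 4)%N -> (j < 4)%N -> (i <= j)%N -> (nth 0 [:: a; b; c; d] i <= nth 0 [:: a; b; c; d] j)%N.
    by move=> hi hj ij; have := h (o4 i) (o4 j); rewrite /seq_key lez_nat !inordK // => /(_ ij).
  by split; [apply: (h' 0 1) | apply: (h' 1 2) | apply: (h' 2 3)].
rewrite /seq_key lez_nat; have := ltn_ord i; have := ltn_ord j.
by case: (nat_of_ord i) => [|[|[|[|]]]] //; case: (nat_of_ord j) => [|[|[|[|]]]] //= *; lia.
Qed.

Lemma tie4_strict a b c d : (a < b)%N -> (b < c)%N -> (c < d)%N -> tie4 [:: a; b; c; d] = 1.
Proof.
move=> ab bc cd; rewrite /tie4 /tie nondecr4 (ltnW ab) (ltnW bc) (ltnW cd).
suff -> : stab (seq_key [:: a; b; c; d]) = [set (1%g : 'S_4)] by rewrite cards1 divr1.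
apply/setP => t; rewrite in_set1; apply/stabP/eqP => [h|-> i]; last by rewrite perm1.
have kinj : injective (seq_key [:: a; b; c; d]).
  have U : uniq [:: a; b; c; d].
    rewrite /= !inE !negb_or (ltn_eqF ab) (ltn_eqF bc) (ltn_eqF cd) (ltn_eqF (ltn_trans ab bc)).
    by rewrite (ltn_eqF (ltn_trans bc cd)) (ltn_eqF (ltn_trans ab (ltn_trans bc cd))).
  by move=> i j [] /eqP; rewrite nth_uniq // => /eqP/val_inj.
by apply/permP => i; rewrite perm1; apply: kinj.
Qed.

Lemma stab_const k (c : 'I_k -> int) (A : {set 'I_k}) :
  (forall i j, i \in A -> j \in A -> c i = c j) -> (#|A|`! <= #|stab c|)%N.
Proof.
move=> cA; rewrite -card_perm; apply: subset_leq_card; apply/subsetP => t tA; apply/stabP => i.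
have [iA|iA] := boolP (i \in A); first by apply: cA => //; rewrite (perm_closed _ tA).
by rewrite (out_perm tA).
Qed.

Lemma stab_two_pairs (c : 'I_4 -> int) : c (o4 0) = c (o4 1) -> c (o4 2) = c (o4 3) -> (4 <= #|stab c|)%N.
Proof.
move=> c01 c23; pose t1 := tperm (o4 0) (o4 1); pose t2 := tperm (o4 2) (o4 3).
have ne i j : (i < 4)%N -> (j < 4)%N -> i != j -> o4 i != o4 j.
  by move=> hi hj; rewrite -val_eqE /= !inordK.
have t1E : (t1 (o4 0) = o4 1) * (t1 (o4 1) = o4 0) * (t1 (o4 2) = o4 2) * (t1 (o4 3) = o4 3).
  by rewrite /t1 tpermL tpermR !tpermD ?ne.
have t2E : (t2 (o4 0) = o4 0) * (t2 (o4 1) = o4 1) * (t2 (o4 2) = o4 3) * (t2 (o4 3) = o4 2).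
  by rewrite /t2 tpermL tpermR !tpermD ?ne.
apply: (size_le_card (f := fun t : 'S_4 => (t (o4 0), t (o4 2)))
  (L := [:: (o4 0, o4 2); (o4 1, o4 2); (o4 0, o4 3); (o4 1, o4 3)])).
  by rewrite /= !inE !xpair_eqE -!val_eqE /= !inordK.
move=> x; rewrite !inE => /or4P[] /eqP ->.
- by exists 1%g; rewrite ?perm1 //; apply/stabP => i; rewrite perm1.
- exists t1; rewrite ?t1E //; apply/stabP; apply: ord4_cases; by rewrite t1E.
- exists t2; rewrite ?t2E //; apply/stabP; apply: ord4_cases; by rewrite t2E.
- exists (t1 * t2)%g; rewrite ?permM ?t1E ?t2E //; apply/stabP; apply: ord4_cases; by rewrite permM ?t1E ?t2E.
Qed.

(* [24] times the value of [tie4] on a nondecreasing sequence. *)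
Definition tie_weight (a b c d : nat) : N :=
  match a == b, b == c, c == d with
  | false, false, false => 24
  | true, false, true => 6
  | true, true, true => 1
  | true, true, false | false, true, true => 4
  | _, _, _ => 12
  end%num.

(** An upper bound on [tie4] follows from a lower bound on the stabiliser, which contains the
    permutations within each block of equal entries. *)
Lemma tie4_le a b c d : tie4 [:: a; b; c; d] <=
  (if [&& a <= b, b <= c & c <= d]%N then N.to_nat (tie_weight a b c d) else 0%N)%:R / 24.
Proof.
rewrite /tie4 /tie nondecr4; case: ifP => _; last by rewrite !mul0r.
suff h : (24 <= N.to_nat (tie_weight a b c d) * #|stab (seq_key [:: a; b; c; d])|)%N.
  rewrite mul1r ler_pdivlMr // mulrC ler_pdivrMr ?stab_gt0 // -natrM.
  by rewrite ler_nat.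
have e := seq_keyE a b c d.
have pair i j : (i < j)%N -> (j < 4)%N -> seq_key [:: a; b; c; d] (o4 i) = seq_key [:: a; b; c; d] (o4 j) ->
    (2 <= #|stab (seq_key [:: a; b; c; d])|)%N.
  move=> ij j4 eij; have := @stab_const 4 (seq_key [:: a; b; c; d]) [set o4 i; o4 j].
  rewrite cards2 -val_eqE /= !inordK ?(ltn_trans ij) // (ltn_eqF ij) /=; apply => x y.
  by rewrite !inE => /orP[] /eqP -> /orP[] /eqP ->.
have triple i j l : (i < j)%N -> (j < l)%N -> (l < 4)%N -> seq_key [:: a; b; c; d] (o4 i) = seq_key [:: a; b; c; d] (o4 j) ->
    seq_key [:: a; b; c; d] (o4 j) = seq_key [:: a; b; c; d] (o4 l) ->
    (6 <= #|stab (seq_key [:: a; b; c; d])|)%N.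
  move=> ij jl l4 eij ejl; have := @stab_const 4 (seq_key [:: a; b; c; d]) [set o4 i; o4 j; o4 l].
  have -> : #|[set o4 i; o4 j; o4 l]| = 3.
    have j4 := ltn_trans jl l4; have i4 := ltn_trans ij j4.
    rewrite setUC cardsU1 cards2 !inE -!val_eqE /= !inordK //.
    by rewrite (ltn_eqF ij) (gtn_eqF jl) (gtn_eqF (ltn_trans ij jl)).
  apply => x y; rewrite !inE -!orbA => /or3P[] /eqP -> /or3P[] /eqP ->; rewrite ?eij ?ejl //.
have s1 : (1 <= #|stab (seq_key [:: a; b; c; d])|)%N by rewrite -(ltr0n R) stab_gt0.
rewrite /tie_weight; case: (eqVneq a b) => [ab|_]; case: (eqVneq b c) => [bc|_]; case: (eqVneq c d) => [cd|_].
- have := @stab_const 4 (seq_key [:: a; b; c; d]) setT; rewrite cardsT card_ord mul1n; apply.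
  move=> x y _ _; move: x; apply: ord4_cases; move: y; apply: ord4_cases; rewrite !e ?ab ?bc ?cd //.
- by have := triple 0 1 2 isT isT isT; rewrite !e ab bc => /(_ erefl erefl); lia.
- by have := @stab_two_pairs (seq_key [:: a; b; c; d]); rewrite !e ab cd => /(_ erefl erefl); lia.
- by have := pair 0 1 isT isT; rewrite !e ab => /(_ erefl); lia.
- by have := triple 1 2 3 isT isT isT; rewrite !e bc cd => /(_ erefl erefl); lia.
- by have := pair 1 2 isT isT; rewrite !e bc => /(_ erefl); lia.
- by have := pair 2 3 isT isT; rewrite !e cd => /(_ erefl); lia.
- by move: s1; lia.
Qed.

End TieFour.

Definition pos4 (t : permutation) : seq nat := [seq pos t v | v <- iota 0 4].

Section Grid.
Variables (R : realFieldType) (n : nat) (tau : seq nat).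

(* Equal masses on the points of the permutation matrix of [tau]. *)
Definition grid_mass (_ : 'I_n) : R := n%:R^-1.
Definition grid_x (i : 'I_n) : int := (i : nat)%:Z.
Definition grid_y (i : 'I_n) : int := (nth 0%N tau i)%:Z.

Definition grid_dens (t : permutation) : R := mdens grid_mass grid_x grid_y (tagged t).

Definition grid_values (p : seq nat) (q : seq nat) : seq nat := [seq nth 0%N tau (nth 0%N q v) | v <- p].

Lemma grid_densE (t : permutation) : perm_order t = 4%N ->
  grid_dens t = 24 * n%:R^-1 ^+ 4 * \sum_(a < n) \sum_(b < n) \sum_(c < n) \sum_(d < n)
    tie4 R [:: (a : nat); (b : nat); (c : nat); (d : nat)] *
    tie4 R (grid_values (pos4 t) [:: (a : nat); (b : nat); (c : nat); (d : nat)]).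
Proof.
case: t => k u; rewrite /perm_order /= => k4; subst k.
rewrite /grid_dens /mdens /= sum_ffun4 -[4`!]/24%N -mulrA; congr (_ * _).
rewrite mulr_sumr; apply: eq_bigr => a _; rewrite mulr_sumr; apply: eq_bigr => b _.
rewrite mulr_sumr; apply: eq_bigr => c _; rewrite mulr_sumr; apply: eq_bigr => d _.
rewrite /grid_mass prodr_const card_ord -mulrA; congr (_ * (_ * _)); apply: eq_tie => i.
  rewrite /= ffunE /grid_x /seq_key; congr (Posz _).
  by have := ltn_ord i; case: (nat_of_ord i) => [|[|[|[|]]]].
rewrite ffunE /grid_y /seq_key /grid_values /pos4; congr (Posz _).
have key (f : nat -> nat) : nth 0%N [:: f 0%N; f 1%N; f 2; f 3] i = f i.
  by have := ltn_ord i; case: (nat_of_ord i) => [|[|[|[|]]]].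
apply: etrans (esym (key (fun v => nth 0%N tau (nth 0%N [:: (a : nat); (b : nat); (c : nat); (d : nat)]
  (pos (existT (fun k => 'S_k) 4%N u) v))))).
rewrite (@pos_permV (existT (fun k => 'S_k) 4%N u)) /=; congr (nth _ _ _).
by have := ltn_ord (u^-1%g i); case: (nat_of_ord (u^-1%g i)) => [|[|[|[|]]]].
Qed.

Lemma grid_mass_ge0 a : 0 <= grid_mass a. Proof. by rewrite invr_ge0 ler0n. Qed.

Lemma grid_mass_sum : (0 < n)%N -> \sum_a grid_mass a = 1.
Proof. by move=> n0; rewrite sumr_const card_ord /grid_mass -[LHS]mulr_natr mulVf // pnatr_eq0 -lt0n. Qed.

Definition copy_test (p : seq nat) (a b c d : nat) : N :=
  if [&& a < b, b < c, c < d & sorted ltn (grid_values p [:: a; b; c; d])]%N then 1%num else 0%num.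

(** Keeps only quadruples of cells without ties, for which both tie weights are 1. *)
Lemma grid_dens_ge (t : permutation) : perm_order t = 4%N ->
  24 * n%:R^-1 ^+ 4 * (N.to_nat (sum_quads n (copy_test (pos4 t))))%:R <= grid_dens t.
Proof.
move=> t4; rewrite grid_densE //; apply: ler_wpM2l.
  by rewrite mulr_ge0 // exprn_ge0 // invr_ge0 ler0n.
rewrite -sum_quadsE natr_sum; apply: ler_sum => a _; rewrite natr_sum; apply: ler_sum => b _.
rewrite natr_sum; apply: ler_sum => c _; rewrite natr_sum; apply: ler_sum => d _.
have tt0 : 0 <= tie4 R [:: (a : nat); (b : nat); (c : nat); (d : nat)] *
    tie4 R (grid_values (pos4 t) [:: (a : nat); (b : nat); (c : nat); (d : nat)]).
  by rewrite mulr_ge0 // tie_ge0.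
case: ifP => // _; rewrite /copy_test; case: ifP => // /and4P[ab bc cd].
rewrite /grid_values /pos4 /= => /and4P[e1 e2 e3 _].
by rewrite !tie4_strict // mulr1.
Qed.

Definition pair_weight (p : seq nat) (a b c d : nat) : N :=
  match grid_values p [:: a; b; c; d] with
  | [:: a'; b'; c'; d'] => if [&& a' <= b', b' <= c' & c' <= d']%N
      then N.mul (tie_weight a b c d) (tie_weight a' b' c' d') else 0%num
  | _ => 0%num
  end.

(** The divisor 576 is 24^2, one factor for each [tie_weight]. *)
Lemma grid_dens_le (t : permutation) : perm_order t = 4%N ->
  grid_dens t <= 24 * n%:R^-1 ^+ 4 * ((N.to_nat (sum_quads n (pair_weight (pos4 t))))%:R / 576).
Proof.
move=> t4; rewrite grid_densE //; apply: ler_wpM2l.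
  by rewrite mulr_ge0 // exprn_ge0 // invr_ge0 ler0n.
rewrite -sum_quadsE.
do 4 (rewrite natr_sum mulr_suml; apply: ler_sum => ? _).
set a := (X in (X <= _)%N); set b := (X in [&& (a <= X)%N, _ & _]).
set c := (X in [&& _, (b <= X)%N & _]); set d := (X in [&& _, _ & (c <= X)%N]).
have h1 := tie4_le R a b c d.
pose q v := nth 0%N tau (nth 0%N [:: a; b; c; d] (pos t v)).
have h2 := tie4_le R (q 0) (q 1%N) (q 2) (q 3).
apply: le_trans (ler_pM (tie_ge0 _ _) (tie_ge0 _ _) h1 h2) _.
have -> : (576 : R) = 24 * 24 by rewrite -natrM.
rewrite /pair_weight /grid_values /= -/(q 0) -/(q 1%N) -/(q 2) -/(q 3).
case: ifP => _; last by rewrite !mul0r.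
rewrite mulf_div; case: ifP => _; last by rewrite mulr0.
by rewrite N2Nat.inj_mul multE natrM.
Qed.

End Grid.

Lemma pos4_mem (t : permutation) : perm_order t = 4%N -> pos4 t \in permutations (iota 0 4).
Proof.
move=> t4; rewrite mem_permutations perm_sym; apply: uniq_perm; first exact: iota_uniq.
  by rewrite map_inj_in_uniq ?iota_uniq // => a b; rewrite !mem_iota -t4 => /andP[_ ha] /andP[_ hb]; apply: pos_inj.
move=> x; rewrite mem_iota /=; apply/idP/mapP => [x4|[a]].
  exists (value t x); last by rewrite valueK // t4.
  by rewrite mem_iota -[X in (_ < X)%N]t4 value_lt // t4.
by rewrite mem_iota -t4 => /andP[_ a4] ->; rewrite pos_lt.
Qed.

(** * Order 4: the value is not a maximum *)

Section BlockPermutations.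
Local Open Scope nat_scope.

(* Permutations in which the pattern with value [v] in position [nth 0 p v]
   occurs often: at most three monotone blocks. *)
Definition block_perm (p : seq nat) : seq nat :=
  let base q :=
    if q == [:: 0; 1; 2; 3] then iota 0 5
    else if q == [:: 0; 1; 3; 2] then iota 0 4 ++ rev (iota 4 4)
    else if q == [:: 0; 2; 1; 3] then iota 0 5 ++ rev (iota 5 10) ++ iota 15 5
    else if q == [:: 0; 3; 2; 1] then iota 0 2 ++ rev (iota 2 6)
    else if q == [:: 0; 2; 3; 1] then iota 0 5 ++ iota 15 5 ++ iota 5 10
    else iota 0 5 ++ iota 10 10 ++ iota 5 5 in
  if nth 0 p 0 == 0 then base p else rev (base [seq 3 - v | v <- p]).

(** The inequality 24 N / n^4 > 1/6 with denominators cleared, where N counts the copies in the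
    block permutation. *)
Definition often (p : seq nat) : bool :=
  let tau := block_perm p in
  let n := size tau in
  (0 < n) && N.ltb (N.mul (N.mul (N.of_nat n) (N.of_nat n)) (N.mul (N.of_nat n) (N.of_nat n)))
    (N.mul 144 (sum_quads n (copy_test tau p))).

Lemma often_extreme : all (fun p => (nth 0 p 0 \in [:: 0; 3]) ==> often p) (permutations (iota 0 4)).
Proof. by vm_compute. Qed.


End BlockPermutations.

Lemma grid_dens_often (R : realFieldType) (t : permutation) : perm_order t = 4%N ->
  pos t 0 \in [:: 0; 3]%N -> let tau := block_perm (pos4 t) in
  (0 < size tau)%N /\ 6^-1 < grid_dens R (size tau) tau t.
Proof.
move=> t4 p0; have := allP often_extreme _ (pos4_mem t4).
rewrite -[nth 0%N (pos4 t) 0]/(pos t 0) p0 /= => /andP[n0 /N.ltb_lt h]; split=> //.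
apply: lt_le_trans (grid_dens_ge _ _ _ t4).
set n := size _ in n0 h *; set S := sum_quads _ _ in h *.
have {}h : (n * n * (n * n) < 144 * N.to_nat S)%N.
  have {h} : (N.to_nat (N.mul (N.mul (N.of_nat n) (N.of_nat n)) (N.mul (N.of_nat n) (N.of_nat n))) <
    N.to_nat (N.mul 144 S))%N by move: h; move: (N.mul (N.mul _ _) _) (N.mul 144 S) => u v; clear; lia.
  by rewrite !N2Nat.inj_mul Nat2N.id !multE.
have n4 : 0 < n%:R ^+ 4 :> R by rewrite exprn_gt0 // ltr0n.
rewrite exprVn mulrAC ltr_pdivlMr // mulrC ltr_pdivrMr; last by rewrite ltr0n.
rewrite -natrX -!natrM ltr_nat.
by move: h; rewrite !expnS expn0; lia.
Qed.

Section Large.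
Variables (R : rcfType) (c : 'I_5 -> R).
Hypothesis c0 : forall i, 0 <= c i.
Variable s : 'I_5 -> permutation.
Hypothesis ext : two_sided c s.
Let J := active c s.
Let k i := perm_order (s i).
Let L := [set i in J | (2 < k i)%N].
Let LE l : (l \in L) = (l \in J) && (2 < k l)%N. Proof. by rewrite [l \in L]in_set. Qed.
Let J5 : (#|J| <= 5)%N. Proof. by apply: leq_trans (max_card _) _; rewrite card_ord. Qed.
Let V := \sum_(i in L) c i.

Lemma large_four l : l \in L -> perm_order (s l) = 4%N.
Proof. exact: (order_four c0 ext). Qed.

Lemma large_gt0 l : l \in L -> 0 < c l.
Proof. by rewrite LE => /andP[]; rewrite inE => /andP[]. Qed.

Lemma large_sum_gt0 l : l \in L -> 0 < V.
Proof.
by move=> lL; rewrite /V (bigD1 l) //= ltr_pwDl ?large_gt0 // sumr_ge0 // => j /andP[/large_gt0/ltW].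
Qed.

Lemma weight_four l a : l \in L -> (a < 4)%N -> \sum_(i in L | pos (s i) 0 == a) c i = V / 4.
Proof.
move=> lL a4; have l4 := large_four lL.
by rewrite (position_weight c0 ext lL) -/(k l) [k l]l4.
Qed.

Lemma item_four l a : l \in L -> (a < 4)%N -> exists2 i, i \in L & pos (s i) 0 = a.
Proof. by move=> lL a4; apply: (position_item c0 ext lL); rewrite large_four. Qed.

Lemma excess_grid n tau : (0 < n)%N ->
  \sum_i c i * grid_dens R n tau (s i) - \sum_i c i / (k i)`!%:R =
  \sum_(i in L) c i * (grid_dens R n tau (s i) - 24^-1).
Proof.
move=> n0; have := @excess R c c0 s ext (grid_dens R n tau).
rewrite -/J -/k -/L => ->; last by move=> m _; apply: mdens_sum; exact: grid_mass_sum.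
by apply: eq_bigr => i iL; rewrite large_four.
Qed.

(** Two items at each end and one for each inner position would be six items. So at one of the ends
    a single item carries the whole weight V / 4 of that position. *)
Lemma single_extreme l : l \in L -> exists i, [/\ i \in L, pos (s i) 0 \in [:: 0; 3]%N & c i = V / 4].
Proof.
move=> lL.
have [x xL x0] := @item_four l 0 lL isT; have [z zL z1] := @item_four l 1 lL isT.
have [w wL w2] := @item_four l 2 lL isT; have [y yL y3] := @item_four l 3 lL isT.
have only i a : i \in L -> (a < 4)%N -> pos (s i) 0 = a -> (forall j, j \in L -> pos (s j) 0 = a -> j = i) -> c i = V / 4.
  move=> iL a4 ia h; rewrite -(weight_four lL a4) (big_pred1 i) // => j.
  by apply/andP/eqP => [[jL /eqP ja]|->]; [exact: h | rewrite iL ia eqxx].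
have [/existsP[x' /and3P[xL' /eqP x0' xx]]|no] := boolP [exists x', [&& x' \in L, pos (s x') 0 == 0%N & x' != x]]; last first.
  exists x; rewrite xL x0; split=> //; apply: (only x 0%N) => // j jL j0.
  by apply/eqP; apply: contraT => jx; case/existsP: no; exists j; rewrite jL j0 jx.
have [/existsP[y' /and3P[yL' /eqP y3' yy]]|no] := boolP [exists y', [&& y' \in L, pos (s y') 0 == 3%N & y' != y]]; last first.
  exists y; rewrite yL y3; split=> //; apply: (only y 3%N) => // j jL j0.
  by apply/eqP; apply: contraT => jx; case/existsP: no; exists j; rewrite jL j0 jx.
suff /leq_trans/(_ J5) : (6 <= #|J|)%N by [].
(* The boolean separates the second item at an end from the first one. *)
have U : uniq [:: (0%N, false); (0%N, true); (1%N, false); (2%N, false); (3%N, false); (3%N, true)] by [].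
apply: (size_le_card U (f := fun i => (pos (s i) 0, (i == x') || (i == y')))) => q.
have neq i j a b : pos (s i) 0 = a -> pos (s j) 0 = b -> a != b -> (i == j) = false.
  by move=> ia jb ab; apply/negbTE; apply: contraNneq ab => e; rewrite -ia -jb e.
have LJ i : i \in L -> i \in J by rewrite LE => /andP[].
rewrite !inE; case/or4P => [||| /or3P[]] /eqP ->.
- by exists x; rewrite ?LJ // x0 (neq _ _ _ _ x0 y3') // eq_sym (negPf xx).
- by exists x'; rewrite ?LJ // x0' eqxx.
- by exists z; rewrite ?LJ // z1 (neq _ _ _ _ z1 y3') // (neq _ _ _ _ z1 x0').
- by exists w; rewrite ?LJ // w2 (neq _ _ _ _ w2 y3') // (neq _ _ _ _ w2 x0').
- by exists y; rewrite ?LJ // y3 (neq _ _ _ _ y3 x0') // eq_sym (negPf yy).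
- by exists y'; rewrite ?LJ // y3' eqxx orbT.
Qed.

(** A pattern of weight V / 4 and density above 1/6 alone exceeds the mean V / 24, and the other
    terms are nonnegative. *)
Lemma not_maximal : extremal c s -> L = finset.set0.
Proof.
move=> mx; apply/eqP; apply: contraT => /set0Pn[l lL].
have [i [iL i0 iV]] := single_extreme lL.
have [n0 big] := grid_dens_often R (large_four iL) i0.
set n := size _ in n0 big; set tau := block_perm _ in big.
have := mx _ (@grid_mass R n) (@grid_x n) (@grid_y n tau) (@grid_mass_ge0 R n) (grid_mass_sum R n0).
rewrite -subr_le0 (excess_grid tau n0) leNgt => /negP[].
have d0 t : 0 <= grid_dens R n tau t.
  rewrite mulr_ge0 // sumr_ge0 // => f _; apply: mulr_ge0; last exact: tie_ge0.
  apply: mulr_ge0; last exact: tie_ge0.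
  by apply: prodr_ge0 => j _; exact: grid_mass_ge0.
under eq_bigr do rewrite mulrBr.
rewrite sumrB -mulr_suml -/V subr_gt0 (bigD1 i) //= iV.
have : 0 <= \sum_(j in L | j != i) c j * grid_dens R n tau (s j).
  by apply: sumr_ge0 => j /andP[/large_gt0/ltW cj _]; rewrite mulr_ge0.
have V0 := large_sum_gt0 lL.
have : V * 6^-1 < V * grid_dens R n tau (s i) by rewrite ltr_pM2l.
by move=> h1 h2; lra.
Qed.

End Large.

(** * Order 4: the value is not a minimum *)

Section Klein.
Local Open Scope nat_scope.

(** The normal Klein four-group of S_4. Its elements are involutions, so lists of positions and
    lists of values coincide. *)
Definition klein : seq (seq nat) := [:: [:: 0; 1; 2; 3]; [:: 1; 0; 3; 2]; [:: 2; 3; 0; 1]; [:: 3; 2; 1; 0]].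

(* Found by computer search: the total density of the four patterns in the
   corresponding grid is 153520 / 921984, just below 1 / 6. *)
Definition rare_perm : seq nat := [:: 3; 4; 7; 13; 12; 2; 6; 9; 11; 1; 0; 5; 8; 10].

Lemma rare_sum : N.ltb (foldr (fun p acc => N.add (sum_quads 14 (pair_weight rare_perm p)) acc) 0%num klein)
  (N.mul 4 (N.mul (N.mul 14 14) (N.mul 14 14))).
Proof. by vm_compute. Qed.

Definition swap01 (p q : seq nat) : bool := (nth 0 q 0 == nth 0 p 1) && (nth 0 q 1 == nth 0 p 0).

(** The coset reached from [klein] by exchanging the two lowest, or the two highest, values. *)
Definition half_klein : seq (seq nat) := [:: [:: 0; 1; 3; 2]; [:: 1; 0; 2; 3]; [:: 2; 3; 1; 0]; [:: 3; 2; 0; 1]].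

Lemma swap01_klein : all (fun p => all (fun q => [&& p \notin klein, swap01 p q & q \in klein] ==>
  (p \in half_klein)) (permutations (iota 0 4))) (permutations (iota 0 4)).
Proof. by vm_compute. Qed.

Lemma klein_first : all (fun p => (p \in klein) ==> (p == nth [::] klein (nth 0 p 0))) (permutations (iota 0 4)).
Proof. by vm_compute. Qed.


End Klein.

Section Minimal.
Variables (R : rcfType) (c : 'I_5 -> R).
Hypothesis c0 : forall i, 0 <= c i.
Variable s : 'I_5 -> permutation.
Hypothesis ext : two_sided c s.
Let J := active c s.
Let k i := perm_order (s i).
Let L := [set i in J | (2 < k i)%N].
Let LE l : (l \in L) = (l \in J) && (2 < k l)%N. Proof. by rewrite [l \in L]in_set. Qed.
Let LJ l : l \in L -> l \in J. Proof. by rewrite LE => /andP[]. Qed.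
Let J5 : (#|J| <= 5)%N. Proof. by apply: leq_trans (max_card _) _; rewrite card_ord. Qed.
Let V := \sum_(i in L) c i.
Let W q := \sum_(i in L | pos4 (s i) == q) c i.
Let perms := permutations (iota 0 4).

Let L4 l : l \in L -> k l = 4%N. Proof. exact: (large_four c0 ext). Qed.

Lemma sum_pos4 (P : pred (seq nat)) : \sum_(i in L | P (pos4 (s i))) c i = \sum_(q <- [seq q <- perms | P q]) W q.
Proof.
rewrite big_filter /W; under [RHS]eq_bigr do rewrite big_mkcondr.
rewrite [RHS]exchange_big [LHS]big_mkcondr /=; apply: eq_bigr => i iL.
have mi : pos4 (s i) \in perms by apply: pos4_mem; exact: L4.
rewrite big_mkcond (bigD1_seq (pos4 (s i))) //= ?permutations_uniq // eqxx [X in _ + X]big1 ?addr0 // => q qn.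
by rewrite eq_sym (negPf qn) if_same.
Qed.

Let rJ (P : pred (seq nat)) : \sum_(i in J | (k i == 4%N) && P (pos4 (s i))) c i = \sum_(q <- [seq q <- perms | P q]) W q.
Proof.
rewrite -sum_pos4; apply: eq_bigl => i; rewrite LE; case iJ: (i \in J) => //=.
have [k2|k2] := ltnP 2 (k i); last by rewrite /= eqn_leq [(4 <= _)%N]leqNgt (leq_ltn_trans k2) ?andbF.
by rewrite [k i]L4 ?LE ?iJ.
Qed.

Lemma bottom_four x y : \sum_(q <- [seq q <- perms | (nth 0%N q 0 == x) && (nth 0%N q 1 == y)]) W q =
  \sum_(q <- [seq q <- perms | (nth 0%N q 0 == y) && (nth 0%N q 1 == x)]) W q.
Proof.
have [J0|Jn] := eqVneq J finset.set0.
  by rewrite -!rJ J0 !big1 // => i; rewrite in_set0.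
have := bottom_zero c0 ext Jn 4 x y; rewrite /bnet /net => /eqP; rewrite subr_eq0 => /eqP.
by rewrite -!rJ.
Qed.

Lemma top_four x y : \sum_(q <- [seq q <- perms | (nth 0%N q 3 == x) && (nth 0%N q 2 == y)]) W q =
  \sum_(q <- [seq q <- perms | (nth 0%N q 3 == y) && (nth 0%N q 2 == x)]) W q.
Proof.
have [J0|Jn] := eqVneq J finset.set0.
  by rewrite -!rJ J0 !big1 // => i; rewrite in_set0.
have := bottom_zero c0 (two_sided_comp ext) Jn 4 x y; rewrite /bnet /net => /eqP; rewrite subr_eq0 => /eqP e.
rewrite -!rJ; apply: etrans (etrans e _); apply: eq_bigl => i; case iJ: (i \in J) => //=;
  have [t0 t1] := top_pos iJ; rewrite t0 t1 -[tag (s i)]/(k i) -/(k i); by case: eqP => //= ->.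
Qed.

(** For each half of the position pairs, the balance at the bottom and the balance at the top are
    two linear equations in four weights; their sum and difference give the equalities. *)
Lemma half_klein_weights :
  [/\ W [:: 0; 1; 2; 3]%N = W [:: 1; 0; 3; 2]%N, W [:: 3; 2; 1; 0]%N = W [:: 2; 3; 0; 1]%N,
      W [:: 0; 1; 3; 2]%N = W [:: 1; 0; 2; 3]%N & W [:: 2; 3; 1; 0]%N = W [:: 3; 2; 0; 1]%N].
Proof.
have se P Q l l' : \sum_(q <- [seq q <- perms | P q]) W q = \sum_(q <- [seq q <- perms | Q q]) W q ->
    perm_eq [seq q <- perms | P q] l && perm_eq [seq q <- perms | Q q] l' ->
    foldr (fun q acc => W q + acc) 0 l = foldr (fun q acc => W q + acc) 0 l'.
  by move=> e /andP[e1 e2]; move: e; rewrite (perm_big _ e1) (perm_big _ e2) /= unlock.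
have /(_ ltac:(by vm_compute)) E1 := se _ _ [:: [:: 0; 1; 2; 3]; [:: 0; 1; 3; 2]]%N
  [:: [:: 1; 0; 2; 3]; [:: 1; 0; 3; 2]]%N (bottom_four 0 1).
have /(_ ltac:(by vm_compute)) E2 := se _ _ [:: [:: 0; 1; 2; 3]; [:: 1; 0; 2; 3]]%N
  [:: [:: 0; 1; 3; 2]; [:: 1; 0; 3; 2]]%N (top_four 3 2).
have /(_ ltac:(by vm_compute)) E3 := se _ _ [:: [:: 3; 2; 1; 0]; [:: 3; 2; 0; 1]]%N
  [:: [:: 2; 3; 1; 0]; [:: 2; 3; 0; 1]]%N (bottom_four 3 2).
have /(_ ltac:(by vm_compute)) E4 := se _ _ [:: [:: 3; 2; 1; 0]; [:: 2; 3; 1; 0]]%N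
  [:: [:: 3; 2; 0; 1]; [:: 2; 3; 0; 1]]%N (top_four 0 1).
rewrite /= in E1 E2 E3 E4.
by split; move: E1 E2 E3 E4; move: (W _) (W _) (W _) (W _) (W _) (W _) (W _) (W _) => *; lra.
Qed.

Let W_item q : 0 < W q -> exists2 i, i \in L & pos4 (s i) = q.
Proof.
move=> w; have [i /andP[iL /eqP e]|no] := pickP [pred i in L | pos4 (s i) == q]; first by exists i.
by move: w; rewrite /W big_pred0 ?ltxx.
Qed.

Let item_W i : i \in L -> 0 < W (pos4 (s i)).
Proof.
move=> iL; rewrite /W (bigD1 i) /=; last by rewrite iL eqxx.
by rewrite ltr_pwDl ?(large_gt0 iL) // sumr_ge0 // => j /andP[/andP[/large_gt0/ltW]].
Qed.

Variables ia ib : 'I_5.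
Hypotheses (iaL : ia \in L) (ibL : ib \in L).
Hypotheses (iaE : pos4 (s ia) = [:: 0; 1; 2; 3]%N) (ibE : pos4 (s ib) = [:: 3; 2; 1; 0]%N).

Lemma klein_item q : q \in klein -> exists2 i, i \in L & pos4 (s i) = q.
Proof.
have [e1 e2 _ _] := half_klein_weights.
have wa := item_W iaL; have wb := item_W ibL; rewrite iaE in wa; rewrite ibE in wb.
by rewrite !inE => /or4P[] /eqP ->; apply: W_item; rewrite -?e1 -?e2.
Qed.

(* The four patterns of [klein] leave room for one more item, whose partner
   would be a sixth one. *)
Lemma all_klein i : i \in L -> pos4 (s i) \in klein.
Proof.
move=> iL; apply: contraT => iK.
suff [j jL /andP[jK ji]] : exists2 j, j \in L & (pos4 (s j) \notin klein) && (pos4 (s j) != pos4 (s i)).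
  suff /leq_trans/(_ J5) : (6 <= #|J|)%N by [].
  have U : uniq (pos4 (s i) :: pos4 (s j) :: klein) by rewrite /= inE negb_or eq_sym ji iK jK.
  apply: (size_le_card U (f := fun i => pos4 (s i))) => q; rewrite !in_cons.
  case/or3P => [/eqP ->|/eqP ->|/klein_item[l lL lq]]; [exists i | exists j | exists l] => //; exact: LJ.
have [j jJ [kj p0 p1]] := bottom_partner c0 ext (LJ iL).
have jL : j \in L by rewrite LE jJ -[k j]/(perm_order (s j)) kj -[perm_order (s i)]/(k i) (L4 iL).
have sw : swap01 (pos4 (s i)) (pos4 (s j)) by rewrite /swap01 /= p0 p1 !eqxx.
have mi : pos4 (s i) \in perms by apply: pos4_mem; exact: L4.
have mj : pos4 (s j) \in perms by apply: pos4_mem; exact: L4.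
have ne : pos4 (s j) != pos4 (s i).
  have [uv _ _] := active_pos (LJ iL); apply: contraNneq uv => /(congr1 (fun q => nth 0%N q 0)) /= <-.
  by rewrite p0.
have [jK|jK] := boolP (pos4 (s j) \in klein); last by exists j; rewrite ?jK.
have := allP (allP swap01_klein _ mi) _ mj; rewrite iK sw jK /=.
have [_ _ e3 e4] := half_klein_weights; have wi := item_W iL.
by rewrite !inE => /or4P[] /eqP e; rewrite e in wi *;
  [have [l lL le] := W_item (eq_ind _ (fun w => 0 < w) wi _ e3)
  |have [l lL le] := W_item (eq_ind _ (fun w => 0 < w) wi _ (esym e3))
  |have [l lL le] := W_item (eq_ind _ (fun w => 0 < w) wi _ e4)
  |have [l lL le] := W_item (eq_ind _ (fun w => 0 < w) wi _ (esym e4))]; exists l => //; rewrite le.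
Qed.

(** The Klein patterns have their lowest values in four different positions, so by [weight_four]
    each has weight V / 4. Their densities in the grid of [rare_perm] add up to less than 4/24. *)
Lemma not_minimal : ~ extremal (fun i => - c i) s.
Proof.
move=> mn.
have := mn _ (@grid_mass R 14) (@grid_x 14) (@grid_y 14 rare_perm) (@grid_mass_ge0 R 14) (@grid_mass_sum R 14 isT).
have neg (f : 'I_5 -> R) : \sum_i - c i * f i = - \sum_i c i * f i.
  by rewrite -sumrN; apply: eq_bigr => i _; rewrite mulNr.
rewrite !neg lerN2 -subr_ge0 -/(grid_dens R 14 rare_perm _) (@excess_grid R c c0 s ext 14 rare_perm isT) leNgt => /negP[].
pose S q := N.to_nat (sum_quads 14 (pair_weight rare_perm q)).
pose U q : R := 24 * 14^-1 ^+ 4 * ((S q)%:R / 576).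
have V0 : 0 < V := large_sum_gt0 c0 iaL.
have le i : i \in L -> c i * (grid_dens R 14 rare_perm (s i) - 24^-1) <=
    c i * (U (nth [::] klein (pos (s i) 0)) - 24^-1).
  move=> iL; apply: ler_wpM2l => //; rewrite lerD2r.
  have /eqP <- : pos4 (s i) == nth [::] klein (pos (s i) 0).
    by have := allP klein_first _ (pos4_mem (L4 iL)); rewrite all_klein.
  exact: grid_dens_le (L4 iL).
apply: le_lt_trans (ler_sum _ le) _.
have p4 i : i \in L -> (pos (s i) 0 < 4)%N by move=> iL; rewrite -(L4 iL) pos_lt // -/(k i) L4.
rewrite (partition_big (fun i => inord (pos (s i) 0) : 'I_4) predT) //=.
rewrite (eq_bigr (fun a : 'I_4 => V / 4 * (U (nth [::] klein a) - 24^-1))); last first.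
  move=> a _; rewrite -(weight_four c0 ext iaL (ltn_ord a)) mulr_suml; apply: eq_big => [i|i /andP[iL /eqP <-]].
    by case iL: (i \in L) => //=; rewrite -val_eqE /= inordK ?p4.
  by rewrite inordK ?p4.
rewrite -mulr_sumr pmulr_rlt0 ?divr_gt0 // !big_ord_recr big_ord0 /= add0r.
set q0 := [:: 0; 1; 2; 3]%N; set q1 := [:: 1; 0; 3; 2]%N; set q2 := [:: 2; 3; 0; 1]%N; set q3 := [:: 3; 2; 1; 0]%N.
have h : (S q0 + (S q1 + (S q2 + S q3)) < 4 * (14 * 14 * (14 * 14)))%N.
  have /N.ltb_lt := rare_sum; rewrite /klein -/q0 -/q1 -/q2 -/q3 /foldr N.add_0_r /S.
  move: (sum_quads _ _) (sum_quads _ _) (sum_quads _ _) (sum_quads _ _) => u0 u1 u2 u3; clear; lia.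
have {}h : (S q0)%:R + ((S q1)%:R + ((S q2)%:R + (S q3)%:R)) < 4 * (14 * 14 * (14 * 14)) :> R.
  by move: h; rewrite -(ltr_nat R) !natrD !natrM.
have e4 : 24 * 14^-1 ^+ 4 = 24 / (14 * 14 * (14 * 14)) :> R by field.
by rewrite /U e4; move: (S q0)%:R (S q1)%:R (S q2)%:R (S q3)%:R h => *; lra.
Qed.

End Minimal.

From mathcomp Require Import all_classical all_reals all_analysis.
Import numFieldNormedType.Exports.

(** * Interpolation: forcing implies extremality *)

Lemma is_copy_card (k n : nat) (s : 'S_k) (p : 'S_n) X : is_copy s p X -> #|X| = k.
Proof.
case/existsP => f /and3P[/forallP f1 /eqP-> _]; rewrite card_imset ?card_ord //.
move=> i j e; apply: val_inj.
have h a b : f a = f b -> ~~ (a < b)%N.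
  move=> ab; apply/negP => lt; have /forallP/(_ b)/implyP/(_ lt) := f1 a.
  by rewrite ab ltnn.
by have := h i j e; have := h j i (esym e); case: ltngtP.
Qed.

Lemma ncopies_le (k n : nat) (s : 'S_k) (p : 'S_n) : (ncopies s p <= 'C(n, k))%N.
Proof.
rewrite -[n in 'C(n, k)]card_ord -card_draws; apply: subset_leq_card.
by apply/fintype.subsetP => X; rewrite !inE => /is_copy_card->.
Qed.

(** Copies that avoid both [i] and [j] are unaffected; the other candidate sets number 'C(n, k) -
    'C(n - 2, k). *)
Lemma ncopies_tperm (k n : nat) (s : 'S_k) (p : 'S_n) (i j : 'I_n) :
  (ncopies s (tperm i j * p)%g <= ncopies s p + ('C(n, k) - 'C(n - 2, k)))%N.
Proof.
have [->|ij] := eqVneq i j; first by rewrite tperm1 mul1g leq_addr.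
rewrite -leq_subLR.
pose D := [set X : {set 'I_n} | X \subset ~: [set i; j] & #|X| == k].
have cD : #|D| = 'C(n - 2, k).
  by rewrite cards_draws cardsCs finset.setCK cards2 ij card_ord.
have DC : D \subset [set X : {set 'I_n} | #|X| == k].
  by apply/fintype.subsetP => X; rewrite !inE => /andP[].
apply: (@leq_trans #|[set X | is_copy s (tperm i j * p)%g X] :\: [set X | is_copy s p X]|).
  rewrite leq_subLR; apply: leq_trans (leq_card_setU _ _).
  by apply: subset_leq_card; apply/fintype.subsetP => X; rewrite !inE; case: (is_copy s p X).
rewrite -[n in 'C(n, k)]card_ord -card_draws -cD -cardsDS //.
apply: subset_leq_card; apply/fintype.subsetP => X; rewrite !inE => /andP[n1 n2].
rewrite (is_copy_card n2) eqxx !andbT.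
apply: contra n1 => sub.
have out a : a \in X -> tperm i j a = a.
  move=> aX; apply: tpermD; apply/eqP => e; move/fintype.subsetP/(_ a aX): sub;
  by rewrite !inE -e eqxx ?orbT.
case/existsP: n2 => f /and3P[f1 /eqP f2 /forallP f3]; apply/existsP; exists f.
rewrite f1 {1}f2 eqxx /=; apply/forallP => a; apply/forallP => b.
have /forallP/(_ b) := f3 a; rewrite !permM !out // f2 imset_f //.
Qed.

(** Bounds by 2 k / n the proportion of k-subsets meeting two given points, hence the effect of a
    transposition on a density. *)
Lemma bin_sub2_le (n k : nat) : (n * ('C(n, k) - 'C(n - 2, k)) <= 2 * k * 'C(n, k))%N.
Proof.
case: k => [|k]; first by rewrite !bin0 subnn muln0.
case: n => [|[|n]]; rewrite ?mul0n //.
  by rewrite mul1n; apply: leq_trans (leq_subr _ _) _; rewrite leq_pmull.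
rewrite subSS subSS subn0.
have -> : ('C(n.+2, k.+1) - 'C(n, k.+1) = 'C(n.+1, k) + 'C(n, k))%N.
  by rewrite binS binS; lia.
have := mul_bin_diag n.+2 k; rewrite /= => E.
have : ('C(n, k) <= 'C(n.+1, k))%N by rewrite leq_bin2l.
nia.
Qed.

Section Path.
Variable n : nat.
Implicit Types A B : 'S_n.

(** A walk from [A] to [B] whose step [t] gives position [t] its value under [B] by one
    transposition and leaves earlier positions alone; steps beyond [n] are idle. *)
Fixpoint perm_path A B (t : nat) : 'S_n :=
  if t is t'.+1 then
    let P := perm_path A B t' in
    if insub t' is Some i then (tperm i (P^-1 (B i)) * P)%g else P
  else A.

Lemma perm_path_agree A B t (j : 'I_n) : (j < t)%N -> perm_path A B t j = B j.
Proof.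
elim: t j => // t IH j; rewrite ltnS leq_eqVlt /=.
case: insubP => [i _ it|]; last by move=> nt /orP[/eqP e|/IH//]; rewrite -e ltn_ord in nt.
case/orP => [/eqP e|jt].
  have -> : j = i by apply: val_inj; rewrite /= e it.
  by rewrite permM tpermL permKV.
rewrite permM tpermD ?IH //.
  by apply/eqP => e; move: jt; rewrite -e -it ltnn.
apply/eqP => e; have := IH j jt; rewrite -e permKV => /perm_inj ij.
by move: jt; rewrite -e -ij it ltnn.
Qed.

Lemma perm_path_full A B : perm_path A B n = B.
Proof. by apply/permP => j; exact: perm_path_agree. Qed.

Lemma perm_path_const A B r t : (forall j : 'I_n, (j < r)%N -> A j = B j) ->
  (t <= r)%N -> perm_path A B t = A.
Proof.
move=> AB; elim: t => //= t IH tr; rewrite IH ?(ltnW tr) //.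
case: insubP => // i _ it; rewrite -AB ?it // permK tperm1 mul1g //.
Qed.

End Path.

Section Interpolate.
Variables (R : realType) (q : nat) (c : 'I_q -> R) (s : 'I_q -> permutation).

Definition lin (n : nat) (p : 'S_n) : R := lin_density c s (existT _ n p).

Lemma lin_def n (p : 'S_n) : lin p = \sum_i c i * density R (s i) (existT _ n p).
Proof. by []. Qed.

(** A Lipschitz constant: one transposition moves the combination by at most [lip] / n. *)
Definition lip : R := \sum_i `|c i| * (2 * perm_order (s i))%:R.

Lemma lip_ge0 : 0 <= lip.
Proof. by apply: sumr_ge0 => i _; rewrite mulr_ge0. Qed.

Lemma density_tperm (r : permutation) n (p : 'S_n) (i j : 'I_n) :
  `|density R r (existT _ n (tperm i j * p)%g) - density R r (existT _ n p)|
    <= (2 * perm_order r)%:R / n%:R.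
Proof.
case: r => k r; rewrite /density /perm_order /=.
case: leqP => kn; last by rewrite subrr normr0 divr_ge0.
have n0 : (0 < n)%N by case: (n) i => // -[].
have b0 : (0 < 'C(n, k))%N by rewrite bin_gt0.
rewrite -mulrBl normrM [X in _ * X]ger0_norm ?invr_ge0 // ler_pdivrMr ?ltr0n //.
rewrite mulrAC ler_pdivlMr ?ltr0n //.
have h1 := ncopies_tperm r p i j.
have := ncopies_tperm r (tperm i j * p)%g i j; rewrite mulgA tperm2 mul1g => h2.
have h3 := bin_sub2_le n k.
apply: (@le_trans _ _ (('C(n, k) - 'C(n - 2, k))%:R * n%:R)); last first.
  by rewrite -!natrM ler_nat mulnC.
apply: ler_wpM2r => //; rewrite ler_norml; apply/andP; split.
  by rewrite lerNl opprB lerBlDl -natrD ler_nat.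
by rewrite lerBlDl -natrD ler_nat.
Qed.

Lemma lin_tperm n (p : 'S_n) (i j : 'I_n) : `|lin (tperm i j * p)%g - lin p| <= lip / n%:R.
Proof.
rewrite !lin_def -sumrB; apply: le_trans (ler_norm_sum _ _ _) _.
rewrite mulr_suml; apply: ler_sum => a _; rewrite -mulrBr normrM -mulrA.
by apply: ler_wpM2l => //; exact: density_tperm.
Qed.

Lemma lin_path_step n (A B : 'S_n) t :
  `|lin (perm_path A B t.+1) - lin (perm_path A B t)| <= lip / n%:R.
Proof.
rewrite /=; case: insubP => [i _ _|_]; first exact: lin_tperm.
by rewrite subrr normr0 divr_ge0 ?lip_ge0.
Qed.

Lemma lin_path n (A B : 'S_n) t : `|lin (perm_path A B t) - lin A| <= t%:R * (lip / n%:R).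
Proof.
elim: t => [|t IH]; first by rewrite subrr normr0 mul0r.
rewrite -(subrKA (lin (perm_path A B t))) -natr1 mulrDl mul1r addrC.
by apply: le_trans (ler_normD _ _) _; apply: lerD => //; exact: lin_path_step.
Qed.

Lemma discrete_ivt (f : nat -> R) (a b : nat) (T e : R) : (a <= b)%N ->
  (forall t, `|f t.+1 - f t| <= e) -> T <= f a -> f b <= T ->
  exists2 t, (a <= t)%N & `|f t - T| <= e.
Proof.
move=> ab st fa fb.
have [d db] : exists d, b = (a + d)%N by exists (b - a)%N; lia.
subst b; elim: d a fa fb {ab} => [|d IH] a fa fb.
  exists a => //; rewrite addn0 in fb; have -> : f a = T by lra.
  by rewrite subrr normr0; apply: le_trans (st 0); exact: normr_ge0.
case: (leP T (f a.+1)) => h.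
  by have [|t at' ht] := IH a.+1 h; [rewrite addSnnS | exists t => //; exact: ltnW].
exists a => //; have := st a; rewrite !ler_norml; lra.
Qed.

(** Both ends are first made to fix the initial segment of length [r], in [r] steps each. The walk
    between the results keeps that segment and crosses the level [T] in steps of size at most [lip]
    / n. *)
Lemma interpolate n r (A B : 'S_n) (T : R) : (r <= n)%N ->
  T + r%:R * (lip / n%:R) <= lin A -> lin B <= T - r%:R * (lip / n%:R) ->
  exists2 p : 'S_n, forall i : 'I_n, (i < r)%N -> p i = i & `|lin p - T| <= lip / n%:R.
Proof.
move=> rn hA hB.
set A' := perm_path A 1 r; set B' := perm_path B 1 r.
have A'1 (i : 'I_n) : (i < r)%N -> A' i = i by move=> ir; rewrite /A' perm_path_agree // perm1.
have B'1 (i : 'I_n) : (i < r)%N -> B' i = i by move=> ir; rewrite /B' perm_path_agree // perm1.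
have AB (i : 'I_n) : (i < r)%N -> A' i = B' i by move=> ir; rewrite A'1 ?B'1.
have := lin_path A 1 r; have := lin_path B 1 r; rewrite -/A' -/B' !ler_norml => hB' hA'.
have [||t rt ht] := @discrete_ivt (fun t => lin (perm_path A' B' t)) r n T (lip / n%:R) rn
   (lin_path_step A' B').
- by rewrite (perm_path_const AB) //; lra.
- by rewrite perm_path_full; lra.
exists (perm_path A' B' t) => // i ir.
by rewrite perm_path_agree ?B'1 //; exact: leq_trans ir rt.
Qed.

End Interpolate.

Lemma ncopies_fixed (K n r : nat) (p : 'S_n) : (r <= n)%N ->
  (forall i : 'I_n, (i < r)%N -> p i = i) -> ('C(r, K) <= ncopies (1%g : 'S_K) p)%N.
Proof.
move=> rn pfix; rewrite ncopiesE -card_ltn_sorted_tuples.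
pose h (t : K.-tuple 'I_r) : {ffun 'I_K -> 'I_n} := [ffun i => widen_ord rn (tnth t i)].
have hinj : injective h.
  move=> t u /ffunP e; apply: eq_from_tnth => i; have := e i; rewrite !ffunE.
  by move/(congr1 val) => /= /val_inj.
rewrite -(card_imset _ hinj); apply: subset_leq_card; apply/fintype.subsetP => f.
case/imsetP => t; rewrite inE => /(sorted_ltn_nth ltn_trans 0%N) st ->.
have inc (i j : 'I_K) : (i < j)%N -> (tnth t i < tnth t j)%N.
  move=> ij; have := st i j; rewrite !inE size_map size_tuple => /(_ (ltn_ord i) (ltn_ord j) ij).
  by rewrite !(nth_map (tnth t i)) ?size_tuple // -!tnth_nth.
rewrite inE; apply/andP; split; apply/forallP => i; apply/forallP => j; rewrite !ffunE.
  by apply/implyP; exact: inc.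
rewrite !perm1 !pfix //=.
case: (ltngtP i j) => [/inc->//|/inc|/val_inj->]; last by rewrite ltnn.
by case: ltngtP.
Qed.

Lemma pow_lt_fact (a : nat) : exists K : nat, (a ^ K < K`!)%N.
Proof.
(* With M = a^2 + 1 one has a^(2M) < M^M <= (2M)!. *)
exists (2 * (a ^ 2).+1)%N; set M := (a ^ 2).+1.
have aM : (a ^ (2 * M) < M ^ M)%N.
  by rewrite expnM ltn_exp2r.
apply: (leq_trans aM).
have : forall d, (M ^ d <= (M + d)`!)%N.
  elim=> [|d IH]; first by rewrite fact_gt0.
  by rewrite expnS addnS factS leq_mul // leqW // leq_addr.
by move=> /(_ M); rewrite mul2n -addnn.
Qed.

Lemma exists_ge_mean (R : realFieldType) (T : finType) (f w : T -> R) :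
  (forall a, 0 <= w a) -> \sum_a w a = 1 -> exists a, \sum_b w b * f b <= f a.
Proof.
move=> w0 w1; apply: contrapT => /forallNP h.
have pos a : 0 < \sum_b w b * f b - f a by rewrite subr_gt0 ltNge; apply/negP; exact: h.
have E : \sum_a w a * (\sum_b w b * f b - f a) = 0.
  under eq_bigr do rewrite mulrBr.
  by rewrite sumrB -mulr_suml w1 mul1r subrr.
have z a : w a = 0.
  have := psumr_eq0P (fun b _ => mulr_ge0 (w0 b) (ltW (pos b))) E isT (i := a).
  by move/eqP; rewrite mulf_eq0 (gt_eqF (pos a)) orbF => /eqP.
by move/eqP: w1; rewrite big1 // eq_sym oner_eq0.
Qed.

Section Forcing.
Variables (R : realType) (q : nat) (c : 'I_q -> R) (s : 'I_q -> permutation).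

Let T : R := \sum_(i < q) c i / (perm_order (s i))`!%:R.

(** A fixed initial segment of length n / d contains 'C(n / d, K) increasing K-tuples, so the
    increasing pattern of order [K] keeps density at least (2d)^-K, which exceeds 1 / K! for a
    suitable [K]. *)
Lemma fixed_not_quasirandom (d : nat) (p : forall n, 'S_n) (N0 : nat) :
  (0 < d)%N ->
  (forall n, (N0 <= n)%N -> forall i : 'I_n, (i < n %/ d)%N -> p n i = i) ->
  ~ quasirandom R (fun n => existT _ n (p n)).
Proof.
move=> d0 pfix qr.
have [K hK] := pow_lt_fact (2 * d).
have := qr (existT (fun k => 'S_k) K (1%g : 'S_K)); rewrite /perm_order /=.
pose e : R := (((2 * d) ^ K)%:R)^-1.
have e0 : 0 < ((2 * d) ^ K)%:R :> R by rewrite ltr0n expn_gt0 muln_gt0 d0.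
have lt : (K`!%:R)^-1 < e.
  by rewrite /e ltf_pV2 ?ltr_nat // posrE ltr0n fact_gt0.
move=> cv.
have /cvgrPdist_lt/(_ (e - (K`!%:R)^-1)) := cv; rewrite subr_gt0 => /(_ lt) [N _ /= HN].
(* Large enough that n <= 2 d (r - K) for the length [r] of the fixed segment. *)
pose n := (maxn N0 (maxn N (2 * d * (K + 1))) + 1)%N.
have nN : (N <= n)%N by rewrite /n; lia.
have nN0 : (N0 <= n)%N by rewrite /n; lia.
have nd : (2 * d * (K + 1) < n)%N by rewrite /n; lia.
have := HN n nN; apply/negP; rewrite -leNgt.
rewrite distrC; apply: le_trans (ler_norm _).
rewrite lerB //.
have Kn : (K <= n)%N by nia.
rewrite /density /perm_order /= Kn.
set r := (n %/ d)%N.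
have rn : (r <= n)%N by apply: leq_div.
have rd : (n < (r + 1) * d)%N by rewrite addn1 /r -ltn_divLR.
have h := ncopies_fixed K rn (pfix n nN0).
rewrite ler_pdivlMr ?ltr0n ?bin_gt0 // mulrC ler_pdivrMr // -natrM ler_nat.
apply: leq_trans (leq_mul h (leqnn _)).
rewrite -(@leq_pmul2r K`!) ?fact_gt0 // bin_ffact mulnAC bin_ffact.
have up : forall a, (a ^_ K <= a ^ K)%N.
  move=> a; elim: (K) => // k IH; rewrite ffactnSr expnSr leq_mul // leq_subr //.
have low : forall a, (K <= a)%N -> ((a - K) ^ K <= a ^_ K)%N.
  move=> a Ka; have : forall k, (k <= K)%N -> ((a - K) ^ k <= a ^_ k)%N.
    elim=> // k IH kK; rewrite ffactnSr expnSr leq_mul ?IH ?(ltnW kK) //.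
    by rewrite leq_sub2l // ltnW.
  by apply.
have Kr : (K <= r)%N by nia.
apply: leq_trans (up n) _; apply: leq_trans (leq_mul (low r Kr) (leqnn _)).
rewrite -expnMn; case: (K) nd => [|k] nd; first by rewrite !expn0.
by rewrite leq_exp2r //; nia.
Qed.

(** Interpolation yields, for every large n, a permutation within [L] / n of [T] that fixes the
    first n / d points; the sequence has the right limit without being quasirandom. *)
Lemma not_forcing (e : R) (N0 : nat) : 0 < e ->
  (forall n, (N0 <= n)%N -> exists A : 'S_n, T + e <= lin c s A) ->
  (forall n, (N0 <= n)%N -> exists B : 'S_n, lin c s B <= T - e) ->
  ~ quasirandom_forcing c s.
Proof.
move=> e0 hA hB forc.
have L0 := lip_ge0 c s; set L := lip c s in L0.
(* Fixing the first n / d points costs at most [L] / d, which is below [e]. *)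
pose d := (Num.truncn (L / e)).+1.
have Ld : L / e < d%:R by rewrite /d; exact: truncnS_gt.
have d0 : (0 < d)%N by [].
have step n : (N0 <= n)%N -> (0 < n)%N -> {p : 'S_n | (forall i : 'I_n, (i < n %/ d)%N -> p i = i) &
    `|lin c s p - T| <= L / n%:R}.
  move=> nN n0; apply: cid2.
  have [A Ah] := hA n nN; have [B Bh] := hB n nN.
  have small : (n %/ d)%:R * (L / n%:R) <= e.
    rewrite mulrA ler_pdivrMr ?ltr0n //.
    have : L <= e * d%:R by rewrite mulrC -ler_pdivrMr // ltW.
    have : (n %/ d)%:R * d%:R <= n%:R :> R by rewrite -natrM ler_nat leq_trunc_div.
    move=> h1 h2; apply: le_trans (ler_wpM2l _ h2) _ => //.
    by rewrite mulrCA ler_wpM2l // ltW.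
  apply: (@interpolate R q c s n (n %/ d) A B T); first exact: leq_div.
    by apply: le_trans Ah; rewrite lerD2l.
  by apply: le_trans Bh _; rewrite lerD2l lerN2.
pose p n : 'S_n := if pselect (N0 < n)%N is left h
  then s2val (step n (ltnW h) (leq_ltn_trans (leq0n _) h)) else 1%g.
have pP n : (N0 < n)%N -> (forall i : 'I_n, (i < n %/ d)%N -> p n i = i) /\
    `|lin c s (p n) - T| <= L / n%:R.
  by rewrite /p; case: pselect => // h _; case: (step _ _ _).
apply: (@fixed_not_quasirandom d p N0.+1) => //.
  by move=> n /pP[].
apply: forc; first exact: cvg_id.
apply/cvgrPdist_le => eps eps0.
near=> n.
rewrite distrC; apply: (le_trans (proj2 (pP n _))); first by near: n; exact: nbhs_infty_gt.
rewrite ler_pdivrMr ?ltr0n; last by near: n; exact: nbhs_infty_gt.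
rewrite mulrC -ler_pdivrMr //.
by near: n; exact: nbhs_infty_ger.
Unshelve. all: by end_near.
Qed.

Definition upper (v : R) := exists N0, forall n, (N0 <= n)%N -> exists A : 'S_n, v <= lin c s A.
Definition lower (v : R) := exists N0, forall n, (N0 <= n)%N -> exists A : 'S_n, lin c s A <= v.

Lemma forcing_extremal : quasirandom_forcing c s ->
  (forall v, upper v -> v <= T) \/ (forall v, lower v -> T <= v).
Proof.
move=> forc; apply/or_asboolP; rewrite -[X in X || _]negbK -[X in _ || X]negbK -negb_and.
apply/negP => /andP[/asboolPn hu /asboolPn hl].
move/existsNP: hu => [u /not_implyP[[N1 uu] /negP]]; rewrite -ltNge => uT.
move/existsNP: hl => [l /not_implyP[[N2 ll] /negP]]; rewrite -ltNge => lT.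
apply: (@not_forcing (Num.min (u - T) (T - l)) (maxn N1 N2)) forc.
- by rewrite lt_min !subr_gt0 uT lT.
- move=> n; rewrite geq_max => /andP[/uu[A hA] _]; exists A; apply: le_trans hA.
  by rewrite -lerBrDl ge_min lexx.
- move=> n; rewrite geq_max => /andP[_ /ll[A hA]]; exists A; apply: (le_trans hA).
  by rewrite lerBrDl -lerBrDr ge_min lexx orbT.
Qed.

Section ModelBounds.
Variables (V : finType) (m : V -> R) (x y : V -> int).
Hypotheses (m0 : forall a, 0 <= m a) (m1 : \sum_a m a = 1).

Let P : R := \sum_i c i * mdens m x y (tagged (s i)).

Lemma expected_lin n : (forall i, (perm_order (s i) <= n)%N) ->
  \sum_o sample_weight m o * lin c s (sample x y o : 'S_n) = P.
Proof.
move=> kn.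
under eq_bigr do rewrite lin_def mulr_sumr.
rewrite exchange_big; apply: eq_bigr => i _ /=.
rewrite -(expected_density x y m1 _ (kn i)) mulr_sumr; apply: eq_bigr => o _.
by rewrite /density kn mulrCA.
Qed.

Lemma exists_order_bound : exists N, forall n, (N <= n)%N -> forall i, (perm_order (s i) <= n)%N.
Proof.
exists (\sum_i perm_order (s i))%N => n Nn i; apply: leq_trans Nn.
by rewrite (bigD1 i) //= leq_addr.
Qed.

(** The expected value over samples of order n is [P], so some sample reaches it. *)
Lemma upper_mdens : upper P.
Proof.
have [N kN] := exists_order_bound; exists N => n /kN kn.
have [w hw] := exists_ge_mean (fun w => lin c s (sample x y w : 'S_n))
  (@sample_weight_ge0 R V m m0 n) (sum_sample_weight m1 n).
by exists (sample x y w); rewrite -(expected_lin kn).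
Qed.

Lemma lower_mdens : lower P.
Proof.
have [N kN] := exists_order_bound; exists N => n /kN kn.
have [w hw] := exists_ge_mean (fun w => - lin c s (sample x y w : 'S_n))
  (@sample_weight_ge0 R V m m0 n) (sum_sample_weight m1 n).
exists (sample x y w); rewrite -(expected_lin kn) -lerN2; apply: le_trans hw.
by under [leRHS]eq_bigr do rewrite mulrN; rewrite sumrN.
Qed.

End ModelBounds.

End Forcing.

(** * Monotone permutations and the conclusion *)

Lemma incr_perm_id k (u : 'S_k) : (forall i j : 'I_k, (i < j)%N -> (u i < u j)%N) -> u = 1%g.
Proof.
move=> inc; have mono i j : (u j < u i)%N = (j < i)%N.
  apply/idP/idP => [|/inc //]; case: (ltngtP j i) => // [/inc|/val_inj ->]; last by rewrite ltnn.
  by case: ltngtP.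
apply/permP => i; apply: val_inj; rewrite perm1 /=.
rewrite -[LHS](card_ord_lt (ltnW (ltn_ord (u i)))) -[RHS](card_ord_lt (ltnW (ltn_ord i))).
rewrite -(card_preimset [set j : 'I_k | (j < u i)%N] (@perm_inj _ u)); apply: eq_card => j.
by rewrite !inE mono.
Qed.

Lemma ncopies_id k n (t : 'S_k) : t != 1%g -> ncopies t (1%g : 'S_n) = 0%N.
Proof.
move=> t1; apply/eqP; rewrite ncopiesE cards_eq0; apply/eqP/setP => f; rewrite finset.in_set0 finset.in_set.
apply/negbTE/negP => /andP[/forallP f1 /forallP f2]; case/eqP: t1; apply: incr_perm_id => i j ij.
have /forallP/(_ j)/implyP/(_ ij) := f1 i; have /forallP/(_ j)/eqP := f2 i.
by rewrite !perm1 => ->.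
Qed.

Lemma ncopies_flip k n (t : 'S_k) : t != flip k -> ncopies t (flip n) = 0%N.
Proof.
move=> t1; apply/eqP; rewrite ncopiesE cards_eq0; apply/eqP/setP => f; rewrite finset.in_set0 finset.in_set.
apply/negbTE/negP => /andP[/forallP f1 /forallP f2]; case/eqP: t1.
have -> : flip k = (flip k)^-1%g by rewrite flipV.
apply/eqP; rewrite eq_sym eq_invg_mul; apply/eqP.
suff h : (t * flip k)%g = 1%g.
  by apply: (mulIg (flip k)); rewrite -mulgA h mulg1 mul1g.
apply: incr_perm_id => i j ij; rewrite !permM !flipE /=.
have /forallP/(_ j)/implyP/(_ ij) := f1 i; have /forallP/(_ i)/eqP := f2 j.
rewrite !flipE /= => h fij; have h' : (t j < t i)%N.
  by rewrite -h ltn_sub2l // ?ltnS // (leq_ltn_trans _ (ltn_ord (f j))).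
by rewrite ltn_sub2l // ?ltnS // (leq_ltn_trans _ (ltn_ord (t i))).
Qed.

Lemma card_incr k n : #|[set f : {ffun 'I_k -> 'I_n} |
  [forall i : 'I_k, forall j : 'I_k, (i < j)%N ==> (f i < f j)%N]]| = 'C(n, k).
Proof.
have e : ncopies (1%g : 'S_k) (1%g : 'S_n) = #|[set f : {ffun 'I_k -> 'I_n} |
  [forall i : 'I_k, forall j : 'I_k, (i < j)%N ==> (f i < f j)%N]]|.
  rewrite ncopiesE; apply: eq_card => f; rewrite !finset.in_set; apply/andP/idP => [[] //|h].
  split=> //; apply/forallP => i; apply/forallP => j; rewrite !perm1.
  have inc (a b : 'I_k) : (a < b)%N -> (f a < f b)%N by have /forallP/(_ b)/implyP := forallP h a.
  by case: (ltngtP i j) => [/inc->//|/inc|/val_inj->]; rewrite ?ltnn //; case: ltngtP.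
apply/eqP; rewrite -e eqn_leq ncopies_le ncopies_fixed // => i _; exact: perm1.
Qed.

(** Every k-subset of positions forms exactly one pattern. *)
Lemma sum_ncopies k n (p : 'S_n) : (\sum_(t : 'S_k) ncopies t p = 'C(n, k))%N.
Proof.
rewrite -card_incr -sum1dep_card.
under [LHS]eq_bigr => t _ do rewrite ncopiesE -sum1dep_card big_mkcondr /=.
rewrite [LHS]exchange_big /=; apply: eq_bigr => f /forallP f1.
have finj : injective (fun i => (p (f i) : nat)%:Z).
  have inc (a b : 'I_k) : (a < b)%N -> (f a < f b)%N by have /forallP/(_ b)/implyP := f1 a.
  move=> i j [] /val_inj/perm_inj e; apply: val_inj.
  by case: (ltngtP i j) => // /inc; rewrite e ltnn.
have [t ht] := rank_perm finj.
rewrite (bigD1 t) //= [X in (_ + X)%N]big1 ?addn0 => [|u ut].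
  by case: ifP => // /negP[]; apply/forallP => i; apply/forallP => j; rewrite ht ltz_nat.
case: ifP => // /forallP hu; case/eqP: ut.
suff h : (t^-1 * u)%g = 1%g by apply: (mulgI t^-1%g); rewrite h mulVg.
apply: incr_perm_id => i j; rewrite !permM.
have /forallP/(_ (t^-1%g j))/eqP <- := hu (t^-1%g i).
by have := ht (t^-1%g i) (t^-1%g j); rewrite !permKV ltz_nat => ->.
Qed.

Section Density.
Variable R : realType.

Lemma density_sum k n (p : 'S_n) : (k <= n)%N ->
  \sum_(t : 'S_k) density R (existT _ k t) (existT _ n p) = 1.
Proof.
move=> kn; rewrite /density /perm_order /= kn -mulr_suml -natr_sum sum_ncopies mulfV //.
by rewrite pnatr_eq0 -lt0n bin_gt0.
Qed.

Lemma density_id k n (t : 'S_k) : t != 1%g ->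
  density R (existT _ k t) (existT _ n (1%g : 'S_n)) = 0.
Proof. by move=> t1; rewrite /density /= ncopies_id // mul0r if_same. Qed.

Lemma density_flip k n (t : 'S_k) : t != flip k ->
  density R (existT _ k t) (existT _ n (flip n)) = 0.
Proof. by move=> t1; rewrite /density /= ncopies_flip // mul0r if_same. Qed.

End Density.

Section Forcing.
Variables (R : realType) (c : 'I_5 -> R) (s : 'I_5 -> permutation).
Hypothesis c0 : forall i, 0 <= c i.
Let T := \sum_i c i / (perm_order (s i))`!%:R.
Let L := [set i in active c s | (2 < perm_order (s i))%N].

Lemma upper_extremal : (forall v, upper c s v -> v <= T) -> extremal c s.
Proof. by move=> h V m x y m0 m1; apply: h; exact: upper_mdens. Qed.

Lemma lower_extremal : (forall v, lower c s v -> T <= v) -> extremal (fun i => - c i) s.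
Proof.
move=> h V m x y m0 m1.
have e (f : 'I_5 -> R) : \sum_i - c i * f i = - \sum_i c i * f i.
  by rewrite -sumrN; apply: eq_bigr => i _; rewrite mulNr.
by rewrite !e lerN2; apply: h; exact: lower_mdens.
Qed.

Hypothesis ext : two_sided c s.

Lemma lin_excess n (p : 'S_n) : (2 <= n)%N ->
  lin c s p = T + \sum_(i in L) c i * (density R (s i) (existT _ n p) - (perm_order (s i))`!%:R^-1).
Proof.
move=> n2; rewrite -(@excess _ c c0 s ext (fun t => density R t (existT _ n p))) => [|k k2]; last first.
  by apply: density_sum; exact: leq_trans k2 n2.
by rewrite lin_def addrCA subrr addr0.
Qed.

(** Otherwise the combination equals [T] on every permutation of order at least 2, in particular
    along the identities, which are not quasirandom. *)
Lemma forcing_large : quasirandom_forcing c s -> L != finset.set0.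
Proof.
move=> forc; apply/eqP => L0.
apply: (@fixed_not_quasirandom R 1 (fun n => 1%g) 0) => // [n _ i _|]; first exact: perm1.
apply: forc; first by apply: cvg_id.
apply: cvg_near_cst; exists 2%N => // n n2; rewrite -[LHS]/(lin c s (1%g : 'S_n)).
by rewrite lin_excess // L0 big_set0 addr0.
Qed.

End Forcing.

Lemma pos4_id (t : permutation) : perm_order t = 4%N -> tagged t = 1%g -> pos4 t = [:: 0; 1; 2; 3]%N.
Proof.
case: t => k u; rewrite /perm_order /= => k4; subst k => /= ->.
have h (v : 'I_4) : pos (existT (fun k => 'S_k) 4%N 1%g) v = v by rewrite pos_permV /= invg1 perm1.
by rewrite /pos4 /= (h (Ordinal (isT : 0 < 4)%N)) (h (Ordinal (isT : 1 < 4)%N)) (h (Ordinal (isT : 2 < 4)%N)) (h (Ordinal (isT : 3 < 4)%N)).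
Qed.

Lemma pos4_flip (t : permutation) : perm_order t = 4%N -> tagged t = flip (tag t) -> pos4 t = [:: 3; 2; 1; 0]%N.
Proof.
case: t => k u; rewrite /perm_order /= => k4; subst k => /= ->.
have h (v : 'I_4) : pos (existT (fun k => 'S_k) 4%N (flip 4)) v = (4 - v.+1)%N.
  by rewrite pos_permV /= flipV flipE.
by rewrite /pos4 /= (h (Ordinal (isT : 0 < 4)%N)) (h (Ordinal (isT : 1 < 4)%N)) (h (Ordinal (isT : 2 < 4)%N)) (h (Ordinal (isT : 3 < 4)%N)).
Qed.

Section Lower.
Variables (R : realType) (c : 'I_5 -> R) (s : 'I_5 -> permutation).
Hypothesis c0 : forall i, 0 <= c i.
Let T := \sum_i c i / (perm_order (s i))`!%:R.
Let L := [set i in active c s | (2 < perm_order (s i))%N].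
Hypothesis low : forall v, lower c s v -> T <= v.

(** Meant for the identities and the reversals, which contain only one pattern of each order. If no
    item of [L] were such a pattern, the combination would fall below the minimum [T] by the
    positive amount [d]. *)
Lemma lower_witness (p : forall n, 'S_n) (g : forall k, 'S_k) :
  (forall k n (t : 'S_k), t != g k -> density R (existT _ k t) (existT _ n (p n)) = 0) ->
  L != finset.set0 -> exists2 i, i \in L & tagged (s i) = g (tag (s i)).
Proof.
move=> dens Ln; have ext : two_sided c s by right; exact: lower_extremal.
have [i /andP[iL /eqP ig]|no] := pickP [pred i in L | tagged (s i) == g (tag (s i))]; first by exists i.
exfalso; pose d := \sum_(i in L) c i / (perm_order (s i))`!%:R.
have d0 : 0 < d.
  have t0 i : i \in L -> 0 < c i / (perm_order (s i))`!%:R.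
    by move=> iL; rewrite divr_gt0 ?ltr0n ?fact_gt0 // (large_gt0 iL).
  have /finset.set0Pn[i iL] := Ln.
  by rewrite /d (bigD1 i) //= ltr_pwDl ?t0 // sumr_ge0 // => j /andP[/t0/ltW].
have : T <= T - d.
  apply: low; exists 2%N => n n2; exists (p n).
  rewrite (lin_excess c0 ext) // -/T -/L lerD2l /d -sumrN; apply: ler_sum => i iL.
  have := no i; rewrite /= iL /= => /negbT ig.
  have := dens _ n _ ig; case: (s i) => k t /= ->.
  by rewrite sub0r mulrN.
by rewrite lerBrDl gerDr leNgt d0.
Qed.

End Lower.

Theorem theorem1p2 (R : realType) (s : 'I_5 -> permutation) (c : 'I_5 -> R)
    (hc : forall i : 'I_5, 0 <= c i) :
  ~ quasirandom_forcing c s.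
Proof.
move=> forc; have [up|low] := forcing_extremal forc.
  have mx := upper_extremal up; have ext : two_sided c s by left.
  by have := forcing_large hc ext forc; rewrite (not_maximal hc ext mx) eqxx.
have mn := lower_extremal low; have ext : two_sided c s by right.
have Ln := forcing_large hc ext forc.
have [ia iaL ia1] := lower_witness hc low (@density_id R) Ln.
have [ib ibL ib1] := lower_witness hc low (@density_flip R) Ln.
have iaE := pos4_id (large_four hc ext iaL) ia1.
have ibE := pos4_flip (large_four hc ext ibL) ib1.
exact: (not_minimal hc ext iaL ibL iaE ibE).
Qed.
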